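(* Let the density-greedy algorithm for trees be as defined in the context. Then: (i) the algorithm can be implemented to run in time polynomial in the size of the instance when the input graph $G$ is a tree; (ii) for every instance in which $G$ is a tree, every $\alpha \geq \chi$ (where $\chi$ is the root eccentricity of that instance) and every $\mu \geq 1$, the output $\pi$ of the algorithm satisfies $\mu\, p(\textsc{Alg}(B+\alpha)) \geq p(\textsc{Opt}(B))$ for all $B \in \mathbb{R}_{\geq 0}$ (in particular $p(\textsc{Alg}(B+\chi)) \geq p(\textsc{Opt}(B))$ for all $B\ge 0$); (iii) conversely, the algorithm is not $(\alpha,\mu)$-competitive on trees for any finite $\mu\ge 1$ when $\alpha<\chi$: for every $\chi>0$ and every $\alpha\in[0,\chi)$ there is an instance in which $G$ is a tree with root eccentricity $\chi$ such that, for every $\mu \geq 1$, the output of the algorithm satisfies $\mu\, p(\textsc{Alg}(B+\alpha)) < p(\textsc{Opt}(B))$ for some $B \geq 0$.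
   Context: An instance consists of a finite undirected graph $G=(V,E)$, edge costs $c(e)>0$ for $e\in E$, vertex prizes $p(v)\ge 0$ for $v\in V$, and a root $r\in V$. For a subgraph $G'=(V',E')$ write $p(G')=\sum_{v\in V'}p(v)$ and $c(G')=\sum_{e\in E'}c(e)$. A rooted subtree is a subtree of $G$ containing $r$; $\mathcal{T}$ denotes the set of rooted subtrees. For $B\ge 0$, $\textsc{Opt}(B)$ is a rooted subtree maximizing $p(T)$ subject to $c(T)\le B$. Let $V^*=\{v: p(v)>0\}$. An incremental solution is a sequence $\pi=(e_1,\dots,e_l)$ of distinct edges such that for every $j\le l$ the edges $e_1,\dots,e_j$ together with $r$ form a rooted subtree, and the tree formed by all of $e_1,\dots,e_l$ spans $V^*$. For $B\ge0$, $\textsc{Alg}(B)$ denotes the rooted subtree formed by $r$ and the edges $e_i$ with $\sum_{j\le i}c(e_j)\le B$, where $\pi$ is the output of the algorithm under consideration. An algorithm is $(\alpha,\mu)$-competitive ($\alpha\ge0,\mu\ge1$) if for every instance its output satisfies $\mu\,p(\textsc{Alg}(B+\alpha))\ge p(\textsc{Opt}(B))$ for all $B\ge 0$. The root eccentricity is $\chi=\max_{v\in V}\ell(v)$, where $\ell(v)$ is the minimum cost of an $r$-$v$ path. Density: for a rooted subtree $T$ (of a graph with root $r$) with at least one edge, $d(T)=p(T)/c(T)$; the trivial tree $(\{r\},\emptyset)$ has density $0$. A min-max subtree is an inclusion-wise minimal rooted subtree among those of maximum density. Contraction: for a rooted subtree $\overline{T}$ of $G$, $G/\overline{T}$ is obtained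 by identifying all vertices of $\overline{T}$ with $r$ and deleting the edges of $\overline{T}$, keeping all other edges (as possible parallel edges or loops) with their costs; each edge of $G/\overline{T}$ corresponds to a unique edge of $G$ not in $\overline{T}$. Prizes are unchanged, except that the root gets prize $0$. Density-greedy algorithm for trees (input: tree $G$ with root $r$): set $\pi=()$, $\overline{T}=(\{r\},\emptyset)$. While the total prize of $G/\overline{T}$ is nonzero: choose an arbitrary min-max subtree $T^*$ of $G/\overline{T}$ (it has exactly one edge $e^*$ incident to $r$), append to $\pi$ the edge $e$ of $G$ corresponding to $e^*$, and add $e$ to $\overline{T}$. Output $\pi$. *)

(* Defs.v *)
From mathcomp Require Import all_boot all_order all_algebra.
From mathcomp Require Export reals.

Set Implicit Arguments.
Unset Strict Implicit.
Unset Printing Implicit Defensive.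

Import Order.TTheory GRing.Theory Num.Theory.
Local Open Scope ring_scope.

(* Rooted prize-collecting multigraphs.  The vertices are [vset I] and the
   edges [eset I], inside ambient finite types: contraction then stays in the
   same type and an edge of the contracted graph is literally an edge of the
   original one.  The scalars are the reals, or [rat] when an instance is the
   input of a program.  The order of the two ends of an edge is irrelevant. *)
Record instance (R : realFieldType) (V E : finType) := Instance {
  vset : {set V};
  eset : {set E};
  ends : E -> V * V;
  cost : E -> R;
  prize : V -> R;
  root : V
}.

Section Graphs.
Variables (R : realFieldType) (V E : finType).
Implicit Types (I : instance R V E) (T : {set V} * {set E}).

Definition valid I : Prop :=
  [/\ root I \in vset I,
      forall e, e \in eset I ->
        ((ends I e).1 \in vset I) /\ ((ends I e).2 \in vset I),
      forall e, e \in eset I -> 0 < cost I e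
    & forall v, v \in vset I -> 0 <= prize I v].

Definition joins I (e : E) (x y : V) : bool :=
  (ends I e == (x, y)) || (ends I e == (y, x)).

(* [s] lists the successive (edge traversed, vertex reached) of a walk from
   [x] to [y] that uses edges of [F] only. *)
Fixpoint walk I (F : {set E}) (x : V) (s : seq (E * V)) (y : V) : bool :=
  if s is (e, z) :: s' then [&& e \in F, joins I e x z & walk I F z s' y]
  else x == y.

(* Loops (length 1) and pairs of parallel edges (length 2) are cycles. *)
Definition is_cycle I (F : {set E}) (x : V) (s : seq (E * V)) : bool :=
  [&& s != [::], walk I F x s x, uniq (unzip1 s) & uniq (unzip2 s)].

Definition is_path I (x : V) (s : seq (E * V)) (y : V) : bool :=
  walk I (eset I) x s y && uniq (x :: unzip2 s).

Definition is_subgraph I T : Prop :=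
  [/\ T.1 \subset vset I, T.2 \subset eset I
    & forall e, e \in T.2 -> ((ends I e).1 \in T.1) /\ ((ends I e).2 \in T.1)].

Definition is_subtree I T : Prop :=
  [/\ is_subgraph I T,
      T.1 != set0,
      forall x y, x \in T.1 -> y \in T.1 -> exists s, walk I T.2 x s y
    & ~ exists x s, is_cycle I T.2 x s].

Definition rooted_subtree I T : Prop := is_subtree I T /\ root I \in T.1.

Definition is_tree I : Prop := is_subtree I (vset I, eset I).

Definition total_prize I T : R := \sum_(v in T.1) prize I v.
Definition total_cost I T : R := \sum_(e in T.2) cost I e.

Definition is_opt I (B : R) T : Prop :=
  [/\ rooted_subtree I T,
      total_cost I T <= B
    & forall T', rooted_subtree I T' -> total_cost I T' <= B ->
        total_prize I T' <= total_prize I T].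

Definition is_dist I (v : V) (d : R) : Prop :=
  (exists2 s, is_path I (root I) s v & d = \sum_(a <- s) cost I a.1) /\
  (forall s, is_path I (root I) s v -> d <= \sum_(a <- s) cost I a.1).

Definition is_ecc I (chi : R) : Prop :=
  (exists2 v, v \in vset I & is_dist I v chi) /\
  (forall v d, v \in vset I -> is_dist I v d -> d <= chi).

Definition density I T : R :=
  if T.2 == set0 then 0 else total_prize I T / total_cost I T.

Definition max_density I T : Prop :=
  rooted_subtree I T /\
  forall T', rooted_subtree I T' -> density I T' <= density I T.

Definition min_max_subtree I T : Prop :=
  max_density I T /\
  forall T', max_density I T' ->
    T'.1 \subset T.1 -> T'.2 \subset T.2 -> T' = T.

Definition contract I T : instance R V E :=
  let h v := if v \in T.1 then root I else v in
  {| vset := root I |: (vset I :\: T.1);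
     eset := eset I :\: T.2;
     ends := fun e => (h (ends I e).1, h (ends I e).2);
     cost := cost I;
     prize := fun v => if v == root I then 0 else prize I v;
     root := root I |}.

(* The subgraph formed by the root, the edges of [F] and their ends. *)
Definition formed_by I (F : {set E}) : {set V} * {set E} :=
  (root I |: [set v | [exists e in F, (v == (ends I e).1) || (v == (ends I e).2)]],
   F).

Definition contract_seq I (pi : seq E) : instance R V E :=
  contract I (formed_by I [set e in pi]).

Definition uncollected I (pi : seq E) : R :=
  \sum_(v in vset (contract_seq I pi)) prize (contract_seq I pi) v.

(* [dg_reach I pi]: [pi] is the value of the sequence after finitely many
   iterations of the loop, for some choice of min-max subtrees. *)
Inductive dg_reach I : seq E -> Prop :=
| dg_start : dg_reach I [::]
| dg_step pi T e :
    dg_reach I pi ->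
    uncollected I pi != 0 ->
    min_max_subtree (contract_seq I pi) T ->
    e \in T.2 ->
    (root I == (ends (contract_seq I pi) e).1)
      || (root I == (ends (contract_seq I pi) e).2) ->
    dg_reach I (rcons pi e).

Definition dg_output I (pi : seq E) : Prop :=
  dg_reach I pi /\ uncollected I pi = 0.

Definition alg I (pi : seq E) (B : R) : {set V} * {set E} :=
  formed_by I [set tnth (in_tuple pi) i | i : 'I_(size pi)
                 & \sum_(e <- take i.+1 pi) cost I e <= B].

End Graphs.

(* Model of computation: first-order recursive programs (pure LISP) on binary
   trees.  Functions are unary, [ECall f] calls the [f]-th one of the program;
   variables are de Bruijn indices, and [ECase] binds the head (index 0) and
   the tail (index 1) of a nonempty value.  Every rule costs one step and at
   most allocates one cell that points to existing ones, so that the time is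
   polynomially related to that of a Turing machine. *)
Inductive data : Type := DNil | DCons of data & data.

Inductive expr : Type :=
| EVar of nat
| ENil
| ECons of expr & expr
| ECase of expr & expr & expr
| ELet of expr & expr
| ECall of nat & expr.

Definition program := seq expr.

(* [eval P env e v t]: [e] evaluates to [v] in [t] steps; there is no such [t]
   if the evaluation diverges or refers to an undefined variable or function. *)
Inductive eval (P : program) : seq data -> expr -> data -> nat -> Prop :=
| eval_var env i :
    (i < size env)%N -> eval P env (EVar i) (nth DNil env i) 1
| eval_nil env :
    eval P env ENil DNil 1
| eval_cons env e1 e2 v1 v2 t1 t2 :
    eval P env e1 v1 t1 -> eval P env e2 v2 t2 ->
    eval P env (ECons e1 e2) (DCons v1 v2) (t1 + t2).+1
| eval_case_nil env e e1 e2 v t1 t2 :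
    eval P env e DNil t1 -> eval P env e1 v t2 ->
    eval P env (ECase e e1 e2) v (t1 + t2).+1
| eval_case_cons env e e1 e2 a b v t1 t2 :
    eval P env e (DCons a b) t1 -> eval P [:: a, b & env] e2 v t2 ->
    eval P env (ECase e e1 e2) v (t1 + t2).+1
| eval_let env e1 e2 v1 v t1 t2 :
    eval P env e1 v1 t1 -> eval P (v1 :: env) e2 v t2 ->
    eval P env (ELet e1 e2) v (t1 + t2).+1
| eval_call env f e a v t1 t2 :
    (f < size P)%N -> eval P env e a t1 -> eval P [:: a] (nth ENil P f) v t2 ->
    eval P env (ECall f e) v (t1 + t2).+1.

Definition computes (P : program) (input output : data) (t : nat) : Prop :=
  eval P [:: input] (ECall 0 (EVar 0)) output t.

Fixpoint dsize (d : data) : nat :=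
  if d is DCons a b then (dsize a + dsize b).+1 else 1%N.

Definition enc_seq (s : seq data) : data := foldr DCons DNil s.

Definition enc_bool (b : bool) : data := if b then DCons DNil DNil else DNil.

(* Binary, least significant bit first, no leading zero. *)
Fixpoint pos_bits (p : BinNums.positive) : seq bool :=
  match p with
  | BinNums.xH => [:: true]
  | BinNums.xO q => false :: pos_bits q
  | BinNums.xI q => true :: pos_bits q
  end.

Definition enc_nat (n : nat) : data :=
  if bin_of_nat n is BinNums.Npos p then enc_seq (map enc_bool (pos_bits p))
  else DNil.

(* Only used for nonnegative numbers, hence without a sign. *)
Definition enc_rat (q : rat) : data :=
  DCons (enc_nat `|numq q|%N) (enc_nat `|denq q|%N).

Definition enc_elt (T : finType) (x : T) : data := enc_nat (enum_rank x).

Definition enc_instance (V E : finType) (I : instance rat V E) : data :=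
  DCons (enc_elt (root I))
    (DCons (enc_seq [seq DCons (enc_elt v) (enc_rat (prize I v))
                    | v <- enum (vset I)])
           (enc_seq [seq DCons (enc_elt e)
                       (DCons (DCons (enc_elt (ends I e).1)
                                     (enc_elt (ends I e).2))
                              (enc_rat (cost I e)))
                    | e <- enum (eset I)])).

Definition enc_output (E : finType) (pi : seq E) : data :=
  enc_seq (map (@enc_elt E) pi).

(* Main.v *)
(* On a tree, rooted subtrees are the edge sets closed under taking the parent
   edge, and they are stable under unions and intersections.

   (ii) Once the first edge of a min-max subtree T of density d has been taken,
   the rest of T has density more than d, and every later min-max subtree lies
   inside T until T is exhausted.  Hence the output splits into blocks of
   decreasing density, and the union X of the first blocks maximizes p - d c for
   the density d of the next block T.  If the budget runs out inside T at an edge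
   e, then, recursively, the part of T collected so far has prize at least d times
   the cost of its edges that are not on the path from the root to e, and that
   path costs at most chi.

   (iii) In a star with two leaves of costs chi and eps < chi - alpha, a large
   prize on the expensive leaf makes it come first, and the budget eps then
   collects nothing.

   (i) For a given a, eliminating the leaves from the bottom up, merging a leaf
   into its parent exactly when its weight p - a c is positive, computes a
   maximizer of p - a c.  Dinkelbach's iteration replaces a by the density of
   this maximizer until the maximizer is empty; the maximizers are nested, so
   that there are at most as many iterations as edges.  All numbers that occur are
   sums over sets of input numbers, hence have polynomial size. *)
Require Import Defs.
From mathcomp Require Import all_boot all_order all_algebra.
From mathcomp Require Import zify ring lra.
Import Defs.

Set Implicit Arguments.
Unset Strict Implicit.
Unset Printing Implicit Defensive.

Import Order.TTheory GRing.Theory Num.Theory.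

(** * Polynomially bounded functions *)

Section PolyBound.
Local Open Scope nat_scope.

(** No program is written out for the time bound. The functions satisfying [ptime] are closed under
    pairing, case distinction, composition and loops over lists, and the program is assembled from
    these closures. A fast loop may still build a huge shared value, so every loop comes with a
    bound on its accumulator. This is why no ratio is computed from an earlier one: each is a pair
    of sums over the input.

    Walks and cycles are dealt with once. A tree becomes a list of oriented edges ([arb]), rooted
    subtrees become edge sets, and the list of a contraction is a sublist, so that all contractions
    are compared inside the original tree.

    The program does not have to find a min-max subtree, only an edge that may be taken from one:
    every root edge of a subtree of positive maximum density lies in some min-max subtree.

    For the guarantee, the block of density d in which the budget ends gives two inequalities with
    the same multiplier d: an upper bound on the optimum, from the maximality of the earlier blocks,
    and a lower bound on the prize collected since. Adding them cancels the cost of the earlier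
    blocks. *)

Definition pb (A : Type) (n g : A -> nat) : Prop :=
  exists k, forall x, g x <= (n x).+2 ^ k.

Section Closure.
Variables (A : Type) (n : A -> nat).
Implicit Types g h : A -> nat.

Lemma pb_le g h : (forall x, g x <= h x) -> pb n h -> pb n g.
Proof.
by move=> le [k hk]; exists k => x; apply: leq_trans (le x) (hk x).
Qed.

Lemma pb_self : pb n n.
Proof. by exists 1 => x; rewrite expn1 -addn2 leq_addr. Qed.

Lemma pb_const c : pb n (fun=> c).
Proof.
exists c => x; apply: leq_trans (_ : 2 ^ c <= _).
  by apply: ltnW; apply: ltn_expl.
by case: c => // c; rewrite leq_exp2r.
Qed.

Lemma pb_mul g h : pb n g -> pb n h -> pb n (fun x => g x * h x).
Proof. by move=> [k hk] [l hl]; exists (k + l) => x; rewrite expnD leq_mul. Qed.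

Lemma pb_add g h : pb n g -> pb n h -> pb n (fun x => g x + h x).
Proof.
move=> [k hk] [l hl]; exists (k + l).+1 => x; set m := (n x).+2.
have m_gt0 : 0 < m by [].
apply: leq_trans (_ : m ^ (k + l) * 2 <= _); last first.
  by rewrite expnS mulnC leq_mul2r orbC.
rewrite muln2 -addnn leq_add //.
  by apply: leq_trans (hk x) _; rewrite leq_pexp2l // leq_addr.
by apply: leq_trans (hl x) _; rewrite leq_pexp2l // leq_addl.
Qed.

Lemma pb_succ g : pb n g -> pb n (fun x => (g x).+1).
Proof.
move=> hg; apply: pb_le (pb_add hg (pb_const 1)) => x.
by rewrite addn1.
Qed.

Lemma pb_exp g k : pb n g -> pb n (fun x => g x ^ k).
Proof.
move=> hg; elim: k => [|k IH]; first exact: pb_const.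
by apply: pb_le (pb_mul hg IH) => x; rewrite expnS.
Qed.

(** Composition of polynomials, where [f] changes the type on which sizes are measured. *)
Lemma pb_bound (B : Type) (m h : B -> nat) g (f : A -> B) :
  pb m h -> pb n g -> (forall x, m (f x) <= g x) -> pb n (fun x => h (f x)).
Proof.
move=> [k hk] hg le; apply: pb_le (pb_exp k (pb_succ (pb_succ hg))) => x.
by apply: leq_trans (hk _) _; case: k {hk} => // k; rewrite leq_exp2r // !ltnS.
Qed.

End Closure.
End PolyBound.

(** * Polynomial-time functions *)

Fixpoint shift (n : nat) (e : expr) : expr :=
  match e with
  | EVar i => EVar i
  | ENil => ENil
  | ECons e1 e2 => ECons (shift n e1) (shift n e2)
  | ECase e0 e1 e2 => ECase (shift n e0) (shift n e1) (shift n e2)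
  | ELet e1 e2 => ELet (shift n e1) (shift n e2)
  | ECall f e0 => ECall (n + f) (shift n e0)
  end.

Section EvalWeakening.
Local Open Scope nat_scope.
Variables P Q : program.

(** De Bruijn indices count from the front, so entries appended at the back are not seen. An
    expression written for a single input can thus be inlined under binders, once its input has been
    rebound at index 0. *)
Lemma eval_env env env' e v t :
  eval P env e v t -> eval P (env ++ env') e v t.
Proof.
elim=> {env e v t}.
- move=> env i lti.
  have -> : nth DNil env i = nth DNil (env ++ env') i by rewrite nth_cat lti.
  by apply: eval_var; rewrite size_cat ltn_addr.
- by move=> env; apply: eval_nil.
- by move=> env e1 e2 v1 v2 t1 t2 _ h1 _ h2; apply: eval_cons.
- by move=> env e e1 e2 v t1 t2 _ h1 _ h2; apply: eval_case_nil.
- by move=> env e e1 e2 a b v t1 t2 _ h1 _ h2; apply: eval_case_cons h1 h2.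
- by move=> env e1 e2 v1 v t1 t2 _ h1 _ h2; apply: eval_let h1 h2.
- by move=> env f e a v t1 t2 ltf _ h1 ev _; apply: eval_call h1 ev.
Qed.

Lemma eval_catr env e v t : eval P env e v t -> eval (P ++ Q) env e v t.
Proof.
elim=> {env e v t}.
- by move=> env i lti; apply: eval_var.
- by move=> env; apply: eval_nil.
- by move=> env e1 e2 v1 v2 t1 t2 _ h1 _ h2; apply: eval_cons.
- by move=> env e e1 e2 v t1 t2 _ h1 _ h2; apply: eval_case_nil.
- by move=> env e e1 e2 a b v t1 t2 _ h1 _ h2; apply: eval_case_cons h1 h2.
- by move=> env e1 e2 v1 v t1 t2 _ h1 _ h2; apply: eval_let h1 h2.
- move=> env f e a v t1 t2 ltf _ h1 _ h2; apply: eval_call h1 _.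
    by rewrite size_cat ltn_addr.
  by rewrite nth_cat ltf.
Qed.

Lemma eval_shift env e v t :
  eval P env e v t ->
  eval (Q ++ map (shift (size Q)) P) env (shift (size Q) e) v t.
Proof.
elim=> {env e v t}.
- by move=> env i lti; apply: eval_var.
- by move=> env; apply: eval_nil.
- by move=> env e1 e2 v1 v2 t1 t2 _ h1 _ h2; apply: eval_cons.
- by move=> env e e1 e2 v t1 t2 _ h1 _ h2; apply: eval_case_nil.
- by move=> env e e1 e2 a b v t1 t2 _ h1 _ h2; apply: eval_case_cons h1 h2.
- by move=> env e1 e2 v1 v t1 t2 _ h1 _ h2; apply: eval_let h1 h2.
- move=> env f e a v t1 t2 ltf _ h1 _ h2; apply: eval_call h1 _.
    by rewrite size_cat size_map ltn_add2l.
  by rewrite nth_cat ltnNge leq_addr /= addKn (nth_map ENil).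
Qed.

End EvalWeakening.

(** Encodings are inferred from types and use the same pieces as [enc_instance] and [enc_output], so
    that the latter are recovered by unfolding. *)
Class Enc (A : Type) := enc : A -> data.

#[global] Instance enc_of_bool : Enc bool := enc_bool.
#[global] Instance enc_of_nat : Enc nat := enc_nat.
#[global] Instance enc_of_prod (A B : Type) {EA : Enc A} {EB : Enc B} :
  Enc (A * B) := fun x => DCons (enc x.1) (enc x.2).
#[global] Instance enc_of_seq (A : Type) {EA : Enc A} : Enc (seq A) :=
  fun s => enc_seq (map enc s).

Definition sz (A : Type) {EA : Enc A} (x : A) : nat := dsize (enc x).
Arguments sz {A EA} x.

Section PTime.
Local Open Scope nat_scope.

Definition runs {A B : Type} {EA : Enc A} {EB : Enc B}
    (P : program) (e : expr) (f : A -> B) (T : A -> nat) : Prop :=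
  forall x, exists2 t, t <= T x & eval P [:: enc x] e (enc (f x)) t.

(* Sharing makes the output size exponential in the running time in general,
   so it is bounded separately. *)
Definition ptime {A B : Type} {EA : Enc A} {EB : Enc B} (f : A -> B) : Prop :=
  pb sz (fun x => sz (f x)) /\
  exists P e T, pb (sz : A -> nat) T /\ runs P e f T.

(** A combinator needs both functions inside one program: the second is appended to the first and
    its calls are renumbered. *)
Lemma ptime_common {A B A' B' : Type} {EA : Enc A} {EB : Enc B}
    {EA' : Enc A'} {EB' : Enc B'} (f : A -> B) (g : A' -> B') :
  ptime f -> ptime g ->
  exists P ef Tf eg Tg,
    [/\ pb (sz : A -> nat) Tf, pb (sz : A' -> nat) Tg, runs P ef f Tf & runs P eg g Tg].
Proof.
move=> [_ [P [ef [Tf [pf rf]]]]] [_ [Q [eg [Tg [pg rg]]]]].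
exists (P ++ map (shift (size P)) Q), ef, Tf, (shift (size P) eg), Tg.
split=> // x.
  by have [t tT ev] := rf x; exists t => //; apply: eval_catr.
by have [t tT ev] := rg x; exists t => //; apply: eval_shift.
Qed.

Context {A B C : Type} {EA : Enc A} {EB : Enc B} {EC : Enc C}.

Lemma ptime_ext (f g : A -> B) : f =1 g -> ptime f -> ptime g.
Proof.
move=> fg [sf [P [e [T [pT rf]]]]]; split.
  by apply: pb_le sf => x; rewrite fg.
by exists P, e, T; split=> // x; rewrite -fg.
Qed.

Lemma ptime_id : ptime (@id A).
Proof.
split; first exact: pb_self.
exists [::], (EVar 0), (fun=> 1); split; first exact: pb_const.
by move=> x; exists 1 => //; apply: (@eval_var _ [:: enc x] 0).
Qed.

Fixpoint quote (d : data) : expr :=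
  if d is DCons d1 d2 then ECons (quote d1) (quote d2) else ENil.

Lemma eval_quote P env d : eval P env (quote d) d (dsize d).
Proof. by elim: d => [|d1 h1 d2 h2] /=; [apply: eval_nil|apply: eval_cons]. Qed.

Lemma ptime_const (y : B) : ptime (fun _ : A => y).
Proof.
split; first exact: pb_const.
exists [::], (quote (enc y)), (fun=> sz y); split; first exact: pb_const.
by move=> x; exists (sz y) => //; apply: eval_quote.
Qed.

Lemma ptime_comp (g : B -> C) (f : A -> B) :
  ptime g -> ptime f -> ptime (fun x => g (f x)).
Proof.
move=> pg pf; have [P [ef [Tf [eg [Tg [pTf pTg rf rg]]]]]] := ptime_common pf pg.
have [sf _] := pf; have [sg _] := pg; split.
  by apply: (pb_bound (f := f) sg sf).
exists P, (ELet ef eg), (fun x => (Tf x + Tg (f x)).+1); split.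
  by apply/pb_succ/pb_add => //; apply: (pb_bound (f := f) pTg sf).
move=> x; have [t1 le1 ev1] := rf x; have [t2 le2 ev2] := rg (f x).
exists (t1 + t2).+1; first by rewrite ltnS leq_add.
by apply: eval_let ev1 _; apply: (eval_env [:: enc x]) ev2.
Qed.

Lemma ptime_pair (f : A -> B) (g : A -> C) :
  ptime f -> ptime g -> ptime (fun x => (f x, g x)).
Proof.
move=> pf pg; have [P [ef [Tf [eg [Tg [pTf pTg rf rg]]]]]] := ptime_common pf pg.
have [sf _] := pf; have [sg _] := pg; split; first exact/pb_succ/pb_add.
exists P, (ECons ef eg), (fun x => (Tf x + Tg x).+1); split.
  exact/pb_succ/pb_add.
move=> x; have [t1 le1 ev1] := rf x; have [t2 le2 ev2] := rg x.
by exists (t1 + t2).+1; [rewrite ltnS leq_add|apply: eval_cons].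
Qed.

Lemma ptime_fst : ptime (@fst A B).
Proof.
split.
  by apply: pb_le (pb_self _) => -[a b]; rewrite {2}/sz /= leqW // leq_addr.
exists [::], (ECase (EVar 0) ENil (EVar 0)), (fun=> 3); split.
  exact: pb_const.
move=> [a b]; exists 3 => //; apply: (@eval_case_cons _ _ _ _ _ (enc a) (enc b) _ 1 1).
  exact: (@eval_var _ [:: _] 0).
exact: (@eval_var _ [:: _; _; _] 0).
Qed.

Lemma ptime_snd : ptime (@snd A B).
Proof.
split.
  by apply: pb_le (pb_self _) => -[a b]; rewrite {2}/sz /= leqW // leq_addl.
exists [::], (ECase (EVar 0) ENil (EVar 1)), (fun=> 3); split.
  exact: pb_const.
move=> [a b]; exists 3 => //; apply: (@eval_case_cons _ _ _ _ _ (enc a) (enc b) _ 1 1).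
  exact: (@eval_var _ [:: _] 0).
exact: (@eval_var _ [:: _; _; _] 1).
Qed.

Lemma ptime_ite (b : A -> bool) (f g : A -> B) :
  ptime b -> ptime f -> ptime g -> ptime (fun x => if b x then f x else g x).
Proof.
move=> pbb pf pg; have [sf _] := pf; have [sg _] := pg; split.
  by apply: pb_le (pb_add sf sg) => x; case: (b x); rewrite ?leq_addr ?leq_addl.
have [P [ef [Tf [eg [Tg [pTf pTg rf rg]]]]]] := ptime_common pf pg.
have [_ [Q [eb [Tb [pTb rb]]]]] := pbb.
pose P' := Q ++ map (shift (size Q)) P.
pose ef' := shift (size Q) ef; pose eg' := shift (size Q) eg.
(* [true] is a nonempty cell, so its branch has two more variables and finds the input at index 2;
   [ELet] brings it back to index 0. *)
exists P', (ECase eb eg' (ELet (EVar 2) ef')).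
exists (fun x => (Tb x + (Tf x + Tg x).+2).+1); split.
  by apply/pb_succ/pb_add => //; apply/pb_succ/pb_succ/pb_add.
move=> x; have [t0 le0 ev0] := rb x.
have [t1 le1 ev1] := rf x; have [t2 le2 ev2] := rg x.
have {}ev0 := eval_catr (map (shift (size Q)) P) ev0.
have {}ev1 := eval_shift Q ev1; have {}ev2 := eval_shift Q ev2.
case: (b x) ev0 => ev0; last first.
  exists (t0 + t2).+1; first by lia.
  exact: eval_case_nil ev0 ev2.
exists (t0 + (1 + t1).+1).+1; first by lia.
apply: eval_case_cons ev0 _; apply: eval_let.
  exact: (@eval_var _ [:: _; _; enc x] 2).
exact: (eval_env [:: _; _; _]) ev1.
Qed.

Lemma sz_cons (x : A) s : sz (x :: s) = (sz x + sz s).+1.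
Proof. by []. Qed.

Lemma sz_pair (x : A * B) : sz x = (sz x.1 + sz x.2).+1.
Proof. by []. Qed.

Lemma sz_gt0 (x : A) : 0 < sz x.
Proof. by rewrite /sz; case: (enc x). Qed.

Lemma ptime_cons (f : B -> A) (g : B -> seq A) :
  ptime f -> ptime g -> ptime (fun x => f x :: g x).
Proof.
move=> pf pg; have [P [ef [Tf [eg [Tg [pTf pTg rf rg]]]]]] := ptime_common pf pg.
have [sf _] := pf; have [sg _] := pg; split; first exact/pb_succ/pb_add.
exists P, (ECons ef eg), (fun x => (Tf x + Tg x).+1); split.
  exact/pb_succ/pb_add.
move=> x; have [t1 le1 ev1] := rf x; have [t2 le2 ev2] := rg x.
by exists (t1 + t2).+1; [rewrite ltnS leq_add|apply: eval_cons].
Qed.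

Lemma ptime_head (a0 : A) : ptime (head a0).
Proof.
split.
  apply: pb_le (pb_add (pb_self _) (pb_const _ (sz a0))) => -[|a s] /=.
    exact: leq_addl.
  by rewrite sz_cons; lia.
exists [::], (ECase (EVar 0) (quote (enc a0)) (EVar 0)), (fun=> (1 + (sz a0)).+2).
split; first exact: pb_const.
case=> [|a s].
  exists (1 + sz a0).+1 => //; apply: eval_case_nil.
    exact: (@eval_var _ [:: _] 0).
  exact: eval_quote.
exists 3 => //.
apply: (@eval_case_cons _ _ _ _ _ (enc a) (enc s) _ 1 1).
  exact: (@eval_var _ [:: _] 0).
exact: (@eval_var _ [:: _; _; _] 0).
Qed.

Lemma ptime_behead : ptime (@behead A).
Proof.
split.
  by apply: pb_le (pb_self _) => -[|a s] //=; rewrite sz_cons; lia.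
exists [::], (ECase (EVar 0) ENil (EVar 1)), (fun=> 3).
split; first exact: pb_const.
case=> [|a s]; exists 3 => //.
  apply: (@eval_case_nil _ _ _ _ _ _ 1 1); last exact: eval_nil.
  exact: (@eval_var _ [:: _] 0).
apply: (@eval_case_cons _ _ _ _ _ (enc a) (enc s) _ 1 1).
  exact: (@eval_var _ [:: _] 0).
exact: (@eval_var _ [:: _; _; _] 1).
Qed.

Lemma ptime_nilp : ptime (@nilp A).
Proof.
split.
  by apply: pb_le (pb_const _ 3) => -[].
exists [::], (ECase (EVar 0) (quote (enc true)) ENil), (fun=> 5).
split; first exact: pb_const.
case=> [|a s]; [exists 5|exists 3] => //.
  apply: (@eval_case_nil _ _ _ _ _ _ 1 3); last exact: eval_quote.
  exact: (@eval_var _ [:: _] 0).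
apply: (@eval_case_cons _ _ _ _ _ (enc a) (enc s) _ 1 1); last exact: eval_nil.
exact: (@eval_var _ [:: _] 0).
Qed.

Lemma size_le_sz (s : seq A) : size s <= sz s.
Proof. by elim: s => // a s IH; rewrite sz_cons /= ltnS (leq_trans IH) ?leq_addl. Qed.

End PTime.

(** * Loops over lists *)

Section Fold.
Local Open Scope nat_scope.
Context {A S X : Type} {EA : Enc A} {ES : Enc S} {EX : Enc X}.

Lemma sz_split (l1 l2 : seq A) a : sz a <= sz (l1 ++ a :: l2).
Proof. by elim: l1 => [|b l1 IH]; rewrite /= sz_cons; lia. Qed.

Lemma sz_catl (l1 l2 : seq A) : sz l1 <= sz (l1 ++ l2).
Proof.
elim: l1 => [|b l1 IH] /=; first exact: sz_gt0.
by rewrite !sz_cons; lia.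
Qed.

(** A step may be cheap and yet square the size of its argument, which explodes when iterated; hence
    the bound [b] on the accumulator after every prefix of the list. *)
Lemma ptime_foldl (step : X -> S -> A -> S) (l : X -> seq A) (s0 : X -> S) :
  ptime (fun y : X * (A * S) => step y.1 y.2.2 y.2.1) ->
  ptime l -> ptime s0 ->
  (exists2 b, pb sz b & forall x l1 l2, l x = l1 ++ l2 ->
     sz (foldl (step x) (s0 x) l1) <= b x) ->
  ptime (fun x => foldl (step x) (s0 x) (l x)).
Proof.
move=> ps pl p0 [b pbb hb]; split.
  by apply: pb_le pbb => x; apply: hb (l x) [::] _; rewrite cats0.
have [P [es [Ts [ei [Ti [pTs pTi rs ri]]]]]] := ptime_common ps (ptime_pair pl p0).
have [sl _] := pl.
(* The loop, with argument [(x, (l, s))]. After the three [ECase], the indices 0, 1, 3 and 4 hold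
   the head and the tail of [l], the accumulator and [x]. The body is appended to [P], so it calls
   itself by the number [size P]. *)
pose body := ECase (EVar 0) ENil (ECase (EVar 1) ENil (ECase (EVar 0) (EVar 1)
  (ECall (size P) (ECons (EVar 4) (ECons (EVar 1)
    (ELet (ECons (EVar 4) (ECons (EVar 0) (EVar 3))) es)))))).
pose P' := P ++ [:: body].
have [k hk] := pTs.
pose (M := fun x : X => (sz x + (sz (l x) + b x).+1).+3 ^ k).
exists P', (ECall (size P) (ECons (EVar 0) ei)).
exists (fun x : X => (Ti x).+2 + (sz (l x)).+1 * (M x + 30)); split.
  apply: pb_add; first exact/pb_succ/pb_succ.
  apply: pb_mul; first exact: pb_succ.
  apply: pb_add; last exact: pb_const.
  do ?[apply: pb_exp|apply: pb_succ]; apply: pb_add; first exact: pb_self.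
  by apply/pb_succ/pb_add.
have loop (x : X) m (l0 : seq A) s :
    (forall l1 a l2, l0 = l1 ++ a :: l2 ->
       Ts (x, (a, foldl (step x) s l1)) <= m) ->
  exists2 t, t <= (size l0).+1 * (m + 30) - 3 &
    eval P' [:: enc (x, (l0, s))] body (enc (foldl (step x) s l0)) t.
  elim: l0 s => [|a l0 IH] s hm.
    exists 7; first lia.
    apply: (@eval_case_cons _ _ _ _ _ (enc x) (enc (Nil A, s)) _ 1 5).
      exact: (@eval_var _ [:: _] 0).
    apply: (@eval_case_cons _ _ _ _ _ (enc (Nil A)) (enc s) _ 1 3).
      exact: (@eval_var _ [:: _; _; _] 1).
    apply: (@eval_case_nil _ _ _ _ _ _ 1 1).
      exact: (@eval_var _ [:: _; _; _; _; _] 0).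
    exact: (@eval_var _ [:: _; _; _; _; _] 1).
  have [t2 le2 ev2] := IH (step x s a) (fun l1 a' l2 e => hm (a :: l1) a' l2 (congr1 (cons a) e)).
  have [t1 le1 ev1] := rs (x, (a, s)).
  have {}le1 := leq_trans le1 (hm [::] a l0 erefl).
  exists (1 + (1 + (1 + ((1 + (1 + ((1 + (1 + 1).+1).+1 + t1).+1).+1).+1 + t2).+1).+1).+1).+1.
    rewrite /= mulSn; move: le2; rewrite [in X in _ -> X]mulSn.
    set q := (size l0) * _; lia.
  apply: (@eval_case_cons _ _ _ _ _ (enc x) (enc (a :: l0, s)) _ 1).
    exact: (@eval_var _ [:: _] 0).
  apply: (@eval_case_cons _ _ _ _ _ (enc (a :: l0)) (enc s) _ 1).
    exact: (@eval_var _ [:: _; _; _] 1).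
  apply: (@eval_case_cons _ _ _ _ _ (enc a) (enc l0) _ 1).
    exact: (@eval_var _ [:: _; _; _; _; _] 0).
  apply: (@eval_call _ _ _ _ (enc (x, (l0, step x s a)))).
  - by rewrite size_cat addn1.
  - apply: eval_cons; first exact: (@eval_var _ [:: _; _; _; _; _; _; _] 4).
    apply: eval_cons; first exact: (@eval_var _ [:: _; _; _; _; _; _; _] 1).
    apply: (@eval_let _ _ _ _ (enc (x, (a, s)))).
      apply: eval_cons; first exact: (@eval_var _ [:: _; _; _; _; _; _; _] 4).
      apply: eval_cons; first exact: (@eval_var _ [:: _; _; _; _; _; _; _] 0).
      exact: (@eval_var _ [:: _; _; _; _; _; _; _] 3).
    exact: (eval_env [:: _; _; _; _; _; _; _]) (eval_catr [:: body] ev1).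
  - by rewrite nth_cat ltnn subnn.
move=> x; have [ti lei evi] := ri x.
have [l1 a l2 e|t2 le2 ev2] := loop x (M x) (l x) (s0 x).
  apply: leq_trans (hk _) _.
  have := hb x l1 (a :: l2) e; have := sz_split l1 l2 a; rewrite -e => h1 h2.
  rewrite /M; case: (k) => // k'; rewrite leq_exp2r // !sz_pair /=; lia.
exists ((1 + ti).+1 + t2).+1.
  have := size_le_sz (l x) => hl.
  have : (size (l x)).+1 * (M x + 30) <= (sz (l x)).+1 * (M x + 30).
    by rewrite leq_mul2r ltnS hl orbT.
  have : 30 <= (size (l x)).+1 * (M x + 30) by rewrite mulSn; lia.
  lia.
apply: eval_call.
- by rewrite size_cat addn1.
- apply: eval_cons; first exact: (@eval_var _ [:: _] 0).
  by apply: eval_catr; apply: evi.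
- by rewrite nth_cat ltnn subnn.
Qed.

End Fold.

(** A search directed by the syntax of the function body; [pt_ext] is a hook that is redefined as
    arithmetic becomes available. *)
Ltac pt_ext := fail.
Ltac pt_step := first
  [ assumption | exact: ptime_id | exact: ptime_fst | exact: ptime_snd
  | match goal with
    | |- ptime (fun x => x) => exact: ptime_id
    | |- ptime (fun x => ?c) => exact: (ptime_const c)
    | |- ptime (fun x => (@?f x, @?g x)) => apply: (ptime_pair (f := f) (g := g))
    | |- ptime (fun x => fst (@?f x)) => apply: (ptime_comp ptime_fst (f := f))
    | |- ptime (fun x => snd (@?f x)) => apply: (ptime_comp ptime_snd (f := f))
    | |- ptime (fun x => cons (@?f x) (@?g x)) =>
        apply: (ptime_cons (f := f) (g := g))
    end
  | pt_ext
  | match goal with |- ptime (fun x => if _ then _ else _) => apply: ptime_ite end ].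
Ltac pt := cbv beta; repeat (pt_step; cbv beta).

Section FoldGrowth.
Local Open Scope nat_scope.
Context {A S X : Type} {EA : Enc A} {ES : Enc S} {EX : Enc X}.

(** The usual way to bound an accumulator: a growth by at most [g x] per round, independent of the
    current accumulator, adds up to at most the length of the list times [g x]. *)
Lemma ptime_foldl_add (step : X -> S -> A -> S) (l : X -> seq A) (s0 : X -> S)
    (g : X -> nat) :
  ptime (fun y : X * (A * S) => step y.1 y.2.2 y.2.1) ->
  ptime l -> ptime s0 -> pb sz g ->
  (forall x s a, sz a <= sz (l x) -> sz (step x s a) <= sz s + g x) ->
  ptime (fun x => foldl (step x) (s0 x) (l x)).
Proof.
move=> ps pl p0 pg hg; apply: ptime_foldl => //.
exists (fun x => sz (s0 x) + sz (l x) * g x).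
  by apply: pb_add; [case: p0|apply: pb_mul => //; case: pl].
move=> x l1 l2 e; apply: leq_trans (_ : sz (s0 x) + size l1 * g x <= _).
  elim/last_ind: l1 l2 e => [|l1 a IH] l2 e; first by rewrite addn0.
  rewrite foldl_rcons size_rcons mulSn addnCA addnC.
  rewrite cat_rcons in e.
  apply: leq_trans (hg _ _ _ _) _; first by rewrite e sz_split.
  by rewrite leq_add2r (IH _ e).
rewrite leq_add2l leq_mul2r; apply/orP; right.
by apply: leq_trans (size_le_sz _); rewrite e size_cat leq_addr.
Qed.

Lemma ptime_foldl_bool (step : X -> bool -> A -> bool) (l : X -> seq A) s0 :
  ptime (fun y : X * (A * bool) => step y.1 y.2.2 y.2.1) ->
  ptime l -> ptime s0 -> ptime (fun x => foldl (step x) (s0 x) (l x)).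
Proof.
move=> ps pl p0; apply: ptime_foldl => //.
exists (fun=> 3); first exact: pb_const.
by move=> x l1 l2 _; case: foldl.
Qed.

End FoldGrowth.

Section Lists.
Local Open Scope nat_scope.
Context {A X : Type} {EA : Enc A} {EX : Enc X}.

Lemma ptime_rev (l : X -> seq A) : ptime l -> ptime (fun x => rev (l x)).
Proof.
move=> pl; apply: (ptime_ext (f := fun x => foldl (fun s a => a :: s) [::] (l x))).
  move=> x; rewrite /rev; elim: (l x) [::] => //= a s IH t; exact: IH.
apply: (ptime_foldl_add (g := fun x => (sz (l x)).+1)); pt.
  by apply: pb_succ; case: pl.
by move=> x s a le; rewrite sz_cons; lia.
Qed.

Lemma ptime_filter (p : X -> A -> bool) (l : X -> seq A) :
  ptime (fun y : X * A => p y.1 y.2) -> ptime l ->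
  ptime (fun x => filter (p x) (l x)).
Proof.
move=> pp pl; apply: (ptime_ext (f := fun x =>
    rev (foldl (fun s a => if p x a then a :: s else s) [::] (l x)))).
  move=> x; rewrite (_ : foldl _ _ _ = catrev (filter (p x) (l x)) [::]).
    by rewrite catrevE cats0 revK.
  by elim: (l x) [::] => //= a s IH t; rewrite IH; case: (p x a).
apply: ptime_rev; apply: (ptime_foldl_add (g := fun x => (sz (l x)).+1)); pt.
- apply: (ptime_comp pp (f := fun y => (y.1, y.2.1))); pt.
- by apply: pb_succ; case: pl.
- by move=> x s a le; case: (p x a); rewrite ?sz_cons; lia.
Qed.

Lemma ptime_has (p : X -> A -> bool) (l : X -> seq A) :
  ptime (fun y : X * A => p y.1 y.2) -> ptime l ->
  ptime (fun x => has (p x) (l x)).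
Proof.
move=> pp pl; apply: (ptime_ext (f := fun x =>
    foldl (fun s a => if p x a then true else s) false (l x))).
  move=> x; rewrite -[RHS]orFb; elim: (l x) false => [|a s IH] b /=.
    by rewrite orbF.
  by rewrite IH; case: (p x a); rewrite ?orbT.
apply: ptime_foldl_bool; pt.
by apply: (ptime_comp pp (f := fun y => (y.1, y.2.1))); pt.
Qed.

End Lists.

Section ListMap.
Local Open Scope nat_scope.
Context {A B X : Type} {EA : Enc A} {EB : Enc B} {EX : Enc X}.

Lemma ptime_map (f : X -> A -> B) (l : X -> seq A) :
  ptime (fun y : X * A => f y.1 y.2) -> ptime l ->
  ptime (fun x => map (f x) (l x)).
Proof.
move=> pf pl.
apply: (ptime_ext (f := fun x => rev (foldl (fun s a => f x a :: s) [::] (l x)))).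
  move=> x; rewrite (_ : foldl _ _ _ = catrev (map (f x) (l x)) [::]).
    by rewrite catrevE cats0 revK.
  by elim: (l x) [::] => //= a s IH t; rewrite IH.
have [[k hk] _] := pf; have [sl _] := pl.
apply: ptime_rev.
apply: (ptime_foldl_add (g := fun x => ((sz x + sz (l x)).+3 ^ k).+1)); pt.
- apply: (ptime_comp pf (f := fun y => (y.1, y.2.1))); pt.
- by do ?[apply: pb_succ|apply: pb_exp|apply: pb_add|apply: pb_self|exact: sl].
- move=> x s a le; rewrite sz_cons; have := hk (x, a); rewrite /= => h.
  have : (sz (x, a)).+2 ^ k <= (sz x + sz (l x)).+3 ^ k.
    by case: (k) => // k'; rewrite leq_exp2r // sz_pair /=; lia.
  by lia.
Qed.

End ListMap.

(** * Binary arithmetic *)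

Section Bits.
Local Open Scope nat_scope.

Definition bits (n : nat) : seq bool :=
  if bin_of_nat n is BinNums.Npos p then pos_bits p else [::].

Lemma enc_natE n : enc n = enc (bits n).
Proof. by rewrite {1}/enc /enc_of_nat /enc_nat /bits; case: bin_of_nat. Qed.

(** The recursion equation of the binary expansion, which replaces [positive] by arithmetic on [odd]
    and [half]. Zero is the empty list, so there is no leading zero. *)
Lemma bits_double (b : bool) n :
  bits (b + n.*2) = if b + n.*2 == 0 then [::] else b :: bits n.
Proof.
rewrite -(bin_of_natK n); move: (bin_of_nat n) => m.
have bits_binE p : bits (nat_of_bin p) =
    if p is BinNums.Npos q then pos_bits q else [::].
  by rewrite /bits nat_of_binK.
rewrite bits_binE; case: m => [|p]; first by case: b; rewrite // (bits_binE (BinNums.Npos BinNums.xH)).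
have p_gt0 : 0 < nat_of_bin (BinNums.Npos p).
  by rewrite /=; elim: p => //= p; rewrite ?NatTrec.doubleE double_gt0.
rewrite ifN; last by rewrite -lt0n addn_gt0 double_gt0 p_gt0 orbT.
have -> : b + (nat_of_bin (BinNums.Npos p)).*2 =
    nat_of_bin (BinNums.Npos (if b then BinNums.xI p else BinNums.xO p)).
  by case: b; rewrite /= NatTrec.doubleE.
by rewrite bits_binE; case: b.
Qed.

Lemma bits_odd_half n : bits n = if n == 0 then [::] else odd n :: bits n./2.
Proof. by rewrite -{1 2}[n]odd_double_half bits_double odd_double_half. Qed.

Lemma half_ind (Q : nat -> Prop) :
  Q 0 -> (forall n, 0 < n -> Q n./2 -> Q n) -> forall n, Q n.
Proof.
move=> Q0 QS n; have [m] := ubnP n; elim: m n => // m IH [//|n] le.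
by apply: QS => //; apply: IH; lia.
Qed.

Lemma ltn_exp_bits n : n < 2 ^ size (bits n).
Proof.
elim/half_ind: n => // n n0 IH; rewrite bits_odd_half -if_neg -lt0n n0 /= expnS.
by move: IH; set q := 2 ^ _; lia.
Qed.

Lemma size_bits_le m n : n < 2 ^ m -> size (bits n) <= m.
Proof.
elim: m n => [|m IH] n; first by rewrite expn0; case: n.
rewrite bits_odd_half expnS; case: (posnP n) => //= n0 lt.
by rewrite ltnS IH //; move: lt; set q := 2 ^ _; lia.
Qed.

Lemma sz_bitseq (s : seq bool) : 2 * size s < sz s <= 4 * size s + 1.
Proof.
elim: s => // b s IH; rewrite sz_cons /=.
have : 0 < sz b <= 3 by case: b.
by move: IH; set u := sz s; set v := sz b; lia.
Qed.

Lemma sz_nat n : sz n = sz (bits n).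
Proof. by rewrite {1}/sz enc_natE. Qed.

Lemma ltn_exp_sz n : n < 2 ^ sz n.
Proof.
apply: leq_trans (ltn_exp_bits n) _; rewrite leq_exp2l // sz_nat.
by have := sz_bitseq (bits n); lia.
Qed.

Lemma sz_nat_le m n : n < 2 ^ m -> sz n <= 4 * m + 1.
Proof. by move=> /size_bits_le; rewrite sz_nat; have := sz_bitseq (bits n); lia. Qed.

Lemma sz_nat_mono m n : m <= n -> sz m <= 4 * sz n + 1.
Proof. by move=> le; apply: sz_nat_le; apply: leq_ltn_trans le (ltn_exp_sz n). Qed.

Context {X : Type} {EX : Enc X}.

(** A number and its bit list have the same encoding, so passing from one to the other costs
    nothing. *)
Lemma ptime_of_bits (f : X -> nat) : ptime (fun x => bits (f x)) -> ptime f.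
Proof.
move=> [sf [P [e [T [pT rf]]]]]; split; first by apply: pb_le sf => x; rewrite sz_nat.
by exists P, e, T; split=> // x; have := rf x; rewrite -enc_natE.
Qed.

Lemma ptime_bits (f : X -> nat) : ptime f -> ptime (fun x => bits (f x)).
Proof.
move=> [sf [P [e [T [pT rf]]]]]; split; first by apply: pb_le sf => x; rewrite sz_nat.
by exists P, e, T; split=> // x; have := rf x; rewrite enc_natE.
Qed.

Lemma ptime_odd (f : X -> nat) : ptime f -> ptime (fun x => odd (f x)).
Proof.
move=> pf; apply: (ptime_ext (f := fun x => head false (bits (f x)))).
  by move=> x; rewrite bits_odd_half; case: eqP => // ->.
by apply: (ptime_comp (ptime_head _)); apply: ptime_bits.
Qed.

Lemma ptime_half (f : X -> nat) : ptime f -> ptime (fun x => (f x)./2).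
Proof.
move=> pf; apply: ptime_of_bits.
apply: (ptime_ext (f := fun x => behead (bits (f x)))).
  by move=> x; rewrite [bits (f x)]bits_odd_half; case: eqP => // ->.
by apply: (ptime_comp ptime_behead); apply: ptime_bits.
Qed.

Lemma ptime_double_bit (b : X -> bool) (f : X -> nat) :
  ptime b -> ptime f -> ptime (fun x => (b x : nat) + (f x).*2).
Proof.
move=> pb pf; apply: ptime_of_bits.
apply: (ptime_ext (f := fun x => if b x then b x :: bits (f x) else
   if nilp (bits (f x)) then [::] else b x :: bits (f x))).
  move=> x; rewrite bits_double; case: (b x) => //=.
  by rewrite bits_odd_half add0n double_eq0; case: eqP.
have pbf := ptime_bits pf.
by pt; apply: (ptime_comp ptime_nilp).
Qed.

End Bits.

Section Arithmetic.
Local Open Scope nat_scope.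

Definition bval (s : seq bool) : nat := foldl (fun n (b : bool) => b + n.*2) 0 s.

Lemma bval_cons b s : bval (b :: s) = b * 2 ^ size s + bval s.
Proof.
suff foldE n : foldl (fun n (b : bool) => b + n.*2) n s = n * 2 ^ size s + bval s.
  by rewrite /bval /= foldE addn0.
rewrite /bval; elim: s n => [|c s IH] n; first by rewrite /= muln1 addn0.
by rewrite /= IH [in RHS]IH expnS -muln2; lia.
Qed.

Lemma bval_lt s : bval s < 2 ^ size s.
Proof.
elim: s => // b s IH; rewrite bval_cons /= expnS.
by move: IH; set q := 2 ^ _; case: b; lia.
Qed.

(** The unread high parts of the two summands, the carry, and the digits of the sum produced so far,
    most significant first. *)
Definition addstate := ((nat * nat) * (bool * seq bool))%type.

Definition addstep (s : addstate) : addstate :=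
  let a := s.1.1 in let b := s.1.2 in let c := s.2.1 in
  ((a./2, b./2),
   (if odd a then (if odd b then true else c) else (if odd b then c else false),
    (if odd a then (if odd b then c else ~~ c) else
       (if odd b then ~~ c else c)) :: s.2.2)).

(** The invariant of addition: what is unread, together with the carry, weighs 2 to the number of
    digits already produced. *)
Definition addval (s : addstate) : nat :=
  (s.1.1 + s.1.2 + s.2.1) * 2 ^ size s.2.2 + bval s.2.2.

Lemma addval_step s : addval (addstep s) = addval s.
Proof.
case: s => [[a b] [c l]]; rewrite /addval /= bval_cons expnS mulnA addnA -mulnDl.
congr (_ * _ + _); have := odd_double_half a; have := odd_double_half b.
by case: (odd a); case: (odd b); case: c => /=; lia.
Qed.

Definition addrun (s : addstate) (l : seq bool) : addstate :=
  foldl (fun s _ => addstep s) s l.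

Lemma addval_run s l : addval (addrun s l) = addval s.
Proof. by elim: l s => //= _ l IH s; rewrite IH addval_step. Qed.

Lemma addrun_half s l :
  (addrun s l).1 = (iter (size l) half s.1.1, iter (size l) half s.1.2).
Proof.
elim: l s => [|x l IH] s; first by case: s => [[a b] c].
by rewrite /= IH /= -!iterS !iterSr.
Qed.

Lemma iter_half_le k n : iter k half n <= n.
Proof. by elim: k => //= k IH; lia. Qed.

Lemma iter_half0 l k n : size (bits n) <= k -> iter k half (iter l half n) = 0.
Proof.
rewrite -iterD addnC iterD => le; rewrite (_ : iter k half n = 0).
  by elim: l => //= l ->.
elim: k n le => [|k IH] n; rewrite bits_odd_half; case: (posnP n) => //= [-> _|_].
  by rewrite (_ : iter k half 0 = 0) //; elim: k {IH} => //= m ->.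
by rewrite ltnS -iterS iterSr => /IH.
Qed.

Lemma size_addrun s l : size (addrun s l).2.2 = size l + size s.2.2.
Proof. by elim: l s => //= _ l IH s; rewrite IH addnS. Qed.

Context {X : Type} {EX : Enc X}.

Lemma ptime_neg (f : X -> bool) : ptime f -> ptime (fun x => ~~ f x).
Proof. by move=> pf; apply: (@ptime_ite X bool); pt. Qed.

Lemma ptime_and (f g : X -> bool) : ptime f -> ptime g -> ptime (fun x => f x && g x).
Proof. by move=> pf pg; apply: (@ptime_ite X bool); pt. Qed.

End Arithmetic.

Ltac pt_ext1 := first
  [ apply: ptime_odd | apply: ptime_half | apply: ptime_double_bit
  | apply: ptime_bits | apply: ptime_neg | apply: ptime_and
  | match goal with |- ptime (fun x => nilp (@?f x)) =>
      apply: (ptime_comp ptime_nilp (f := f)) end ].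
Ltac pt_ext ::= pt_ext1.

Section Addition.
Local Open Scope nat_scope.

Lemma sz_bool (b : bool) : sz b <= 3.
Proof. by case: b. Qed.

Lemma ptime_addstep : ptime addstep.
Proof. rewrite /addstep; pt. Qed.

Context {X : Type} {EX : Enc X}.

Lemma ptime_addrun (s : X -> addstate) (l : X -> seq bool) :
  ptime s -> ptime l -> ptime (fun x => addrun (s x) (l x)).
Proof.
move=> ps pl; apply: (ptime_foldl (step := fun _ s _ => addstep s)) => //.
  by apply: (ptime_comp ptime_addstep (f := fun y => y.2.2)); pt.
have [ss _] := ps; have [sl _] := pl.
exists (fun x => 4 * sz (s x) + 1 + (4 * sz (s x) + 1) + 6 +
                 (4 * (sz (l x) + sz (s x)) + 1)).
  by do ![exact: pb_const|exact: ss|exact: sl|apply: pb_add|apply: pb_mul].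
move=> x l1 l2 e; rewrite -/(addrun _ l1).
have := addrun_half (s x) l1; have := size_addrun (s x) l1.
case: (addrun _ _) => [[a b] [c t]] /= st [ea eb].
have sza : sz a <= 4 * sz (s x).1.1 + 1.
  by rewrite ea; apply: sz_nat_mono; apply: iter_half_le.
have szb : sz b <= 4 * sz (s x).1.2 + 1.
  by rewrite eb; apply: sz_nat_mono; apply: iter_half_le.
have := sz_bitseq t; rewrite st => szt.
have sl1 : size l1 <= sz (l x).
  by apply: leq_trans (size_le_sz _); rewrite e size_cat leq_addr.
have : size (s x).2.2 <= sz (s x).2.2 by apply: size_le_sz.
have := sz_bool c.
by move: sza szb; rewrite ![sz (_, _)]sz_pair /= (sz_pair (s x)) !sz_pair; lia.
Qed.

Lemma ptime_add (f g : X -> nat) :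
  ptime f -> ptime g -> ptime (fun x => f x + g x).
Proof.
move=> pf pg.
pose s0 x : addstate := ((f x, g x), (false, [::])).
(* The bit lists are only loop counters: running over both of them exhausts both summands, and one
   more step turns the last carry into a digit. *)
pose s1 x := addrun (s0 x) (bits (f x)).
pose s2 x := addrun (s1 x) (bits (g x)).
pose s3 x := addstep (s2 x).
apply: (ptime_ext (f := fun x => bval (s3 x).2.2)) => [x|].
  have : addval (s3 x) = f x + g x.
    by rewrite /s3 addval_step !addval_run /addval /= muln1 !addn0.
  rewrite /addval; have := addrun_half (s1 x) (bits (g x)).
  rewrite [(s1 x).1]addrun_half /= -/(s2 x).
  rewrite -iterD addnC iterD iter_half0 // iter_half0 //.
  by rewrite /s3; case: (s2 x) => [[a b] [c l]] [-> ->] /=; rewrite mul0n.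
have ps0 : ptime s0 by rewrite /s0; pt.
have ps1 : ptime s1 by apply: ptime_addrun; pt.
have ps2 : ptime s2 by apply: ptime_addrun; pt.
have ps3 : ptime (fun x => (s3 x).2.2).
  by pt; apply: (ptime_comp ptime_addstep (f := s2)).
have [sb _] := ps3.
apply: (ptime_foldl (step := fun _ n (b : bool) => b + n.*2)); pt.
exists (fun x => 4 * sz (s3 x).2.2 + 1).
  by do ![exact: pb_const|exact: sb|apply: pb_add|apply: pb_mul].
move=> x l1 l2 e; apply: sz_nat_le; apply: leq_trans (bval_lt _) _.
by rewrite leq_exp2l // (leq_trans _ (size_le_sz _)) // e size_cat leq_addr.
Qed.

End Addition.

Section Multiplication.
Local Open Scope nat_scope.

Definition lval (s : seq bool) : nat := foldr (fun (b : bool) n => b + n.*2) 0 s.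

Lemma lval_bits n : lval (bits n) = n.
Proof.
elim/half_ind: n => // n n0 IH.
by rewrite bits_odd_half -if_neg -lt0n n0 /= IH odd_double_half.
Qed.

Lemma lval_lt s : lval s < 2 ^ size s.
Proof.
by elim: s => //= b s IH; rewrite expnS; move: IH; set q := 2 ^ _; case: b; lia.
Qed.

(** Shift and add on the partial product and the shifted second factor. The form [false + _.*2]
    matches [ptime_double_bit]. *)
Definition mulstep (s : nat * nat) (b : bool) : nat * nat :=
  (if b then s.1 + s.2 else s.1, false + (s.2).*2).

Lemma mulrunE s l :
  foldl mulstep s l = (s.1 + lval l * s.2, s.2 * 2 ^ size l).
Proof.
elim: l s => [|b l IH] [m n] /=; first by rewrite addn0 muln1.
by rewrite IH expnS /mulstep /=; congr pair; case: b; rewrite -!muln2; nia.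
Qed.

Context {X : Type} {EX : Enc X}.

Lemma ptime_mul (f g : X -> nat) :
  ptime f -> ptime g -> ptime (fun x => f x * g x).
Proof.
move=> pf pg.
apply: (ptime_ext (f := fun x => (foldl mulstep (0, g x) (bits (f x))).1)) => [x|].
  by rewrite mulrunE lval_bits.
apply: (ptime_comp ptime_fst); apply: (ptime_foldl (step := fun _ => mulstep)).
- by rewrite /mulstep; pt; apply: ptime_add; pt.
- by pt.
- by pt.
have [sf _] := pf; have [sg _] := pg.
exists (fun x => (4 * (sz (f x) + sz (g x)) + 1 + (4 * (sz (f x) + sz (g x)) + 1)).+1).
  by do ![exact: pb_const|exact: sf|exact: sg|apply: pb_add|apply: pb_mul|apply: pb_succ].
move=> x l1 l2 e; rewrite mulrunE sz_pair /= add0n ltnS.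
have le : size l1 <= sz (f x).
  rewrite sz_nat e; apply: leq_trans (size_le_sz _).
  by rewrite size_cat leq_addr.
have le2 : 2 ^ size l1 <= 2 ^ sz (f x) by rewrite leq_exp2l.
have := lval_lt l1; have := ltn_exp_sz (g x) => h1 h2.
by apply: leq_add; apply: sz_nat_le; rewrite expnD; nia.
Qed.

End Multiplication.

Section Comparison.
Local Open Scope nat_scope.

(** The flag is the verdict on the low digits already read; a differing higher digit overrides
    it. *)
Definition cmpstep (s : (nat * nat) * bool) : (nat * nat) * bool :=
  ((s.1.1./2, s.1.2./2),
   if odd s.1.1 then (if odd s.1.2 then s.2 else false)
   else (if odd s.1.2 then true else s.2)).

Definition cmpval (s : (nat * nat) * bool) : bool :=
  if s.1.1 == s.1.2 then s.2 else s.1.1 < s.1.2.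

Lemma cmpval_step s : cmpval (cmpstep s) = cmpval s.
Proof.
case: s => [[a b] r]; rewrite /cmpval /cmpstep /=.
have := odd_double_half a; have := odd_double_half b.
case: (odd a); case: (odd b) => /= ea eb.
- by rewrite -ea -eb; do 2!case: eqP; lia.
- by case: eqP => h1; case: eqP => h2; lia.
- by case: eqP => h1; case: eqP => h2; lia.
- by rewrite -ea -eb; do 2!case: eqP; lia.
Qed.

Definition cmprun s (l : seq bool) := foldl (fun s _ => cmpstep s) s l.

Lemma cmpval_run s l : cmpval (cmprun s l) = cmpval s.
Proof. by elim: l s => //= _ l IH s; rewrite IH cmpval_step. Qed.

Lemma cmprun_half s l :
  (cmprun s l).1 = (iter (size l) half s.1.1, iter (size l) half s.1.2).
Proof.
elim: l s => [|x l IH] s; first by case: s => [[a b] c].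
by rewrite /= IH /= -!iterS !iterSr.
Qed.

Context {X : Type} {EX : Enc X}.

Lemma ptime_cmprun (s : X -> (nat * nat) * bool) (l : X -> seq bool) :
  ptime s -> ptime l -> ptime (fun x => cmprun (s x) (l x)).
Proof.
move=> ps pl; apply: (ptime_foldl (step := fun _ s _ => cmpstep s)) => //.
  by rewrite /cmpstep; pt.
have [ss _] := ps.
exists (fun x => 4 * sz (s x) + 1 + (4 * sz (s x) + 1) + 6).
  by do ![exact: pb_const|exact: ss|apply: pb_add|apply: pb_mul].
move=> x l1 l2 e; rewrite -/(cmprun _ l1).
have := cmprun_half (s x) l1.
case: (cmprun _ _) => [[a b] c] /= [ea eb].
have sza : sz a <= 4 * sz (s x).1.1 + 1.
  by rewrite ea; apply: sz_nat_mono; apply: iter_half_le.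
have szb : sz b <= 4 * sz (s x).1.2 + 1.
  by rewrite eb; apply: sz_nat_mono; apply: iter_half_le.
have := sz_bool c.
by move: sza szb; rewrite ![sz (_, _)]sz_pair /= (sz_pair (s x)) !sz_pair; lia.
Qed.

Lemma ptime_ltn (f g : X -> nat) :
  ptime f -> ptime g -> ptime (fun x => f x < g x).
Proof.
move=> pf pg.
pose s1 x := cmprun ((f x, g x), false) (bits (f x)).
pose s2 x := cmprun (s1 x) (bits (g x)).
apply: (ptime_ext (f := fun x => (s2 x).2)) => [x|].
  have : cmpval (s2 x) = (f x < g x).
    by rewrite !cmpval_run /cmpval /=; case: eqP => // ->; rewrite ltnn.
  rewrite /cmpval; have := cmprun_half (s1 x) (bits (g x)).
  rewrite [(s1 x).1]cmprun_half /= -/(s2 x).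
  rewrite -iterD addnC iterD iter_half0 // iter_half0 //.
  by case: (s2 x) => [[a b] c] [-> ->] /=.
have ps1 : ptime s1 by apply: ptime_cmprun; pt.
by pt; apply: ptime_cmprun; pt.
Qed.

Lemma ptime_eqn (f g : X -> nat) :
  ptime f -> ptime g -> ptime (fun x => f x == g x).
Proof.
move=> pf pg; apply: (ptime_ext (f := fun x => ~~ (f x < g x) && ~~ (g x < f x))).
  by move=> x; rewrite -!leqNgt eqn_leq andbC.
by pt; apply: ptime_ltn.
Qed.

End Comparison.

Ltac pt_ext ::= first
  [ pt_ext1
  | match goal with
    | |- ptime (fun x => @eq_op _ (@?f x) (@?g x)) =>
        apply: (ptime_eqn (f := f) (g := g))
    | |- ptime (fun x => leq (S (@?f x)) (@?g x)) =>
        apply: (ptime_ltn (f := f) (g := g))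
    | |- ptime (fun x => muln (@?f x) (@?g x)) =>
        apply: (ptime_mul (f := f) (g := g))
    | |- ptime (fun x => addn (@?f x) (@?g x)) =>
        apply: (ptime_add (f := f) (g := g))
    end ].

(** * Unreduced fractions *)

Section Fractions.
Local Open Scope nat_scope.

(** Numerator and denominator, never reduced, which avoids computing a gcd. *)
Definition qfrac := (nat * nat)%type.

Definition fadd (p q : qfrac) : qfrac := (p.1 * q.2 + q.1 * p.2, p.2 * q.2).

(* An upper bound on both components that is submultiplicative under [fadd]. *)
Definition height (q : qfrac) : nat := (q.1 + q.2).+1.

Lemma height_add p q : height (fadd p q) <= height p * height q.
Proof. by case: p q => [a b] [c d]; rewrite /height /=; nia. Qed.

Lemma height_sz q : height q <= 2 ^ sz q.
Proof.
case: q => [a b]; rewrite /height sz_pair /= expnS.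
have := ltn_exp_sz a; have := ltn_exp_sz b; rewrite expnD.
by set u := 2 ^ _; set v := 2 ^ _; nia.
Qed.

Lemma sz_frac m q : height q <= 2 ^ m -> sz q <= 8 * m + 3.
Proof.
case: q => [a b]; rewrite /height sz_pair /= => le.
have := @sz_nat_le m a; have := @sz_nat_le m b; lia.
Qed.

Definition fsum (l : seq qfrac) : qfrac := foldl fadd (0, 1) l.

(** Heights multiply under addition and the height of a fraction is at most 2 to its size, so the
    size of a sum is linear in that of the list. *)
Lemma height_foldl (q : qfrac) (l0 : seq qfrac) :
  height (foldl fadd q l0) <= height q * 2 ^ sz l0.
Proof.
elim: l0 q => [|p l0 IH] q /=; first by rewrite leq_pmulr // expn_gt0.
apply: leq_trans (IH _) _; rewrite sz_cons expnS expnD.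
have := height_add q p; have := height_sz p.
have : 0 < 2 ^ sz l0 by rewrite expn_gt0.
set u := 2 ^ _; set v := 2 ^ _ => u0 h1 h2.
apply: leq_trans (_ : height q * v * u <= _); last by nia.
by rewrite leq_mul2r (leq_trans h2) ?orbT // leq_mul2l h1 orbT.
Qed.

Context {X : Type} {EX : Enc X}.

Lemma ptime_fsum (l : X -> seq qfrac) : ptime l -> ptime (fun x => fsum (l x)).
Proof.
move=> pl; apply: (ptime_foldl (step := fun _ => fadd)) => //.
- by rewrite /fadd; pt.
- by pt.
have [sl _] := pl.
exists (fun x => 8 * (sz (l x)).+1 + 3).
  by do ![exact: pb_const|exact: sl|apply: pb_add|apply: pb_mul|apply: pb_succ].
move=> x l1 l2 e; apply: sz_frac.
apply: leq_trans (height_foldl _ _) _; rewrite [height _]/= expnS leq_mul2l leq_exp2l //.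
by rewrite e; apply: sz_catl.
Qed.

End Fractions.

(** * Rooted trees *)

Section Topo.
Variables (V T : eqType) (r : V) (par ch : T -> V).
Implicit Types K : seq T.

(* Deepest edges first: the parent end of an edge occurs later in the list as a
   child end, or is the root. *)
Fixpoint topo K : bool :=
  if K is e :: K' then
    [&& par e \in r :: map ch K', ch e \notin r :: map ch K' & topo K']
  else true.

Lemma topo_uniq K : topo K -> uniq (map ch K) && (r \notin map ch K).
Proof.
elim: K => //= e K IH /and3P[_]; rewrite !inE !negb_or => /andP[er eK] tK.
by rewrite eK [r == _]eq_sym er; have /andP[-> ->] := IH tK.
Qed.

Lemma topo_par K e : topo K -> e \in K -> par e \in r :: map ch K.
Proof.
elim: K => //= a K IH /and3P[pa _ tK]; rewrite inE => /predU1P[->|eK].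
  by move: pa; rewrite !inE => /orP[->|->] //; rewrite !orbT.
by have := IH tK eK; rewrite !inE => /orP[->|->] //; rewrite !orbT.
Qed.

Lemma topo_index K e : topo K -> e \in K ->
  (index (ch e) (map ch K) < index (par e) (map ch K))%N.
Proof.
elim: K => //= a K IH /and3P[pa na tK]; rewrite inE.
have [->|_ /=] := eqVneq e a.
  by rewrite eqxx ifN // (memPnC na).
move=> eK; rewrite ifN; last first.
  by apply: (memPnC na); rewrite inE map_f ?orbT.
rewrite ifN; last by apply: (memPnC na); rewrite topo_par.
by rewrite ltnS IH.
Qed.

End Topo.

Lemma topo_map (V T U : eqType) (r : V) (par ch : T -> V) (par' ch' : U -> V)
    (f : T -> U) K :
  {in K, forall x, par' (f x) = par x} -> {in K, forall x, ch' (f x) = ch x} ->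
  topo r par' ch' (map f K) = topo r par ch K.
Proof.
elim: K => //= e K IH hp hc; rewrite hp ?mem_head // hc ?mem_head //.
have hp' : {in K, forall x, par' (f x) = par x}.
  by move=> x xK; rewrite hp // inE xK orbT.
have hc' : {in K, forall x, ch' (f x) = ch x}.
  by move=> x xK; rewrite hc // inE xK orbT.
have -> : map ch' (map f K) = map ch K by rewrite -map_comp; apply/eq_in_map.
by rewrite IH.
Qed.

Lemma uniq_map_inj (T U : eqType) (f : T -> U) s :
  uniq (map f s) -> {in s &, injective f}.
Proof.
elim: s => //= a s IH /andP[as_ un] x y; rewrite !inE.
case/predU1P => [->|xs] /predU1P[->|ys] // e.
- by case/negP: as_; rewrite e map_f.
- by case/negP: as_; rewrite -e map_f.
- exact: IH un _ _ xs ys e.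
Qed.

(** * Walks *)

Section Walks.
Variables (R : realFieldType) (V E : finType) (I : instance R V E).
Implicit Types (F : {set E}) (s : seq (E * V)) (x y z : V).

Lemma joins_sym e x y : joins I e x y = joins I e y x.
Proof. by rewrite /joins orbC. Qed.

Lemma joins_inv e x y u v : joins I e x y -> joins I e u v ->
  (u = x /\ v = y) \/ (u = y /\ v = x).
Proof.
by rewrite /joins => /orP[]/eqP-> /orP[]/eqP[-> ->]; by [left | right].
Qed.

Lemma walk_cat F x s y s' z :
  walk I F x s y -> walk I F y s' z -> walk I F x (s ++ s') z.
Proof.
elim: s x => [|[e u] s IH] x /=; first by move/eqP->.
by move=> /and3P[-> -> /IH h] /h.
Qed.

Lemma walk_rev F x s y : walk I F x s y -> exists s', walk I F y s' x.
Proof.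
elim: s x => [|[e u] s IH] x /=; first by move/eqP->; exists [::] => /=.
move=> /and3P[eF exu /IH[s' h]]; exists (s' ++ [:: (e, x)]).
by apply: walk_cat h _; rewrite /= eF joins_sym exu eqxx.
Qed.

Lemma walk_crosses F x s y (D : pred V) :
  walk I F x s y -> D x != D y ->
  exists e u v, [/\ e \in unzip1 s, e \in F, joins I e u v, ~~ D u & D v].
Proof.
elim: s x => [|[e z] s IH] x /=; first by move/eqP->; rewrite eqxx.
move=> /and3P[eF exz wz] Dxy; have [Dxz|Dxz] := eqVneq (D x) (D z).
  rewrite Dxz in Dxy; have [f [u [v [fs fF fuv Du Dv]]]] := IH z wz Dxy.
  by exists f, u, v; split=> //; rewrite inE fs orbT.
case Dx: (D x) Dxz => Dxz.
  by exists e, z, x; split; rewrite ?mem_head ?Dx 1?joins_sym //; case: (D z) Dxz.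
by exists e, x, z; split; rewrite ?mem_head ?Dx //; case: (D z) Dxz.
Qed.

Lemma walk_from F z s y x :
  walk I F z s y -> uniq (z :: unzip2 s) -> x \in z :: unzip2 s ->
  exists2 s', walk I F x s' y & uniq (x :: unzip2 s').
Proof.
elim: s z => [|[e u] s IH] z.
  by move=> w un; rewrite inE => /eqP->; exists [::].
move=> w un; rewrite inE => /predU1P[->|xs]; first by exists ((e, u) :: s).
by move: w un => /= /and3P[_ _ w] /andP[_ un]; apply: IH w un xs.
Qed.

Lemma walk_simple F x s y :
  walk I F x s y -> exists2 s', walk I F x s' y & uniq (x :: unzip2 s').
Proof.
elim: s x => [|[e z] s IH] x; first by exists [::].
move=> /= /and3P[eF exz /IH[s' w un]].
have [xs|xs] := boolP (x \in z :: unzip2 s'); first exact: walk_from w un xs.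
by exists ((e, z) :: s') => /=; [rewrite eF exz|rewrite xs].
Qed.

Lemma walk_ends F x s y e u v :
  walk I F x s y -> e \in unzip1 s -> joins I e u v -> u \in x :: unzip2 s.
Proof.
elim: s x => //= -[f z] s IH x /= /and3P[_ fxz w]; rewrite inE.
case/predU1P => [->|es] euv.
  by have [[-> _]|[-> _]] := joins_inv fxz euv; rewrite !inE eqxx ?orbT.
by rewrite inE (IH z) ?orbT.
Qed.

(** A repeated edge would lead back to the vertex from which it was first traversed. *)
Lemma walk_uniq_edges F x s y :
  walk I F x s y -> uniq (x :: unzip2 s) -> uniq (unzip1 s).
Proof.
elim: s x => //= -[e z] s IH x /= /and3P[_ exz w] /andP[xs un].
rewrite (IH z w un) andbT; apply: contra xs => es.
exact: walk_ends w es exz.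
Qed.

Lemma walk_sub F F' x s y : F \subset F' -> walk I F x s y -> walk I F' x s y.
Proof.
move=> sF; elim: s x => //= -[e z] s IH x /and3P[eF -> /IH->].
by rewrite (subsetP sF).
Qed.

Lemma walk_edges F x s y : walk I F x s y -> {subset unzip1 s <= F}.
Proof.
elim: s x => //= -[e z] s IH x /and3P[eF _ w] f; rewrite inE.
by case/predU1P => [->//|]; apply: IH w f.
Qed.

Lemma topo_walk (par ch : E -> V) (K : seq E) F :
  {in K, forall e, joins I e (par e) (ch e)} -> topo (root I) par ch K ->
  {subset K <= F} ->
  forall x, x \in root I :: map ch K -> exists s, walk I F (root I) s x.
Proof.
elim: K => [|e K IH] /= hj.
  by move=> _ _ x; rewrite inE => /eqP->; exists [::] => /=.
move=> /and3P[pe _ tK] sK.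
have {}IH : forall x, x \in root I :: map ch K -> exists s, walk I F (root I) s x.
  apply: IH => // [f fK|f fK]; first by apply: hj; rewrite inE fK orbT.
  by apply: sK; rewrite inE fK orbT.
move=> x; rewrite !inE orbCA => /orP[/eqP->|xK]; last first.
  by apply: IH; rewrite inE.
have [s w] := IH _ pe; exists (s ++ [:: (e, ch e)]).
by apply: walk_cat w _; rewrite /= sK ?mem_head // hj ?mem_head /=.
Qed.

End Walks.

(** * Oriented trees and their rooted subtrees *)

Section Arborescence.
Variables (R : realFieldType) (V E : finType).

(** A tree presented by its oriented edges: [ch] matches edges with the vertices other than the
    root, so that edge sets determine subtrees. Unlike [is_tree], this form passes directly to
    contractions. *)
Record arb (I : instance R V E) (par ch : E -> V) (K : seq E) : Prop := Arb {
  arb_joins : {in K, forall e, joins I e (par e) (ch e)};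
  arb_edges : K =i eset I;
  arb_verts : vset I =i root I :: map ch K;
  arb_topo : topo (root I) par ch K
}.

Variables (I : instance R V E) (par ch : E -> V) (K : seq E).
Hypothesis AI : arb I par ch K.
Local Notation r := (root I).

Lemma arb_uniq_ch : uniq (map ch K).
Proof. by have /andP[] := topo_uniq (arb_topo AI). Qed.

Lemma arb_ch_root e : e \in K -> ch e != r.
Proof.
move=> eK; have /andP[_] := topo_uniq (arb_topo AI).
by apply: contraNneq => <-; apply: map_f.
Qed.

Lemma arb_ch_inj : {in K &, injective ch}.
Proof. by exact: uniq_map_inj arb_uniq_ch. Qed.

Lemma arb_par e : e \in K -> par e = r \/ exists2 f, f \in K & ch f = par e.
Proof.
move=> /(topo_par (arb_topo AI)); rewrite inE => /predU1P[->|/mapP[f fK ->]].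
  by left.
by right; exists f.
Qed.

Definition idx (v : V) : nat := index v (map ch K).

Lemma idx_lt e : e \in K -> (idx (ch e) < idx (par e))%N.
Proof. exact: topo_index (arb_topo AI). Qed.

(** Induction from the root downwards, on the distance of the position from the end of the list. *)
Lemma arb_ind (Q : E -> Prop) :
  (forall e, e \in K -> (forall f, f \in K -> ch f = par e -> Q f) -> Q e) ->
  forall e, e \in K -> Q e.
Proof.
move=> h; suff H n e : (size K - idx (ch e) < n)%N -> e \in K -> Q e.
  by move=> e; apply: H (ltnSn _).
elim: n e => // n IH e lt eK; apply: (h e) => // f fK fe; apply: IH => //.
have := idx_lt eK; rewrite fe.
have : (idx (par e) <= size K)%N by rewrite /idx -(size_map ch) index_size.
by move: lt; lia.
Qed.

Definition parent_edge : rel E :=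
  [rel e f | [&& e \in K, f \in K & ch f == par e]].
Local Notation up := parent_edge.

(** Reflexive, so for [e] in [K] the edges [f] with [anc f e] are those of the path from the root to
    [ch e], including [e]. *)
Definition anc (f e : E) : bool := connect up e f.

Lemma anc_refl e : anc e e.
Proof. exact: connect0. Qed.

Lemma up_anc e f g : up e f -> anc g f -> anc g e.
Proof. by move=> ef; apply: connect_trans; apply: connect1. Qed.

Lemma anc_trans : transitive anc.
Proof. by move=> f g e gf fe; apply: connect_trans fe gf. Qed.

Lemma anc_up f e : anc f e -> f = e \/ exists2 h, up e h & anc f h.
Proof.
case/connectP => -[|h p] /=; first by move=> _ ->; left.
move=> /andP[eh hp] ->; right; exists h => //; apply/connectP; by exists p.
Qed.

Lemma up_inj e f g : up e f -> up e g -> f = g.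
Proof.
move=> /and3P[_ fK /eqP fe] /and3P[_ gK /eqP ge].
by apply: arb_ch_inj; rewrite // fe ge.
Qed.

Lemma anc_chain f g e : anc f e -> anc g e -> anc f g || anc g f.
Proof.
case/connectP => p; elim: p e => [|h p IH] e /=; first by move=> _ -> ->; rewrite orbT.
move=> /andP[eh hp] fE ge; have [->|[h' eh' gh']] := anc_up ge.
  rewrite (@anc_trans h) ?orTb //; first by apply/connectP; exists p.
  by apply: up_anc eh _; apply: anc_refl.
by rewrite (up_inj eh' eh) in gh'; apply: IH hp fE gh'.
Qed.

Lemma anc_idx f e : anc f e -> (idx (ch e) <= idx (ch f))%N.
Proof.
case/connectP => p; elim: p e => [|h p IH] e /=; first by move=> _ ->.
move=> /andP[/and3P[eK hK /eqP he] hp] fE; apply: leq_trans (IH h hp fE).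
by rewrite he ltnW ?idx_lt.
Qed.

Lemma anc_mem f e : anc f e -> e \in K -> f \in K.
Proof.
case/connectP => p; elim: p e => [|h p IH] e /=; first by move=> _ ->.
by move=> /andP[/and3P[eK hK _] hp] fE _; apply: IH hp fE hK.
Qed.

Definition below (f : E) : pred V := fun v => [exists e in K, (ch e == v) && anc f e].

Lemma below_ch f e : e \in K -> below f (ch e) = anc f e.
Proof.
move=> eK; apply/existsP/idP => [[g /and3P[gK /eqP ge]]|fe].
  by rewrite (arb_ch_inj gK eK ge).
by exists e; rewrite eK eqxx fe.
Qed.

Lemma below_par f e : e \in K -> below f (par e) -> anc f e.
Proof.
move=> eK /existsP[g /and3P[gK /eqP ge fg]]; apply: up_anc fg.
by rewrite /parent_edge /= eK gK ge eqxx.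
Qed.

Lemma below_root f : below f r = false.
Proof.
by apply/existsP => -[g /and3P[gK ge _]]; have := arb_ch_root gK; rewrite ge.
Qed.

Lemma below_own_par f : f \in K -> below f (par f) = false.
Proof.
move=> fK; apply/existsP => -[g /and3P[gK /eqP ge /anc_idx]].
by rewrite ge; have := idx_lt fK; lia.
Qed.

(* The edge above [v] is the only one that joins the part below it to the rest. *)
Lemma crossing_edge f e u v : e \in K -> joins I e u v ->
  ~~ below f u -> below f v -> e = f.
Proof.
move=> eK euv; have [[-> ->]|[-> ->]] := joins_inv (arb_joins AI eK) euv.
  rewrite below_ch // => nb /anc_up[//|[h eh fh]]; case/negP: nb.
  by move: eh => /and3P[_ hK /eqP<-]; rewrite below_ch.
by rewrite below_ch // => /negP h /(below_par eK).
Qed.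

Lemma walk_through (F : {set E}) x s y f : {subset F <= K} -> walk I F x s y ->
  below f x != below f y -> f \in unzip1 s /\ f \in F.
Proof.
move=> sF w xy; have [e [u [v [es eF euv bu bv]]]] := walk_crosses w xy.
by rewrite -(crossing_edge (sF _ eF) euv bu bv).
Qed.

Definition upclosed (F : {set E}) : bool :=
  [forall e in F, (e \in K) && [forall f, up e f ==> (f \in F)]].
Local Notation closed := upclosed.

Implicit Types F G : {set E}.

Lemma closedP F : reflect
  ({subset F <= K} /\ forall e f, e \in F -> up e f -> f \in F) (closed F).
Proof.
apply: (iffP forall_inP) => [h|[sF cF] e eF].
  split=> [e /h/andP[]//|e f /h/andP[_ /forallP/(_ f)/implyP]]; exact.
by rewrite sF //=; apply/forallP => f; apply/implyP; apply: cF.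
Qed.

Lemma closed_anc F e f : closed F -> e \in F -> anc f e -> f \in F.
Proof.
move=> /closedP[_ cF] eF /connectP[p]; elim: p e eF => [|h p IH] e eF /=.
  by move=> _ ->.
by move=> /andP[eh hp] fE; apply: (IH h) => //; apply: cF eF eh.
Qed.

Lemma closedU F G : closed F -> closed G -> closed (F :|: G).
Proof.
move=> /closedP[sF cF] /closedP[sG cG]; apply/closedP; split.
  by move=> e; rewrite inE => /orP[/sF|/sG].
by move=> e f; rewrite !inE => /orP[/cF h /h->|/cG h /h->]; rewrite ?orbT.
Qed.

Lemma closedI F G : closed F -> closed G -> closed (F :&: G).
Proof.
move=> /closedP[sF cF] /closedP[sG cG]; apply/closedP; split.
  by move=> e; rewrite inE => /andP[/sF].
by move=> e f; rewrite !inE => /andP[/cF h /cG h'] ef; rewrite (h f ef) (h' f ef).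
Qed.

Lemma closed0 : closed set0.
Proof. by apply/closedP; split=> e; rewrite inE. Qed.

Definition tree_of (F : {set E}) : {set V} * {set E} := (r |: ch @: F, F).

(** Every edge is a bridge. A walk in [T] from the root to a vertex therefore uses the edge above
    this vertex, so that the edges of [T] are closed under parents and determine its vertices.
    Conversely, a closed walk has to use its first edge again, which excludes cycles. *)
Lemma rooted_subtreeP T :
  rooted_subtree I T <-> closed T.2 /\ T = tree_of T.2.
Proof.
split.
  move=> [[[sV sE ends_in] _ conn _] rT].
  have sK : {subset T.2 <= K} by move=> e /(subsetP sE); rewrite (arb_edges AI).
  have ch_in f : f \in K -> ch f \in T.1 -> f \in T.2.
    move=> fK vT; have [s w] := conn _ _ rT vT.
    have [|_ //] := walk_through (f := f) sK w.
    by rewrite below_root below_ch // anc_refl.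
  have ends e : e \in T.2 -> par e \in T.1 /\ ch e \in T.1.
    move=> eT; have := ends_in e eT; have := arb_joins AI (sK e eT).
    by rewrite /joins => /orP[]/eqP-> [].
  split.
    apply/closedP; split=> // e f eT /and3P[_ fK /eqP fe]; apply: ch_in => //.
    by rewrite fe; case: (ends e eT).
  rewrite /tree_of; case: T sV sE ends_in conn rT sK ch_in ends => T1 T2 /=.
  move=> sV sE ends_in conn rT sK ch_in ends; congr pair; apply/setP => v.
  rewrite !inE; apply/idP/predU1P => [vT|[->//|/imsetP[e eT ->]]].
    have [->|nr] := eqVneq v r; first by left.
    right; have := subsetP sV _ vT; rewrite (arb_verts AI) inE (negbTE nr) /=.
    by move=> /mapP[f fK vE]; rewrite vE; apply: imset_f; apply: ch_in; rewrite -?vE.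
  by case: (ends e eT).
move=> [cF ->]; move: T.2 cF => F {T} cF.
have /closedP[sF upF] := cF; split; last by rewrite /= !inE eqxx.
have parF e : e \in F -> par e \in r |: ch @: F.
  move=> eF; rewrite inE; have [->|[f fK fe]] := arb_par (sF e eF).
    by rewrite inE eqxx.
  by rewrite -fe imset_f ?orbT // (upF e) // /parent_edge /= sF // fK fe eqxx.
have reach v : v \in r |: ch @: F -> exists s, walk I F r s v.
  rewrite !inE => /predU1P[->|/imsetP[e eF ->{v}]]; first by exists [::] => /=.
  have eK := sF e eF; move: e eK eF.
  apply: (arb_ind (Q := fun e => e \in F -> exists s, walk I F r s (ch e))).
  move=> e eK IH eF.
  have [s w] : exists s, walk I F r s (par e).
    have := parF e eF; rewrite !inE => /predU1P[->|/imsetP[f fF ef]].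
      by exists [::] => /=.
    by have [s w] := IH f (sF f fF) (esym ef) fF; exists s; rewrite ef.
  exists (s ++ [:: (e, ch e)]); apply: walk_cat w _.
  by rewrite /= eF (arb_joins AI) /=.
split=> /=.
- split=> /=.
  + apply/subsetP => v; rewrite !inE (arb_verts AI) inE.
    move=> /predU1P[->|/imsetP[e eF ->]]; first by rewrite eqxx.
    by rewrite map_f ?orbT // sF.
  + by apply/subsetP => e /sF; rewrite (arb_edges AI).
  + move=> e eF; have chF : ch e \in r |: ch @: F by rewrite inE imset_f ?orbT.
    have := arb_joins AI (sF e eF); rewrite /joins.
    by case/orP => /eqP -> /=; rewrite chF parF.
- by apply/set0Pn; exists r; rewrite !inE eqxx.
- move=> x y /reach[s w] /reach[s' w']; have [s1 w1] := walk_rev w.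
  by exists (s1 ++ s'); apply: walk_cat w1 w'.
- move=> [x [s]]; rewrite /is_cycle; case: s => //= -[e z] s /andP[w].
  move: w => /and3P[eF exz w] /andP[/andP[es _] _]; case/negP: es.
  have eK := sF e eF.
  have [|-> //] := walk_through (f := e) sF w.
  have [[-> ->]|[-> ->]] := joins_inv (arb_joins AI eK) exz.
    by rewrite below_ch // below_own_par // anc_refl.
  by rewrite below_ch // below_own_par // anc_refl.
Qed.

End Arborescence.

(** * Contraction *)

Section Contraction.
Local Open Scope ring_scope.
Variables (R : realFieldType) (V E : finType).
Variables (I : instance R V E) (par ch : E -> V) (K : seq E).
Hypothesis AI : arb I par ch K.
Local Notation r := (root I).
Local Notation closed := (upclosed par ch K).
Local Notation up := (parent_edge par ch K).
Implicit Types X F : {set E}.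

Lemma closed_sub F : closed F -> {subset F <= K}.
Proof. by case/closedP. Qed.

Lemma closed_up F e f : closed F -> e \in F -> up e f -> f \in F.
Proof. by case/closedP => _; apply. Qed.

Lemma closed_par F e : closed F -> e \in F -> par e \in r |: ch @: F.
Proof.
move=> cF eF; have eK := closed_sub cF eF; rewrite !inE.
have [->|[f fK fe]] := arb_par AI eK; first by rewrite eqxx.
by rewrite -fe imset_f ?orbT // (closed_up cF eF) // /parent_edge /= eK fK fe /=.
Qed.

Lemma ends_arb e v : e \in K ->
  (v == (ends I e).1) || (v == (ends I e).2) = (v == par e) || (v == ch e).
Proof.
by move=> /(arb_joins AI); rewrite /joins => /orP[]/eqP-> //=; rewrite orbC.
Qed.

Lemma formed_by_closed X : closed X -> formed_by I X = tree_of I ch X.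
Proof.
move=> cX; congr pair; apply/setP => v; rewrite inE [in RHS]inE !in_set1.
have [//|nr /=] := eqVneq v r.
rewrite inE; apply/existsP/imsetP => [[e /andP[eX]]|[e eX ->]]; last first.
  by exists e; rewrite eX ends_arb ?eqxx ?orbT // (closed_sub cX eX).
rewrite ends_arb ?(closed_sub cX eX) // => /orP[]/eqP ve; last by exists e.
by have := closed_par cX eX; rewrite -ve !inE (negbTE nr) => /imsetP[f]; exists f.
Qed.

(** Contracting [X] moves some parent ends to the root. The child end of a remaining edge is never
    contracted, so [ch] is kept. *)
Definition pcon X (e : E) : V := if par e \in r |: ch @: X then r else par e.
Definition kcon X : seq E := [seq e <- K | e \notin X].

Lemma mem_kcon X e : (e \in kcon X) = (e \notin X) && (e \in K).
Proof. by rewrite mem_filter. Qed.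

Lemma ch_contracted X e : {subset X <= K} -> e \in K ->
  (ch e \in r |: ch @: X) = (e \in X).
Proof.
move=> sX eK; rewrite !inE (negbTE (arb_ch_root AI eK)) /=.
apply/imsetP/idP => [[f fX ef]|eX]; last by exists e.
by rewrite (arb_ch_inj AI eK (sX f fX) ef).
Qed.

(** The order survives the deletion of [X] from the list: a parent end whose edge has been deleted
    has become the root. *)
Lemma arb_contract X : closed X ->
  arb (contract I (tree_of I ch X)) (pcon X) ch (kcon X).
Proof.
move=> cX; have sX := closed_sub cX; split.
- move=> e; rewrite mem_kcon => /andP[nX eK].
  have := arb_joins AI eK; rewrite /joins /= /pcon.
  have := ch_contracted sX eK; rewrite (negbTE nX).
  by move=> nch /orP[]/eqP-> /=; rewrite nch eqxx ?orbT.
- by move=> e; rewrite mem_kcon inE (arb_edges AI).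
- move=> v; rewrite /= inE in_set1 [in RHS]inE; have [//|nr /=] := eqVneq v r.
  rewrite in_setD (arb_verts AI) [v \in r :: _]inE (negbTE nr) /=.
  apply/andP/mapP => [[nX /mapP[e eK ve]]|[e]].
    by exists e; rewrite // mem_kcon eK -(ch_contracted sX eK) -ve nX.
  rewrite mem_kcon => /andP[nX eK] ->.
  by rewrite ch_contracted // nX map_f.
- have := arb_topo AI; rewrite /kcon /=.
  elim: (K) => //= e K' IH /and3P[pe ne /IH tK].
  case: ifP => // neX /=; rewrite tK andbT; apply/andP; split.
    rewrite /pcon; case: ifP => [_|npX]; first exact: mem_head.
    move: pe; rewrite !inE => /predU1P[pr|/mapP[f fK fe]].
      by rewrite pr !inE eqxx in npX.
    rewrite fe map_f ?orbT // mem_filter fK andbT.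
    by apply: contraFN npX => fX; rewrite fe !inE imset_f ?orbT.
  apply: contra ne; rewrite !inE => /predU1P[->|/mapP[f]]; first by rewrite eqxx.
  by rewrite mem_filter => /andP[_ fK] ->; rewrite map_f ?orbT.
Qed.

(** The edge sets of the rooted subtrees of the contraction of a closed [X], expressed in the
    original tree so that different contractions can be compared. *)
Definition adm X F : bool := [disjoint F & X] && closed (X :|: F).

Lemma closed_contract X F : closed X ->
  (upclosed (pcon X) ch (kcon X) F) = adm X F.
Proof.
move=> cX; have sX := closed_sub cX; apply/closedP/andP.
  move=> [sF uF]; split.
    by apply/pred0P => e /=; apply/andP => -[/sF]; rewrite mem_kcon => /andP[/negP].
  apply/closedP; split.
    by move=> e; rewrite inE => /orP[/sX//|/sF]; rewrite mem_kcon => /andP[].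
  move=> e f; rewrite !inE => /orP[eX /(closed_up cX eX)->//|eF] /and3P[_ fK fe].
  have [//|nX /=] := boolP (f \in X); apply: (uF e) => //.
  rewrite /parent_edge /= sF // mem_kcon nX fK /= /pcon.
  by rewrite -(eqP fe) ch_contracted // (negbTE nX).
move=> [dF cF]; have nX f : f \in F -> f \notin X by move/(disjointFr dF) => ->.
split=> [e eF|e f eF].
  by rewrite mem_kcon nX // (closed_sub cF) // inE eF orbT.
rewrite /parent_edge /= !mem_kcon => /and3P[/andP[_ eK] /andP[nfX fK]].
rewrite /pcon; case: ifP => [_|_ fe].
  by rewrite (negbTE (arb_ch_root AI fK)).
have : f \in X :|: F.
  by apply: (closed_up cF (e := e)); [rewrite inE eF orbT|rewrite /parent_edge /= eK fK].
by rewrite inE (negbTE nfX).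
Qed.

(** Only child ends count, so the root contributes nothing, as in a contraction. *)
Definition sprize F : R := \sum_(e in F) prize I (ch e).
Definition scost F : R := \sum_(e in F) cost I e.

Lemma sum_contract X F : {subset F <= K} ->
  total_prize (contract I (tree_of I ch X)) (tree_of I ch F) = sprize F.
Proof.
move=> sF; rewrite /total_prize /= big_setU1 /=; last first.
  by apply/imsetP => -[e /sF /(arb_ch_root AI)/eqP h /esym].
rewrite eqxx add0r big_imset /=.
  by apply: eq_bigr => e /sF /(arb_ch_root AI)/negbTE->.
by move=> e f /sF eK /sF fK; apply: (arb_ch_inj AI).
Qed.

Lemma sum_tree F : {subset F <= K} ->
  total_prize I (tree_of I ch F) = prize I r + sprize F.
Proof.
move=> sF; rewrite /total_prize /= big_setU1 /=; last first.
  by apply/imsetP => -[e /sF /(arb_ch_root AI)/eqP h /esym].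
by rewrite big_imset //= => e f /sF eK /sF fK; apply: (arb_ch_inj AI).
Qed.

Definition kset : {set E} := [set e in K].

Lemma closed_kset : closed kset.
Proof. by apply/closedP; split=> [e|e f]; rewrite !inE // => _ /and3P[]. Qed.

Lemma uncollected_closed (pi : seq E) : closed [set e in pi] ->
  uncollected I pi = sprize (kset :\: [set e in pi]).
Proof.
move=> cX; rewrite /uncollected /contract_seq formed_by_closed //.
set X := [set e in pi]; rewrite -(@sum_contract X); last first.
  by move=> e; rewrite !inE => /andP[].
apply: eq_bigl => v; rewrite (arb_verts (arb_contract cX)) [in RHS]inE in_set1 inE.
congr (_ || _); apply/mapP/imsetP => -[e eK ->]; exists e => //.
  by move: eK; rewrite mem_kcon !inE.
by move: eK; rewrite mem_kcon !inE.
Qed.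

(* [T] is a min-max subtree, of density [l], of the contraction of [X]. *)
Record best X (T : {set E}) (l : R) : Prop := Best {
  best_adm : adm X T;
  best_neq0 : T != set0;
  best_eq : sprize T = l * scost T;
  best_gt0 : 0 < l;
  best_max : forall F, adm X F -> sprize F <= l * scost F;
  best_min : forall F, adm X F -> F \subset T -> F != set0 ->
    l * scost F <= sprize F -> F = T
}.

Hypothesis VI : valid I.

Lemma cost_gt0 e : e \in K -> 0 < cost I e.
Proof. by move=> eK; have [_ _ h _] := VI; apply: h; rewrite -(arb_edges AI). Qed.

Lemma prize_ge0 e : e \in K -> 0 <= prize I (ch e).
Proof.
move=> eK; have [_ _ _ h] := VI; apply: h.
by rewrite (arb_verts AI) inE map_f ?orbT.
Qed.

Lemma scost_ge0 F : {subset F <= K} -> 0 <= scost F.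
Proof. by move=> sF; apply: sumr_ge0 => e /sF eK; apply/ltW/cost_gt0. Qed.

Lemma sprize_ge0 F : {subset F <= K} -> 0 <= sprize F.
Proof. by move=> sF; apply: sumr_ge0 => e /sF eK; apply/prize_ge0. Qed.

Lemma scost_gt0 F : {subset F <= K} -> F != set0 -> 0 < scost F.
Proof.
move=> sF /set0Pn[e eF]; rewrite /scost (big_setD1 e) //=.
apply: ltr_pwDl; first by apply/cost_gt0/sF.
by apply: scost_ge0 => f; rewrite inE => /andP[_ /sF].
Qed.

Lemma adm_sub X F : adm X F -> {subset F <= K}.
Proof. by move=> /andP[_ /closed_sub h] e eF; apply: h; rewrite inE eF orbT. Qed.

Lemma rooted_contractP X (T : {set V} * {set E}) : closed X ->
  rooted_subtree (contract I (tree_of I ch X)) T <->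
  adm X T.2 /\ T = tree_of I ch T.2.
Proof.
by move=> cX; rewrite -closed_contract //; exact: (rooted_subtreeP (arb_contract cX) T).
Qed.

Lemma density_contract X F : {subset F <= K} ->
  density (contract I (tree_of I ch X)) (tree_of I ch F) =
  if F == set0 then 0 else sprize F / scost F.
Proof. by move=> sF; rewrite /density sum_contract. Qed.

(** All that remains is itself a competitor, of positive density. This excludes the trivial subtree
    and allows ratios to be replaced by the linear inequalities of [best]. *)
Lemma best_of_min_max X (T : {set V} * {set E}) : closed X -> sprize (kset :\: X) != 0 ->
  min_max_subtree (contract I (tree_of I ch X)) T ->
  adm X T.2 /\ exists l, best X T.2 l.
Proof.
move=> cX p0 [[/(rooted_contractP _ cX)[aT ->] dmax] dmin]; split=> //.
move: T.2 aT dmax dmin => F {T} aF dmax dmin /=.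
have sF := adm_sub aF.
have {}dmax G : adm X G -> density (contract I (tree_of I ch X)) (tree_of I ch G)
    <= density (contract I (tree_of I ch X)) (tree_of I ch F).
  by move=> aG; apply/dmax/rooted_contractP.
set l := density _ (tree_of I ch F) in dmax.
have sKX : {subset kset :\: X <= K} by move=> e; rewrite !inE => /andP[].
have aKX : adm X (kset :\: X).
  apply/andP; split; first by rewrite disjoints_subset; apply/subsetP => e; rewrite !inE => /andP[].
  rewrite (_ : _ :|: _ = kset) ?closed_kset //; apply/setP => e; rewrite !inE.
  by case eX: (e \in X) => //=; rewrite (closed_sub cX).
have KX0 : kset :\: X != set0.
  by apply: contraNneq p0 => ->; rewrite /sprize big_set0.
have l_gt0 : 0 < l.
  apply: lt_le_trans (dmax _ aKX); rewrite density_contract // (negbTE KX0).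
  by rewrite divr_gt0 ?scost_gt0 // lt0r p0 sprize_ge0.
have F0 : F != set0.
  by apply: contraTneq l_gt0 => F0; rewrite /l /density /= F0 eqxx ltxx.
have lE : l = sprize F / scost F by rewrite /l density_contract // (negbTE F0).
exists l; split=> //.
- by rewrite lE divfK // gt_eqF // scost_gt0.
- move=> G aG; have [->|G0] := eqVneq G set0.
    by rewrite /sprize /scost !big_set0 mulr0.
  have := dmax G aG; rewrite density_contract ?(negbTE G0); last exact: adm_sub aG.
  by rewrite ler_pdivrMr // scost_gt0 //; apply: adm_sub aG.
- move=> G aG sGF G0 le; have sG := adm_sub aG.
  suff : tree_of I ch G = tree_of I ch F by case.
  apply: dmin => //=; last by rewrite setUS ?imsetS.
  split; first by apply/rooted_contractP.
  move=> T' /(rooted_contractP _ cX)[aT' ->]; apply: le_trans (dmax _ aT') _.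
  by rewrite density_contract // (negbTE G0) ler_pdivlMr // scost_gt0.
Qed.

Lemma min_max_of_best X F l : closed X -> best X F l ->
  min_max_subtree (contract I (tree_of I ch X)) (tree_of I ch F).
Proof.
move=> cX [aF F0 FE l0 Fmax Fmin]; have sF := adm_sub aF.
have dF : density (contract I (tree_of I ch X)) (tree_of I ch F) = l.
  by rewrite density_contract // (negbTE F0) FE mulfK // gt_eqF // scost_gt0.
split; first split; first by apply/rooted_contractP.
  move=> T' /(rooted_contractP _ cX)[aT' ->]; rewrite dF.
  have sT := adm_sub aT'; rewrite density_contract //; case: ifPn => [_|T0].
    exact: ltW.
  by rewrite ler_pdivrMr ?scost_gt0 // Fmax.
move=> T' [/(rooted_contractP _ cX)[aT' T'E] max'] _ sT'; rewrite T'E.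
have sT := adm_sub aT'.
have := max' (tree_of I ch F); rewrite dF T'E density_contract // => h.
have {}h : l <= if T'.2 == set0 then 0 else sprize T'.2 / scost T'.2.
  by apply: h; apply/rooted_contractP.
move: h; case: ifPn => [_|T0 h]; first by rewrite leNgt l0.
by rewrite (Fmin T'.2) // -ler_pdivlMr // scost_gt0.
Qed.

Lemma closed_add X e : closed X -> e \in K -> par e \in r |: ch @: X ->
  closed (e |: X).
Proof.
move=> cX eK; rewrite !inE => pe; apply/closedP; split.
  by move=> f; rewrite !inE => /predU1P[->//|/(closed_sub cX)].
move=> f g; rewrite !inE => /predU1P[->|fX]; last first.
  by move/(closed_up cX fX) => ->; rewrite orbT.
move=> /and3P[_ gK /eqP ge]; move: pe; rewrite -ge => /orP[/eqP gr|].
  by have := arb_ch_root AI gK; rewrite gr eqxx.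
by move=> /imsetP[h hX] /(arb_ch_inj AI gK (closed_sub cX hX)) ->; rewrite hX orbT.
Qed.

Lemma root_incident X e : closed X -> e \in K -> e \notin X ->
  (r == (ends (contract I (tree_of I ch X)) e).1) ||
  (r == (ends (contract I (tree_of I ch X)) e).2) = (par e \in r |: ch @: X).
Proof.
move=> cX eK nX; have AX := arb_contract cX.
have eKX : e \in kcon X by rewrite mem_kcon nX.
have := @ends_arb; have := arb_joins AX eKX; rewrite {1}/joins => /orP[]/eqP-> _ /=.
  rewrite [r == ch e]eq_sym (negbTE (arb_ch_root AI eK)) orbF /pcon.
  case: ifP => [|/negbT]; first by rewrite eqxx.
  by rewrite !inE negb_or eq_sym => /andP[/negbTE].
rewrite [r == ch e]eq_sym (negbTE (arb_ch_root AI eK)) /= /pcon.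
case: ifP => [|/negbT]; first by rewrite eqxx.
by rewrite !inE negb_or eq_sym => /andP[/negbTE].
Qed.

Lemma set_rcons (s : seq E) e : [set x in rcons s e] = e |: [set x in s].
Proof. by apply/setP => x; rewrite !inE mem_rcons inE. Qed.

Lemma dg_run pi : dg_reach I pi ->
  [/\ closed [set e in pi], uniq pi & forall e0 t, (t < size pi)%N ->
    [/\ closed [set e in take t pi], sprize (kset :\: [set e in take t pi]) != 0,
        par (nth e0 pi t) \in r |: ch @: [set e in take t pi] &
        exists T l, best [set e in take t pi] T l /\ nth e0 pi t \in T]].
Proof.
elim=> [|{}pi T e _ [cX un IH] u0 mm eT inc].
  split=> //; rewrite (_ : [set _ in _] = set0) ?closed0 //; apply/setP => e; rewrite !inE.
rewrite uncollected_closed // in u0.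
rewrite /contract_seq formed_by_closed // in mm inc.
have [aT [l bT]] := best_of_min_max cX u0 mm.
have nX : e \notin [set x in pi] by case/andP: aT => /disjointFr ->.
have eK := adm_sub aT eT; rewrite root_incident // in inc.
split; first by rewrite set_rcons; apply: closed_add.
  by rewrite rcons_uniq un andbT; rewrite inE in nX.
move=> e0 t; rewrite size_rcons ltnS leq_eqVlt => /predU1P[->|lt].
  rewrite -cats1 take_size_cat // cats1 nth_rcons ltnn eqxx.
  by split=> //; exists T.2, l.
by rewrite -cats1 takel_cat ?(ltnW lt) // nth_cat lt; apply: IH.
Qed.

Lemma dg_step_best pi F l e : dg_reach I pi -> uncollected I pi != 0 ->
  best [set x in pi] F l -> e \in F -> par e \in r |: ch @: [set x in pi] ->
  dg_reach I (rcons pi e).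
Proof.
move=> rp u0 bF eF pe; have [cX _ _] := dg_run rp.
have [aF _ _ _ _ _] := bF; have eK := adm_sub aF eF.
apply: (@dg_step _ _ _ _ _ (tree_of I ch F)) => //; rewrite /contract_seq formed_by_closed //.
  exact: min_max_of_best bF.
by rewrite root_incident //; case/andP: aF => /disjointFr ->.
Qed.

End Contraction.

(** * The greedy sequence is competitive *)

Section Greedy.
Local Open Scope ring_scope.
Variables (R : realFieldType) (V E : finType).
Variables (I : instance R V E) (par ch : E -> V) (K : seq E).
Hypotheses (AI : arb I par ch K) (VI : valid I).
Local Notation r := (root I).
Local Notation closed := (upclosed par ch K).
Local Notation anc := (anc par ch K).
Local Notation adm := (adm par ch K).
Local Notation best := (best I par ch K).
Local Notation P := (sprize I ch).
Local Notation C := (scost I).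
Implicit Types X F G T Z : {set E}.

Lemma setUDK F G : F :|: (G :\: F) = F :|: G.
Proof. by apply/setP => e; rewrite !inE; case: (e \in F). Qed.

Lemma disjoint_setD F G : [disjoint F :\: G & G].
Proof.
by rewrite -setI_eq0; apply/eqP/setP => e; rewrite !inE andbAC andNb.
Qed.

Lemma sprizeID F G : P F = P (F :&: G) + P (F :\: G).
Proof. exact: big_setID. Qed.

Lemma scostID F G : C F = C (F :&: G) + C (F :\: G).
Proof. exact: big_setID. Qed.

Lemma sprizeU F G : [disjoint F & G] -> P (F :|: G) = P F + P G.
Proof.
rewrite disjoint_sym => d; rewrite (sprizeID _ F) (setIidPr (subsetUl F G)).
by rewrite setDUl setDv set0U (setDidPl d).
Qed.

Lemma scostU F G : [disjoint F & G] -> C (F :|: G) = C F + C G.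
Proof.
rewrite disjoint_sym => d; rewrite (scostID _ F) (setIidPr (subsetUl F G)).
by rewrite setDUl setDv set0U (setDidPl d).
Qed.

Lemma scost_sub F G : {subset G <= K} -> F \subset G -> C F <= C G.
Proof.
move=> sG sFG; rewrite (scostID G F) (setIidPr sFG) lerDl.
by apply: (scost_ge0 AI VI) => e; rewrite inE => /andP[_ /sG].
Qed.

Lemma best_uniq X T l T' l' : best X T l -> best X T' l' -> l <= l'.
Proof.
move=> bT bT'; have [aT T0 TE _ _ _] := bT; have [_ _ _ _ Tmax _] := bT'.
have := Tmax _ aT; rewrite TE ler_pM2r //.
exact: (scost_gt0 AI VI (adm_sub aT)).
Qed.

(* A proper initial part of a min-max subtree has smaller density by
   minimality, so what remains of the subtree is denser than it was, and no
   denser subtree can leave it: otherwise the union would beat the maximum. *)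
Lemma best_stays X T l Z T' l' : best X T l -> adm X Z -> Z \proper T ->
  Z != set0 -> best (X :|: Z) T' l' -> T' \subset T /\ l < l'.
Proof.
move=> [aT T0 TE l0 Tmax Tmin] aZ pZ Z0 [aT' T'0 T'E l'0 Tmax' _].
have sT := adm_sub aT; have sT' := adm_sub aT'.
have sZT := proper_sub pZ.
have [dT cT] := andP aT; have [dZ cZ] := andP aZ; have [dT' cT'] := andP aT'.
have sub_gt0 F G : {subset F <= K} -> F :\: G != set0 -> 0 < C (F :\: G).
  move=> sF; apply: (scost_gt0 AI VI) => e; rewrite inE => /andP[_]; exact: sF.
have PZ : P Z < l * C Z.
  rewrite ltNge; apply/negP => /(Tmin _ aZ sZT Z0) ZT.
  by rewrite ZT properxx in pZ.
have TZ0 : T :\: Z != set0.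
  by rewrite setD_eq0; case/andP: pZ.
have aTZ : adm (X :|: Z) (T :\: Z).
  apply/andP; split.
    apply/pred0P => e /=; rewrite !inE; case eZ: (e \in Z); rewrite //= ?orbF.
    by apply/andP => -[eT]; rewrite (disjointFr dT eT).
  by rewrite -setUA setUDK (setUidPr sZT).
have PTZ : l * C (T :\: Z) < P (T :\: Z).
  move: TE; rewrite (sprizeID T Z) (scostID T Z) (setIidPr sZT).
  by move: PZ; lra.
have ll' : l < l'.
  rewrite -(ltr_pM2r (sub_gt0 T Z sT TZ0)).
  by apply: lt_le_trans PTZ _; apply: Tmax'.
split=> //; rewrite -setD_eq0; apply/negPn/negP => D0.
have aU : adm X (T :|: T').
  apply/andP; split.
    rewrite -setI_eq0 setIUl setU_eq0 !setI_eq0 dT.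
    by apply: disjointWr dT'; apply: subsetUl.
  have -> : X :|: (T :|: T') = (X :|: T) :|: (X :|: Z :|: T').
    apply/setP => e; rewrite !inE; have := subsetP sZT e.
    by case: (e \in X); case: (e \in T); case: (e \in Z); case: (e \in T') => //= /(_ isT).
  exact: closedU.
(* Maximality of [T] gives density at most [l] outside [T], maximality of [T'] gives at most [l']
   inside. As [l < l'], a nonempty part outside would push the density of [T'] below [l']. *)
have PD : P (T' :\: T) <= l * C (T' :\: T).
  have := Tmax _ aU; rewrite (sprizeID _ T) (scostID _ T).
  rewrite setIUl setIid (setUidPl _) ?subsetIr // setDUl setDv set0U.
  by move: TE; lra.
have aI : adm (X :|: Z) (T' :&: T).
  apply/andP; split; first by apply: disjointWl dT'; apply: subsetIl.
  by rewrite setUIr closedI // -setUA (setUidPr sZT).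
have := Tmax' _ aI; have := T'E; rewrite (sprizeID T' T) (scostID T' T).
have : l * C (T' :\: T) < l' * C (T' :\: T) by rewrite ltr_pM2r ?sub_gt0.
by move: PD; lra.
Qed.

(** The parent edge of an edge of the branch is comparable with [e]: it is in the branch as well or,
    lying above [e], already in [X]. *)
Lemma branch_adm X T e : closed X -> adm X T -> e \in T ->
  par e \in r |: ch @: X ->
  adm X [set g in T | anc e g] /\ adm X (T :\: [set g in T | anc e g]).
Proof.
move=> cX aT eT pe; set T1 := [set g in T | anc e g].
have sT := adm_sub aT; have [dT cT] := andP aT.
have cXe := closed_add AI cX (sT e eT) pe.
have sub_dis F : F \subset T -> [disjoint F & X] by move=> s; apply: disjointWl s dT.
split.
  rewrite /adm sub_dis //=; last by apply/subsetP => g; rewrite inE => /andP[].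
  apply/closedP; split=> [g|g h].
    by rewrite !inE => /orP[/(closed_sub cX)|/andP[/sT]].
  rewrite inE => /orP[gX gh|]; first by rewrite inE (closed_up cX gX gh).
  rewrite inE => /andP[gT eg] gh.
  have : h \in X :|: T by apply: closed_up cT _ gh; rewrite inE gT orbT.
  rewrite !inE => /orP[->//|hT]; rewrite hT /=.
  have hg : anc h g by apply: up_anc gh _; apply: anc_refl.
  have /orP[->|he] := anc_chain AI eg hg; first by rewrite orbT.
  have := closed_anc cXe (setU11 _ _) he.
  by rewrite !inE => /predU1P[->|->] //; rewrite anc_refl orbT.
rewrite /adm sub_dis ?subsetDl //=; apply/closedP; split=> [g|g h].
  by rewrite !inE => /orP[/(closed_sub cX)|/andP[_ /sT]].
rewrite inE => /orP[gX gh|]; first by rewrite inE (closed_up cX gX gh).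
rewrite !inE => /andP[ng gT] gh.
have : h \in X :|: T by apply: closed_up cT _ gh; rewrite inE gT orbT.
rewrite !inE => /orP[->//|hT]; rewrite hT /= andbT.
by rewrite gT /= in ng; rewrite (contra _ ng) ?orbT // => /(up_anc gh).
Qed.

(** This is the uniqueness of the root edge of a min-max subtree: the rest of [T] has density at
    most [l], so the branch through [e] has density at least [l] and equals [T] by minimality. *)
Lemma best_root_anc X T l e f : closed X -> best X T l -> e \in T ->
  par e \in r |: ch @: X -> f \in T -> anc e f.
Proof.
move=> cX [aT T0 TE l0 Tmax Tmin] eT pe fT.
have [a1 a2] := branch_adm cX aT eT pe; set T1 := [set g in T | anc e g] in a1 a2.
have T1T : T1 \subset T by apply/subsetP => g; rewrite inE => /andP[].
have := TE; rewrite (sprizeID T T1) (scostID T T1) (setIidPr T1T) => s.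
have T1E : T1 = T.
  apply: Tmin => //; first by apply/set0Pn; exists e; rewrite inE eT anc_refl.
  by have := Tmax _ a2; move: s; lra.
by move: fT; rewrite -T1E inE => /andP[].
Qed.

(* In a subtree of maximum density every branch at the root has that density. *)
Lemma best_exists X T l e : closed X -> adm X T -> e \in T ->
  par e \in r |: ch @: X -> 0 < l -> P T = l * C T ->
  (forall F, adm X F -> P F <= l * C F) -> exists2 F, best X F l & e \in F.
Proof.
move=> cX aT eT pe l0 TE Tmax.
have [a1 a2] := branch_adm cX aT eT pe; set T1 := [set g in T | anc e g] in a1 a2.
have T1T : T1 \subset T by apply/subsetP => g; rewrite inE => /andP[].
have T1E : l * C T1 <= P T1.
  have := Tmax _ a2; move: TE; rewrite (sprizeID T T1) (scostID T T1) (setIidPr T1T).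
  by lra.
pose q F := [&& adm X F, F != set0, F \subset T1 & l * C F <= P F].
have qT1 : q T1.
  by rewrite /q a1 T1E subxx !andbT /=; apply/set0Pn; exists e; rewrite inE eT anc_refl.
have [F /minsetP[/and4P[aF F0 sF FE] Fmin] _] := minset_exists qT1.
exists F.
  split=> //; first by apply/eqP; rewrite eq_le Tmax.
  move=> G aG sG G0 GE; apply: Fmin => //.
  by rewrite /q aG G0 GE andbT; apply: subset_trans sF.
(* A nonempty admissible part of the branch contains [e], which is an ancestor of all its edges. *)
have /set0Pn[f fF] := F0.
have : anc e f by have := subsetP sF f fF; rewrite inE => /andP[].
have [dF cF] := andP aF; have [dT _] := andP aT.
have fXF : f \in X :|: F by rewrite inE fF orbT.
by move=> /(closed_anc cF fXF); rewrite inE (disjointFr dT eT).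
Qed.

Variable pi : seq E.
Hypothesis reach : dg_reach I pi.
Local Notation A t := [set e in take t pi].
Local Notation n := (size pi).

Lemma greedy_uniq : uniq pi.
Proof. by have [] := dg_run AI VI reach. Qed.

Lemma greedy_closed t : closed (A t).
Proof.
have [cX _ h] := dg_run AI VI reach.
case: (ltnP t n) => [lt|le]; last by rewrite take_oversize.
have e1 : E by case: (pi) lt.
by have [] := h e1 t lt.
Qed.

Lemma greedy_sub t : {subset A t <= K}.
Proof. exact: closed_sub (greedy_closed t). Qed.

Lemma greedy_mono s t : (s <= t)%N -> A s \subset A t.
Proof.
move=> le; apply/subsetP => e; rewrite !inE -(subnKC le) takeD mem_cat => ->.
by [].
Qed.

Variable e0 : E.
Local Notation "'e_ t" := (nth e0 pi t) (at level 8, t at level 2).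

Lemma greedyS t : (t < n)%N -> A t.+1 = 'e_t |: A t.
Proof. by move=> lt; rewrite (take_nth e0) // set_rcons. Qed.

Lemma greedy_notin t : (t < n)%N -> 'e_t \notin A t.
Proof.
move=> lt; rewrite inE; have := take_uniq t.+1 greedy_uniq.
by rewrite (take_nth e0) // rcons_uniq => /andP[].
Qed.

Lemma greedy_best t : (t < n)%N ->
  exists T l, best (A t) T l /\ 'e_t \in T.
Proof. by move=> lt; have [_ _ /(_ e0 t lt)[]] := dg_run AI VI reach. Qed.

Lemma greedy_par t : (t < n)%N -> par 'e_t \in r |: ch @: A t.
Proof. by move=> lt; have [_ _ /(_ e0 t lt)[]] := dg_run AI VI reach. Qed.

Lemma greedy_inside s t T l : best (A s) T l -> (s < t < n)%N ->
  A t :\: A s \proper T -> 'e_s \in T ->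
  'e_t \in T /\ forall T' l', best (A t) T' l' -> l < l'.
Proof.
move=> bT /andP[st tn] pT eT.
have AE : A t = A s :|: (A t :\: A s).
  by rewrite setUDK (setUidPr _) // greedy_mono // ltnW.
have aZ : adm (A s) (A t :\: A s).
  by rewrite /adm -AE greedy_closed disjoint_setD.
have Z0 : A t :\: A s != set0.
  apply/set0Pn; exists 'e_s; rewrite inE greedy_notin ?(ltn_trans st) //=.
  have := subsetP (greedy_mono st) 'e_s; rewrite greedyS ?(ltn_trans st) //.
  by apply; rewrite setU11.
have key T' l' : best (A t) T' l' -> T' \subset T /\ l < l'.
  by rewrite {1}AE; apply: best_stays bT aZ pT Z0.
split; last by move=> T' l' /key[].
by have [T' [l' [/key[sT _] /(subsetP sT)]]] := greedy_best tn.
Qed.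

(** While [T] is not exhausted, [greedy_inside] puts the next edge in [T]; so the edges taken from
    time [s] on fill up [T] exactly before any other edge is taken. *)
Lemma greedy_block s t T l : best (A s) T l -> 'e_s \in T -> (s < t <= n)%N ->
  (exists2 s', (s < s' <= t)%N & A s' = A s :|: T) \/ A t :\: A s \proper T.
Proof.
move=> bT eT; have dT : [disjoint T & A s] by case: bT => /andP[].
elim: t => // t IH /andP[]; rewrite ltnS leq_eqVlt => st tn.
suff sub : A t.+1 :\: A s \subset T \/
    exists2 s', (s < s' <= t)%N & A s' = A s :|: T.
  case: sub => [sub|[s' /andP[ss' s't] AE]]; last first.
    by left; exists s'; rewrite // ss' leqW.
  have [|ne] := eqVneq (A t.+1 :\: A s) T; last by right; rewrite properEneq ne.
  move=> TE; left; exists t.+1; first by rewrite ltnS leqnn andbT leq_eqVlt st.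
  by rewrite -TE setUDK (setUidPr _) // greedy_mono // ltnW // ltnS leq_eqVlt.
case/predU1P: st => [st|st].
  rewrite -st greedyS; last by rewrite st.
  by left; rewrite setDUl setDv setU0 (subset_trans (subsetDl _ _)) // sub1set.
case: IH => [|h|pT]; [by rewrite st ltnW|by right|left].
have [eT' _] := greedy_inside bT (introT andP (conj st tn)) pT eT.
rewrite greedyS // setDUl subUset (proper_sub pT) andbT.
by rewrite (subset_trans (subsetDl _ _)) // sub1set.
Qed.

Local Notation Q t := [set f | anc f 'e_t].

(** Let [T] be the subtree opened at time [s]. If it is completed by time [t], it pays for itself,
    its density being at least [l], and the claim is applied from its completion on. Otherwise the
    edge of time [t] lies in [T], below the root edge taken at time [s]; that edge is on the path
    and need not be paid for, and the claim is applied from [s.+1] on. *)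
Lemma greedy_deficit m s t l : (t - s <= m)%N -> (s <= t < n)%N -> 0 <= l ->
  (forall s' T l', (s <= s' <= t)%N -> best (A s') T l' -> l <= l') ->
  l * C ((A t :\: A s) :\: Q t) <= P (A t :\: A s).
Proof.
elim: m s => [|m IH] s le /andP[st tn] l0 hl.
  have -> : t = s by lia.
  by rewrite setDv set0D /sprize /scost !big_set0 mulr0.
have [->|ne] := eqVneq t s.
  by rewrite setDv set0D /sprize /scost !big_set0 mulr0.
have {ne}st : (s < t)%N by rewrite ltn_neqAle eq_sym ne.
have sn : (s < n)%N by apply: ltn_trans tn.
have [T [ls [bT eT]]] := greedy_best sn.
have lls : l <= ls by apply: hl bT; rewrite leqnn ltnW.
have [aT _ TE _ _ _] := bT; have dT : [disjoint T & A s] by case/andP: aT.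
have [[s' /andP[ss' s't] AE]|pT] := greedy_block bT eT (introT andP (conj st (ltnW tn))).
  have step : A t :\: A s = T :|: (A t :\: A s').
    have := greedy_mono s't; rewrite AE => /subUsetP[_ sT].
    apply/setP => e; rewrite !inE; have := subsetP sT e; rewrite inE.
    have := disjointFr dT (x := e); rewrite inE.
    case: (e \in T) => /= [/(_ isT)-> /(_ isT)->//|_ _].
    by rewrite orbF.
  have dis : [disjoint T & A t :\: A s'].
    rewrite -setI_eq0 AE; apply/eqP/setP => e; rewrite !inE.
    by case: (e \in T); rewrite ?orbT.
  rewrite step sprizeU // TE.
  have IH' := IH s' _ _ l0 _.
  have {IH'} : l * C ((A t :\: A s') :\: Q t) <= P (A t :\: A s').
    apply: IH' => [||s1 T1 l1 /andP[h1 h2]]; rewrite ?s't //; first lia.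
    by apply: hl; rewrite h2 andbT (leq_trans _ h1) // ltnW.
  have /(ler_wpM2l l0) : C ((T :|: (A t :\: A s')) :\: Q t) <= C T + C ((A t :\: A s') :\: Q t).
    rewrite (scostID _ T) lerD //; apply: scost_sub.
    - exact: adm_sub aT.
    - exact: subsetIr.
    - by move=> e; rewrite !inE => /and3P[_ _] h; apply: (@greedy_sub t); rewrite inE.
    - by apply/subsetP => e; rewrite !inE; case: (e \in T).
  have /ler_wpM2r/(_ _ _ lls) : 0 <= C T.
    by apply: (scost_ge0 AI VI); apply: adm_sub aT.
  by lra.
have [eT' _] := greedy_inside bT (introT andP (conj st tn)) pT eT.
have aes := best_root_anc (greedy_closed s) bT eT (greedy_par sn) eT'.
have -> : (A t :\: A s) :\: Q t = (A t :\: A s.+1) :\: Q t.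
  rewrite greedyS //; apply/setP => e; rewrite !inE.
  by have [->|//] := eqVneq e; rewrite aes.
apply: le_trans (IH s.+1 _ _ l0 _) _; [lia|lia| |].
  by move=> s1 T1 l1 /andP[h1 h2]; apply: hl; rewrite h2 andbT ltnW.
rewrite [leRHS](sprizeID _ (A t :\: A s.+1)) (setIidPr _) ?lerDl.
  apply: (sprize_ge0 AI VI) => e; rewrite !inE => /and3P[_ _] h.
  by apply: (@greedy_sub t); rewrite inE.
by apply: setDS; apply: greedy_mono.
Qed.

Definition maximal_for l X := forall F, closed F -> P F - l * C F <= P X - l * C X.

(** Skips completed blocks until the one, of density [l'], that is not completed by time [t]; inside
    it all densities are at least [l']. *)
Lemma greedy_block_start m s t T l : (t - s <= m)%N -> (s <= t < n)%N ->
  best (A s) T l -> maximal_for l (A s) ->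
  exists s' l', [/\ (s' <= t)%N, 0 < l', maximal_for l' (A s') &
    forall s1 T1 l1, (s' <= s1 <= t)%N -> best (A s1) T1 l1 -> l' <= l1].
Proof.
elim: m s T l => [|m IH] s T0 l le /andP[st tn] bT0 mx.
  have ts : t = s by lia.
  exists s, l; split=> //; first by case: bT0.
  move=> s1 T1 l1 h; have -> : s1 = s by lia.
  exact: best_uniq bT0.
have sn : (s < n)%N by apply: leq_ltn_trans tn.
have [T [ls [bT eT]]] := greedy_best sn.
have {bT0}lE : l = ls.
  by apply/eqP; rewrite eq_le (best_uniq bT0 bT) (best_uniq bT bT0).
rewrite -{}lE {T0 ls} in bT.
have [aT T0 TE l0 Tmax _] := bT; have sT := adm_sub aT.
have [dT cT] := andP aT.
have [/existsP[s' /andP[/andP[ss' s't] /eqP AE]]|none] := boolP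
    [exists s' : 'I_n, (s < s' <= t)%N && (A s' == A s :|: T)].
  have [T' [l' [bT' eT']]] := greedy_best (ltn_ord s').
  have [aT' T'0 T'E l'0 Tmax' _] := bT'; have [dT' cT'] := andP aT'.
  have sT' := adm_sub aT'.
  (* A denser next block would make the union of both blocks beat the first one. *)
  have ll' : l' <= l.
    have aU : adm (A s) (T :|: T').
      rewrite /adm setUA -AE cT' andbT -setI_eq0 setIUl setU_eq0 !setI_eq0 dT.
      by apply: disjointWr dT'; rewrite AE subsetUl.
    have dis : [disjoint T & T'].
      by rewrite disjoint_sym; apply: disjointWr dT'; rewrite AE subsetUr.
    have := Tmax _ aU; rewrite sprizeU // scostU // TE T'E mulrDr lerD2l ler_pM2r //.
    exact: (scost_gt0 AI VI).
  apply: (IH s' T' l') => //; [lia|by rewrite s't|].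
  (* Outside [A s'], [F] gains at most [l'] per unit of cost. Inside, [A s'] is still maximal for
     [l], since the added block has density [l], and lowering the multiplier from [l] to [l']
     favours [A s'], whose cost is larger. *)
  move=> F cF.
  have aF : adm (A s') (F :\: A s').
    by rewrite /adm setUDK closedU ?greedy_closed // disjoint_setD.
  have cI : closed (F :&: A s') by rewrite closedI ?greedy_closed.
  have := Tmax' _ aF; have := mx _ cI; have := mx _ (greedy_closed s').
  have PE : P (A s') = P (A s) + P T.
    by rewrite AE sprizeU // disjoint_sym.
  have CE : C (A s') = C (A s) + C T.
    by rewrite AE scostU // disjoint_sym.
  have CI : C (F :&: A s') <= C (A s').
    by apply: scost_sub; [exact: greedy_sub|exact: subsetIr].
  rewrite (sprizeID F (A s')) (scostID F (A s')) PE CE TE in CI *.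
  by move: ll' CI; nra.
exists s, l; split=> //; move=> s1 T1 l1 /andP[]; rewrite leq_eqVlt.
case/predU1P => [<- _|ss1 s1t]; first exact: best_uniq bT.
have s1n : (s1 < n)%N by apply: leq_ltn_trans tn.
have [[s' /andP[ss' s's1] AE]|pT] := greedy_block bT eT (introT andP (conj ss1 (ltnW s1n))).
  have s'n : (s' < n)%N by apply: leq_ltn_trans s1n.
  case/existsP: none; exists (Ordinal s'n).
  by rewrite /= ss' AE eqxx (leq_trans s's1).
have [_ h] := greedy_inside bT (introT andP (conj ss1 s1n)) pT eT.
by move=> /h /ltW.
Qed.

(** With the start [s] of the open block and its density [l'], maximality gives P F <= P (A s) + l'
    (B - C (A s)). The edges taken since [s] and off the path cost at least B - C (A s), because the
    path accounts for at most [chi]; [greedy_deficit] gives [l'] per unit of this cost. *)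
Lemma greedy_competitive t chi B F : (t < n)%N -> closed F -> C F <= B ->
  C (Q t) <= chi -> B + chi < C (A t.+1) -> P F <= P (A t).
Proof.
move=> tn cF CF CQ lt.
have A0 : A 0 = set0 by apply/setP => e; rewrite !inE take0.
have [T [l [bT _]]] := greedy_best (leq_ltn_trans (leq0n t) tn).
have mx : maximal_for l (A 0).
  move=> G cG; rewrite A0 /sprize /scost !big_set0 mulr0 subrr subr_le0.
  have [_ _ _ _ Tmax _] := bT; apply: Tmax.
  by rewrite A0 /adm set0U cG andbT -setI_eq0 setI0.
have [s [l' [st l'0 mx' h]]] := @greedy_block_start t 0 t T l (leq_subr _ _) tn bT mx.
have := @greedy_deficit t s t l' (leq_subr _ _) (introT andP (conj st tn)) (ltW l'0) h.
have etK : 'e_t \in K.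
  by apply: (@greedy_sub t.+1); rewrite greedyS // setU11.
have sQ : {subset Q t <= K} by move=> e; rewrite inE => /anc_mem; apply.
have CA : C (A t.+1) = cost I 'e_t + C (A t).
  by rewrite greedyS // /scost big_setU1 // greedy_notin.
(* The edge that exceeds the budget lies on its own path, so [chi] pays for it too. *)
have CQt : cost I 'e_t + C ((A t :\: A s) :&: Q t) <= C (Q t).
  rewrite {2}/scost (big_setD1 'e_t) ?inE ?anc_refl //= lerD2l; apply: scost_sub.
    by move=> e; rewrite inE => /andP[_ /sQ].
  apply/subsetP => e; rewrite !inE => /andP[/andP[_ eA] ->]; rewrite andbT.
  by apply: contraTneq eA => ->; have := greedy_notin tn; rewrite inE.
have sA := setIidPr (greedy_mono st).
have := mx' F cF; have := sprizeID (A t) (A s); have := scostID (A t) (A s).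
have := scostID (A t :\: A s) (Q t); rewrite {}sA.
set c1 := C (_ :&: Q t); set c2 := C (_ :\: Q t) => e1 e2 e3 h1 h2.
have h3 : l' * (B - C (A s)) <= l' * c2.
  by rewrite ler_wpM2l // ?ltW //; move: CQt; rewrite -/c1; lra.
have h4 : l' * C F <= l' * B by rewrite ler_wpM2l // ltW.
by lra.
Qed.

End Greedy.

(** * Distances, budgets and the competitive guarantee *)

Section Competitive.
Local Open Scope ring_scope.
Variables (R : realFieldType) (V E : finType).
Variables (I : instance R V E) (par ch : E -> V) (K : seq E).
Hypotheses (AI : arb I par ch K) (VI : valid I).
Local Notation r := (root I).
Local Notation anc := (anc par ch K).
Local Notation P := (sprize I ch).
Local Notation C := (scost I).

Lemma sum_cost_seq (s : seq E) : uniq s -> \sum_(e <- s) cost I e = C [set e in s].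
Proof. by move=> us; rewrite big_uniq //=; apply: eq_bigl => e; rewrite inE. Qed.

Lemma arb_path e : e \in K ->
  exists2 s, is_path I r s (ch e) &
    \sum_(a <- s) cost I a.1 = C [set f | anc f e].
Proof.
move=> eK.
suff [s [w us chs ancs]] : exists s, [/\ walk I (eset I) r s (ch e),
    uniq (unzip1 s), unzip2 s = map ch (unzip1 s) & unzip1 s =i anc^~ e].
  have sK : {subset unzip1 s <= K} by move=> f; rewrite ancs => /anc_mem; apply.
  exists s.
    rewrite /is_path w /= chs; apply/andP; split.
      by apply/mapP => -[f /sK /(arb_ch_root AI)/eqP h /esym].
    by rewrite map_inj_in_uniq // => f g /sK fK /sK gK; apply: (arb_ch_inj AI).
  rewrite -(big_map fst xpredT (cost I)) sum_cost_seq //.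
  by congr (C _); apply/setP => f; rewrite !inE ancs.
move: e eK; apply: (arb_ind AI) => e eK IH.
have w1 (F : {set E}) : e \in F -> walk I F (par e) [:: (e, ch e)] (ch e).
  by move=> eF; rewrite /= eF (arb_joins AI) /=.
have eE : e \in eset I by rewrite -(arb_edges AI).
have [pr|[f fK fe]] := arb_par AI eK.
  exists [:: (e, ch e)]; split; rewrite -?pr ?w1 // => g; rewrite !inE.
  apply/eqP/idP => [->|/anc_up[//|[h /and3P[_ hK /eqP]]]]; first exact: anc_refl.
  by rewrite pr => /eqP; rewrite (negbTE (arb_ch_root AI hK)).
have [s [w us chs ancs]] := IH f fK fe.
have eh : parent_edge par ch K e f by rewrite /parent_edge /= eK fK fe /=.
exists (s ++ [:: (e, ch e)]); split.
- by apply: walk_cat w _; rewrite fe w1.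
- rewrite /unzip1 map_cat cats1 rcons_uniq us andbT -/(unzip1 s) ancs.
  apply/negP => /(anc_idx AI) /=.
  by have := idx_lt AI eK; rewrite fe; lia.
- by rewrite /unzip1 /unzip2 !map_cat -/(unzip2 s) chs.
- move=> g; rewrite /unzip1 map_cat mem_cat -/(unzip1 s) ancs !inE.
  apply/orP/idP => [[fg|/eqP->]|/anc_up[->|[h eh' gh]]].
  + exact: up_anc eh fg.
  + exact: anc_refl.
  + by right.
  + by left; rewrite -(up_inj AI eh' eh).
Qed.

(** Each ancestor edge separates the root from [ch e], so every path uses all of them. *)
Lemma arb_dist e : e \in K -> is_dist I (ch e) (C [set f | anc f e]).
Proof.
move=> eK; split; first by have [s w sE] := arb_path eK; exists s.
move=> s /andP[w us]; have sE : {subset eset I <= K}.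
  by move=> f; rewrite (arb_edges AI).
have ue := walk_uniq_edges w us.
rewrite -(big_map fst xpredT (cost I)) sum_cost_seq //; apply: (scost_sub AI VI).
  by move=> f; rewrite inE => /(walk_edges w)/sE.
apply/subsetP => f; rewrite !inE => fe; have fK := anc_mem fe eK.
have [|//] := walk_through AI (f := f) sE w.
by rewrite (below_root AI) (below_ch AI) // fe.
Qed.

Lemma ecc_anc chi e : is_ecc I chi -> e \in K -> C [set f | anc f e] <= chi.
Proof.
move=> [_ h] eK; apply: h (arb_dist eK).
by rewrite (arb_verts AI) inE map_f ?orbT.
Qed.

(** Prefix costs do not decrease, so the affordable positions form an initial segment. The guard
    [0 < t] allows a negative [B]. *)
Lemma alg_take (pi : seq E) (B : R) : dg_reach I pi ->
  exists2 t, (t <= size pi)%N & [/\ alg I pi B = formed_by I [set e in take t pi],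
    ((0 < t)%N -> C [set e in take t pi] <= B) &
    (t < size pi)%N -> B < C [set e in take t.+1 pi]].
Proof.
move=> rp; have up := greedy_uniq AI VI rp.
pose c i := C [set e in take i pi].
have cE i : \sum_(e <- take i pi) cost I e = c i.
  by rewrite sum_cost_seq // take_uniq.
have c_mono i j : (i <= j)%N -> c i <= c j.
  move=> ij; apply: (scost_sub AI VI); last exact: greedy_mono.
  exact: (greedy_sub AI VI rp).
pose t := find (fun i => B < c i.+1) (iota 0 (size pi)).
have tn : (t <= size pi)%N by rewrite /t -{2}(size_iota 0 (size pi)) find_size.
have lt_t i : (i < t)%N -> c i.+1 <= B.
  move=> it; have := before_find 0%N it.
  by rewrite nth_iota ?add0n ?(leq_trans it) // => /negbT; rewrite -leNgt.
have ge_t : (t < size pi)%N -> B < c t.+1.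
  move=> lt; have := nth_find 0%N (a := fun i => B < c i.+1) (s := iota 0 (size pi)).
  by rewrite has_find size_iota -/t lt nth_iota // add0n; apply.
exists t => //; split=> //; last first.
  by case: (t) lt_t => // k h _; apply: h.
rewrite /alg; congr (formed_by I _); apply/setP => e.
apply/imsetP/idP => [[i]|]; rewrite inE ?cE.
  move=> ciB ->; have it : (i < t)%N.
    rewrite ltnNge; apply/negP => ti; have lt := leq_ltn_trans ti (ltn_ord i).
    by have := lt_le_trans (ge_t lt) (c_mono _ _ (ti : (t < i.+1)%N)); rewrite ltNge ciB.
  by rewrite inE (tnth_nth e) /= -(nth_take e it) mem_nth // size_takel.
move=> et; have e_pi := mem_take et.
have lt : (index e pi < size pi)%N by rewrite index_mem.
exists (Ordinal lt); last by rewrite (tnth_nth e) /= nth_index.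
have idxE : index e pi = index e (take t pi).
  by rewrite -{1}(cat_take_drop t pi) index_cat et.
by rewrite inE /= cE lt_t // idxE -{2}(size_takel tn) index_mem.
Qed.

Lemma competitive chi alpha mu (pi : seq E) B T :
  is_ecc I chi -> chi <= alpha -> 1 <= mu -> dg_output I pi -> 0 <= B ->
  is_opt I B T -> total_prize I T <= mu * total_prize I (alg I pi (B + alpha)).
Proof.
move=> ecc ca mu1 [rp u0] B0 [/(rooted_subtreeP AI)[cF ->] cT _].
move: T.2 cF cT => F {T} cF cT.
have sF := closed_sub cF.
have [t tn [-> _ ge_t]] := @alg_take pi (B + alpha) rp.
have cA := greedy_closed AI VI rp t.
rewrite (formed_by_closed AI) // !(sum_tree AI) //; last exact: closed_sub cA.
have r0 : 0 <= prize I r.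
  by have [rV _ _ h] := VI; apply: h.
have A0 : 0 <= P [set e in take t pi] by apply: (sprize_ge0 AI VI); apply: closed_sub cA.
suff le : P F <= P [set e in take t pi].
  apply: le_trans (_ : prize I r + P [set e in take t pi] <= _).
    by rewrite lerD2l.
  by rewrite ler_peMl // addr_ge0.
(* If the whole sequence is affordable, termination of the algorithm says that no prize is left
   outside it. *)
move: tn; rewrite leq_eqVlt => /predU1P[tn|tn].
  move: u0; rewrite (uncollected_closed AI); last first.
    by move: cA; rewrite tn take_size.
  rewrite tn take_size => p0.
  have sK G : {subset kset K :\: G <= K} by move=> e; rewrite !inE => /andP[].
  have : P F <= P (kset K).
    rewrite (sprizeID _ _ (kset K) F) (setIidPr _) ?lerDl ?(sprize_ge0 AI VI) //.
    by apply/subsetP => e /sF; rewrite inE.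
  rewrite (sprizeID _ _ (kset K) [set e in pi]) p0 addr0 (setIidPr _) //.
  apply/subsetP => e ex; rewrite inE; apply: (closed_sub cA).
  by rewrite tn take_size.
have e0 : E by case: (pi) tn.
apply: (@greedy_competitive _ _ _ _ _ _ _ AI VI pi rp e0 t alpha B) => //.
- apply: le_trans ca; apply: ecc_anc => //.
  apply: (greedy_sub AI VI rp (t := t.+1)); rewrite (take_nth e0) // inE mem_rcons.
  exact: mem_head.
- exact: ge_t.
Qed.

End Competitive.

(** * Orienting a tree *)

Section Orientation.
Variables (R : realFieldType) (V E : finType) (I : instance R V E).
Local Notation r := (root I).
Local Notation tpar := (fun x : E * (V * V) => x.2.1).
Local Notation tch := (fun x : E * (V * V) => x.2.2).

(* [s.1] lists the vertices reached so far and [s.2] the edges, each with its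
   parent end and its child end. *)
Definition ostep (s : seq V * seq (E * (V * V))) (e : E) :=
  let u := (ends I e).1 in let v := (ends I e).2 in
  if (u \in s.1) && (v \notin s.1) then (v :: s.1, (e, (u, v)) :: s.2)
  else if (v \in s.1) && (u \notin s.1) then (u :: s.1, (e, (v, u)) :: s.2)
  else s.

Definition oscan s := foldl ostep s (enum (eset I)).

(** As many scans as edges suffice: a scan that changes nothing ends the process, and any other one
    orients a new edge. *)
Definition orient := foldl (fun s _ => oscan s) ([:: r], [::]) (enum (eset I)).

Definition oriented s : Prop :=
  [/\ s.1 = rcons (map tch s.2) r, topo r tpar tch s.2 &
      {in s.2, forall x, x.1 \in eset I /\ joins I x.1 x.2.1 x.2.2}].

Lemma joins_ends e : joins I e (ends I e).1 (ends I e).2.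
Proof. by rewrite /joins; case: (ends I e) => u v; rewrite eqxx. Qed.

Lemma oriented_mem s : oriented s -> s.1 =i r :: map tch s.2.
Proof. by move=> [-> _ _] x; rewrite mem_rcons. Qed.

Lemma oriented_step s e : e \in eset I -> oriented s -> oriented (ostep s e).
Proof.
move=> eE os; have ms := oriented_mem os; have [s1 ts js] := os.
have eJ := joins_ends e; rewrite /ostep.
case: ifP => [/andP[us vs]|_].
  split=> /=; first by rewrite s1.
    by rewrite -!ms us vs.
  by move=> x; rewrite inE => /predU1P[->//|/js].
case: ifP => [/andP[vs us]|_ //].
split=> /=; first by rewrite s1.
  by rewrite -!ms us vs.
by move=> x; rewrite inE => /predU1P[->/=|/js//]; rewrite joins_sym.
Qed.

Definition balanced (s : seq V * seq (E * (V * V))) (e : E) : bool :=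
  ((ends I e).1 \in s.1) == ((ends I e).2 \in s.1).

Lemma ostepP s e : (ostep s e = s /\ balanced s e) \/
  size (ostep s e).2 = (size s.2).+1.
Proof.
rewrite /ostep /balanced; do 2![case: (_ \in s.1)] => /=; by [left|right].
Qed.

Lemma oscanP s (l : seq E) :
  (size s.2 <= size (foldl ostep s l).2)%N /\
  (size s.2 = size (foldl ostep s l).2 ->
   foldl ostep s l = s /\ all (balanced s) l).
Proof.
elim: l s => //= e l IH s; have [le eq] := IH (ostep s e).
case: (ostepP s e) => [[sE ->]|sz]; first by rewrite sE in le eq *.
by move: le; rewrite sz; split=> [|h]; lia.
Qed.

Lemma oriented_foldl s (l : seq E) : {subset l <= eset I} -> oriented s ->
  oriented (foldl ostep s l).
Proof.
elim: l s => //= e l IH s sl os; apply: IH => [f fl|].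
  by apply: sl; rewrite inE fl orbT.
by apply: oriented_step => //; apply: sl; rewrite mem_head.
Qed.

(** Both ends of a listed edge have been reached, whereas the child end of an edge is new when it is
    listed. *)
Lemma oriented_uniq s : oriented s -> uniq (map fst s.2).
Proof.
move=> [_]; elim: s.2 => //= x L IH /and3P[px nx tL] js.
rewrite IH // ?andbT; last by move=> y yL; apply: js; rewrite inE yL orbT.
apply/mapP => -[y yL xy].
have [_ jx] := js x (mem_head _ _).
have [_] : y.1 \in eset I /\ joins I y.1 y.2.1 y.2.2 by apply: js; rewrite inE yL orbT.
rewrite -xy => jy; case/negP: nx.
have yc : y.2.2 \in r :: map tch L by rewrite inE (map_f tch) ?orbT.
have yp := topo_par tL yL.
by have [[_ ->]|[_ ->]] := joins_inv jy jx.
Qed.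

(** Either no edge leaves the reached vertices, or there are at least as many oriented edges as
    scans. At the end the second case means that all edges are oriented, which again leaves no edge
    at the frontier. *)
Lemma oriented_orient : oriented orient /\ all (balanced orient) (enum (eset I)).
Proof.
have sE : {subset enum (eset I) <= eset I} by move=> e; rewrite mem_enum.
have step (l : seq E) : exists s, [/\ s = foldl (fun s _ => oscan s) ([:: r], [::]) l,
    oriented s & all (balanced s) (enum (eset I)) \/ (size l <= size s.2)%N].
  elim/last_ind: l => [|l e [s [sE' os hs]]]; first by exists ([:: r], [::]); split=> //; right.
  rewrite foldl_rcons -sE' size_rcons; exists (oscan s); split=> //.
    exact: oriented_foldl.
  have [le eq] := oscanP s (enum (eset I)).
  have [/eq[h bal]|ne] := eqVneq (size s.2) (size (oscan s).2).
    by left; rewrite /oscan h.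
  case: hs => [bal|h]; last by right; apply: leq_ltn_trans h _; rewrite ltn_neqAle ne.
  left; suff -> : oscan s = s by [].
  rewrite /oscan; elim: (enum _) bal => //= f l' IH /andP[bf /IH].
  have [[-> _]//|] := ostepP s f.
  by move: bf; rewrite /balanced /ostep => /eqP->; rewrite andbN => /= /eqP; rewrite eqn_leq ltnn andbF.
have [s [sE' os [bal|le]]] := step (enum (eset I)); rewrite -/orient in sE'.
  by rewrite -sE'.
rewrite -sE'; split=> //.
have [_ ts js] := os; have ms := oriented_mem os.
have sub : {subset map fst s.2 <= enum (eset I)}.
  by move=> e /mapP[x /js[xE _] ->]; rewrite mem_enum.
have [_ eqE] := uniq_min_size (oriented_uniq os) sub (leq_trans le (eq_leq (esym (size_map _ _)))).
apply/allP => e; rewrite -eqE => /mapP[x xs ->]; have [_ jx] := js x xs.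
have xc : x.2.2 \in s.1 by rewrite ms inE (map_f tch) ?orbT.
have xp : x.2.1 \in s.1 by rewrite ms; apply: (topo_par ts xs).
rewrite /balanced; have [[-> ->]|[-> ->]] := joins_inv jx (joins_ends x.1);
by rewrite xc xp.
Qed.

Definition opar (e : E) : V := head r [seq x.2.1 | x <- orient.2 & x.1 == e].
Definition och (e : E) : V := head r [seq x.2.2 | x <- orient.2 & x.1 == e].

Lemma orient_assoc x : x \in orient.2 -> opar x.1 = x.2.1 /\ och x.1 = x.2.2.
Proof.
have [os _] := oriented_orient; have := oriented_uniq os; rewrite /opar /och.
elim: orient.2 => //= y L IH /andP[yL uL]; rewrite inE.
have [xy|ne] := eqVneq y.1 x.1; last first.
  by case/predU1P => [xE|/(IH uL)//]; rewrite xE eqxx in ne.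
case/predU1P => [->//|xL]; case/negP: yL.
by rewrite xy map_f.
Qed.

(** Connectedness makes every vertex reached, since a walk to an unreached one would cross the
    frontier. Acyclicity makes every edge oriented, since any other edge closes a cycle with a
    simple walk in the oriented ones. *)
Lemma tree_arb : valid I -> is_tree I -> arb I opar och (map fst orient.2).
Proof.
move=> vI [_ _ conn acyc]; have [os bal] := oriented_orient.
have [s1 ts js] := os; have ms := oriented_mem os; have as_ := orient_assoc.
have [rV endsV _ _] := vI.
have sub_sub : forall v, v \in vset I -> v \in orient.1.
  move=> v vV; have [s w] : exists s, walk I (eset I) r s v by exact: (conn r v rV vV).
  apply/negPn/negP => nv.
  have [|e [a [b [_ eE eab na nb]]]] := walk_crosses (D := mem orient.1) w.
    by rewrite /= (negbTE nv) ms mem_head.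
  have := allP bal e; rewrite mem_enum => /(_ eE).
  rewrite /balanced; have [[-> ->]|[-> ->]] := joins_inv eab (joins_ends e);
  by move: na nb; rewrite /= => /negbTE-> ->.
have mapc : map och (map fst orient.2) = map tch orient.2.
  by rewrite -map_comp; apply/eq_in_map => x /as_[].
have tK : topo r opar och (map fst orient.2).
  by rewrite (@topo_map _ _ _ _ tpar tch) // => x /as_[].
have jK : {in map fst orient.2, forall e, joins I e (opar e) (och e)}.
  by move=> e /mapP[x xs ->]; have [-> ->] := as_ x xs; case: (js x xs).
split=> //; last first.
  move=> v; rewrite mapc -ms; apply/idP/idP => [/sub_sub//|].
  rewrite ms inE => /predU1P[->//|/mapP[x xs ->]].
  have [xE jx] := js x xs; have [h1 h2] := endsV _ xE.
  by have [[-> _]|[-> _]] := joins_inv (joins_ends x.1) (etrans (joins_sym _ _ _ _) jx).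
move=> e; apply/idP/idP => [/mapP[x /js[xE _] ->]//|eE].
apply/negPn/negP => neK; have [uV vV] := endsV _ eE.
set K := map fst orient.2 in neK tK jK.
pose F := [set f in K].
have sKF : {subset K <= F} by move=> f; rewrite inE.
have reach v : v \in vset I -> exists s, walk I F r s v.
  move=> /sub_sub; rewrite ms -mapc; exact: topo_walk jK tK sKF v.
have [s1' w1] := reach _ uV; have [s2' w2] := reach _ vV.
have [s3 w3] := walk_rev w2.
have [s w us] := walk_simple (walk_cat w3 w1).
case: acyc; exists (ends I e).1, ((e, (ends I e).2) :: s).
have sF : {subset F <= eset I} by move=> f; rewrite inE => /mapP[x /js[xE _] ->].
rewrite /is_cycle /= eE joins_ends (walk_uniq_edges w us); move: (us) => /= -> /=.
rewrite (walk_sub _ w) ?andbT /=; last by apply/subsetP.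
by apply: contra neK => /(walk_edges w); rewrite inE.
Qed.

End Orientation.

(** * Tightness *)

Section Star.
Local Open Scope ring_scope.
Variables (R : realFieldType) (chi eps : R).
Hypotheses (eps_gt0 : 0 < eps) (eps_lt : eps < chi).

(* The expensive leaf is the denser one, so that it is served first. *)
Definition star : instance R (option bool) bool := {|
  vset := setT; eset := setT;
  ends := fun e => (None, Some e);
  cost := fun e => if e then chi else eps;
  prize := fun v => match v with
                    | None => 0 | Some true => 2 * chi / eps | Some false => 1
                    end;
  root := None |}.

Local Notation par := (fun _ : bool => None : option bool).
Local Notation ch := (Some : bool -> option bool).
Local Notation K := [:: true; false].
Local Notation P := (sprize star ch).
Local Notation C := (scost star).

Lemma chi_gt0 : 0 < chi. Proof. exact: lt_trans eps_lt. Qed.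

Lemma star_prize_gt0 : 0 < 2 * chi / eps :> R.
Proof. by rewrite divr_gt0 // mulr_gt0 // chi_gt0. Qed.

Lemma star_valid : valid star.
Proof.
split=> [|e _|e _|v _] /=; rewrite ?inE //.
  by case: e; rewrite ?chi_gt0.
by case: v => [[]|]; rewrite ?ler01 // ltW // star_prize_gt0.
Qed.

Lemma star_arb : arb star par ch K.
Proof.
split=> [e _|[]|[[]|]|] //=; rewrite ?inE //.
by rewrite /joins eqxx.
Qed.

Lemma star_mem b : b \in K.
Proof. by case: b. Qed.

Lemma star_closed (F : {set bool}) : upclosed par ch K F.
Proof. by apply/closedP; split=> [[]|e f _ /and3P[]]. Qed.

Lemma star_adm (X F : {set bool}) : adm par ch K X F = [disjoint F & X].
Proof. by rewrite /adm star_closed andbT. Qed.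

Lemma star_anc e f : anc par ch K f e -> f = e.
Proof. by case/anc_up => // -[h /and3P[]]. Qed.

Lemma star_tree : is_tree star.
Proof.
have : rooted_subtree star (setT, setT).
  apply/(rooted_subtreeP star_arb); split; first exact: star_closed.
  congr pair; apply/setP => v; rewrite !inE; case: v => [b|] //=.
  by rewrite imset_f.
by case.
Qed.

Lemma starP F : P F =
  (if true \in F then 2 * chi / eps else 0) + (if false \in F then 1 else 0).
Proof. by rewrite /sprize big_mkcond /= big_bool. Qed.

Lemma starC F : C F =
  (if true \in F then chi else 0) + (if false \in F then eps else 0).
Proof. by rewrite /scost big_mkcond /= big_bool. Qed.

Lemma star_ecc : is_ecc star chi.
Proof.
have anc1 e : [set f | anc par ch K f e] = [set e].
  apply/setP => f; rewrite !inE; apply/idP/eqP => [/star_anc//|->].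
  exact: anc_refl.
split.
  exists (Some true); first by rewrite inE.
  have := arb_dist star_arb star_valid (e := true) isT.
  by rewrite anc1 starC !inE addr0.
move=> v d _ [_ h]; case: v h => [b|] h.
  have [s /h le sE] := arb_path star_arb (e := b) (star_mem b).
  apply: le_trans le _; rewrite sE anc1 starC !inE.
  by case: b {h sE}; rewrite ?addr0 ?add0r // ltW.
by apply: le_trans (h [::] _) _; rewrite ?big_nil // ltW // chi_gt0.
Qed.

(** The origin of the prize [2 * chi / eps]: the expensive leaf gets twice the density [1 / eps] of
    the cheap one. *)
Lemma star_best_true : best star par ch K set0 [set true] (2 / eps).
Proof.
split.
- by rewrite star_adm disjoint_sym disjoints_subset sub0set.
- by apply/set0Pn; exists true; rewrite inE.
- by rewrite starP starC !inE !addr0 mulrAC.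
- by rewrite divr_gt0.
- move=> F _; rewrite starP starC.
  have := star_prize_gt0; have := chi_gt0.
  have e1 : 2 / eps * eps = 2 :> R by rewrite divfK // gt_eqF.
  have e2 : 2 / eps * chi = 2 * chi / eps by rewrite mulrAC.
  by rewrite mulrDr; case: ifP; case: ifP => _ _; rewrite ?mulr0 ?e1 ?e2; lra.
- move=> F _ sF /set0Pn[e eF] _; apply/eqP; rewrite eqEsubset sF /=.
  by have := subsetP sF e eF; rewrite inE sub1set => /eqP<-.
Qed.

Lemma star_best_false : best star par ch K [set true] [set false] (1 / eps).
Proof.
split.
- by rewrite star_adm disjoints1 inE.
- by apply/set0Pn; exists false; rewrite inE.
- by rewrite starP starC !inE !add0r divfK // gt_eqF.
- by rewrite divr_gt0.
- move=> F; rewrite star_adm => dF.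
  have tF : true \in F = false by rewrite (disjointFl dF) // inE.
  rewrite starP starC tF !add0r; case: ifP => _; last by rewrite mulr0.
  by rewrite divfK // gt_eqF.
- move=> F _ sF /set0Pn[e eF] _; apply/eqP; rewrite eqEsubset sF /=.
  by have := subsetP sF e eF; rewrite inE sub1set => /eqP<-.
Qed.

Lemma star_uncollected (pi : seq bool) :
  uncollected star pi = P (kset K :\: [set e in pi]).
Proof. by rewrite (uncollected_closed star_arb) // star_closed. Qed.

Lemma star_output : dg_output star [:: true; false].
Proof.
have r0 : dg_reach star [::] by exact: dg_start.
have nil0 : [set e in [::]] = set0 :> {set bool} by apply/setP => e; rewrite !inE.
have one : [set e in [:: true]] = [set true] by apply/setP => e; rewrite !inE.
have r1 : dg_reach star [:: true].
  apply: (dg_step_best star_arb star_valid (pi := [::]) r0 (F := [set true]) (l := 2 / eps)).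
  - by rewrite star_uncollected starP !inE /= gt_eqF // addr_gt0 ?star_prize_gt0.
  - by rewrite nil0; apply: star_best_true.
  - by rewrite inE.
  - by rewrite !inE.
split; last by rewrite star_uncollected starP !inE /= addr0.
apply: (dg_step_best star_arb star_valid (pi := [:: true]) r1 (F := [set false]) (l := 1 / eps)).
- by rewrite star_uncollected starP !inE /= add0r oner_eq0.
- by rewrite one; apply: star_best_false.
- by rewrite inE.
- by rewrite !inE.
Qed.

(** Whatever choices are made: were the cheap edge first, its min-max subtree would be that leaf
    alone, beaten by the other leaf. *)
Lemma star_first (pi : seq bool) : dg_output star pi ->
  (0 < size pi)%N /\ nth true pi 0 = true.
Proof.
move=> [rp u0]; have pos : (0 < size pi)%N.
  case: pi rp u0 => // _; rewrite star_uncollected starP !inE /=.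
  by have := star_prize_gt0; lra.
split=> //; case: (greedy_best star_arb star_valid rp true pos) => T [l [bT eT]].
have cX := star_closed [set e in take 0 pi].
case ne : (nth true pi 0) eT => // eT.
have TE : T = [set false].
  apply/eqP; rewrite eqEsubset sub1set eT andbT; apply/subsetP => f fT.
  rewrite inE eq_sym; apply/eqP.
  by apply: star_anc; apply: (best_root_anc star_arb cX bT eT _ fT); rewrite !inE.
have [_ _ TP _ Tmax _] := bT; move: TP; rewrite TE starP starC !inE !add0r => TP.
have := Tmax [set true]; rewrite star_adm take0.
have -> : [disjoint [set true] & [set e in [::]]] by rewrite disjoints1 inE.
move=> /(_ isT); rewrite starP starC !inE !addr0.
have -> : 2 * chi / eps = 2 * (l * chi).
  have -> : l = 1 / eps by rewrite TP mulfK // gt_eqF.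
  by ring.
have l0 : 0 < l by case: bT.
have := mulr_gt0 l0 chi_gt0; lra.
Qed.

Lemma star_not_competitive (alpha mu : R) (pi : seq bool) :
  0 <= alpha -> eps + alpha < chi -> dg_output star pi ->
  is_opt star eps (tree_of star ch [set false]) /\
  mu * total_prize star (alg star pi (eps + alpha)) <
    total_prize star (tree_of star ch [set false]).
Proof.
move=> a0 lt out; have [pos first] := star_first out; have [rp _] := out.
have sK (F : {set bool}) : {subset F <= K} by case.
split.
  split.
  - by apply/(rooted_subtreeP star_arb); rewrite star_closed.
  - by rewrite /total_cost -/(scost star _) starC !inE add0r.
  - move=> T /(rooted_subtreeP star_arb)[_ ->].
    rewrite /total_cost -/(scost star _) !(sum_tree star_arb) // !starP starC !inE /=.
    have := chi_gt0; have := eps_gt0; have := eps_lt.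
    by case: ifP; case: ifP; lra.
have [t tn [-> Ct _]] := alg_take star_arb star_valid (eps + alpha) rp.
(* The first edge alone costs [chi], more than the budget. The collected prize is then 0, which no
   factor [mu] can repair. *)
have t0 : t = 0%N.
  case: t tn Ct => // t tn /(_ isT); rewrite starC.
  have -> : true \in [set e in take t.+1 pi].
    by rewrite inE -{1}first; case: (pi) pos => //= b s _; rewrite mem_head.
  by have := eps_gt0; case: ifP => _ e0 h; exfalso; move: e0 h; lra.
rewrite t0 take0 (formed_by_closed star_arb) ?star_closed //.
rewrite !(sum_tree star_arb) // !starP !inE /= !addr0 mulr0.
by lra.
Qed.

End Star.

(** * Leaf elimination *)

Section Elimination.
Local Open Scope ring_scope.
Variables (R : realFieldType) (V E : eqType) (r : V) (par ch : E -> V).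
Variable K : seq E.
Implicit Types (o : E -> V) (w : E -> R) (l : seq E).

(* [o e] is the vertex into which the child end of [e] has been merged so far.
   The leaf [ch e] is merged into its parent when its total weight is positive,
   and it is discarded otherwise. *)
Definition load w o (v : V) : R := \sum_(f <- K | o f == v) w f.

Definition absorb w o (e : E) : E -> V :=
  if 0 < load w o (ch e) then fun f => if o f == ch e then par e else o f else o.

Definition elim w o l := foldl (absorb w) o l.

Lemma absorb_load w o e y : par e != ch e -> y != ch e ->
  load w (absorb w o e) y =
  load w o y + (if (y == par e) && (0 < load w o (ch e)) then load w o (ch e) else 0).
Proof.
move=> pe ye; rewrite /absorb; case: ifP => _; last by rewrite andbF addr0.
rewrite andbT /load (bigID (fun f => o f == ch e)) /= addrC; congr (_ + _).
  apply: eq_bigl => f; case: (eqVneq (o f) (ch e)) => [->|_]; last by rewrite andbT.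
  by rewrite andbF eq_sym (negbTE ye).
case: ifP => [/eqP->|yp].
  by apply: eq_bigl => f; case: (eqVneq (o f) (ch e)) => [_|]; rewrite ?andbF // eqxx.
rewrite big_pred0 // => f; case: (eqVneq (o f) (ch e)) => [_|]; rewrite ?andbF //.
by rewrite eq_sym yp.
Qed.

Lemma topo_cons_neq e l : topo r par ch (e :: l) -> par e != ch e.
Proof. by move=> /= /and3P[pe /memPn ne _]; apply: ne. Qed.

(** The leaf [ch e] can be removed from [F] without loss. A positive load moves to [par e]: it stays
    counted if [F] contained the leaf, as [F] then contains [par e], and otherwise the sum can only
    grow. Dropping a load that is not positive does no harm. At the end only the root is left. *)
Lemma elim_max w l o (F : pred V) : topo r par ch l -> F r ->
  {in l, forall e, F (ch e) -> F (par e)} ->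
  (forall v, F v -> v \in r :: map ch l) ->
  \sum_(f <- K | F (o f)) w f <= load w (elim w o l) r.
Proof.
elim: l o F => [|e l IH] o F tl Fr Fup Fsub /=.
  rewrite le_eqVlt; apply/orP; left; apply/eqP; apply: eq_bigl => f.
  by apply/idP/eqP => [/Fsub|->//]; rewrite /= mem_seq1 => /eqP.
have pce := topo_cons_neq tl; have /= /and3P[pe ne tl'] := tl.
pose F' v := F v && (v != ch e).
have rne : r != ch e by apply: (memPn ne); apply: mem_head.
apply: (@le_trans _ _ (\sum_(f <- K | F' (absorb w o e f)) w f)); last first.
  apply: IH => //.
  - by rewrite /F' Fr.
  - move=> f fl /andP[Ff _]; apply/andP; split; first by apply: Fup; rewrite // inE fl orbT.
    by apply: (memPn ne); apply: topo_par tl' fl.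
  - by move=> v /andP[/Fsub]; rewrite /= !inE => /or3P[->//|->//|->]; rewrite orbT.
have FE : \sum_(f <- K | F (o f)) w f =
    (if F (ch e) then load w o (ch e) else 0) + \sum_(f <- K | F' (o f)) w f.
  rewrite (bigID (fun f => o f == ch e)) /=; congr (_ + _).
  case: ifP => Fe; last first.
    by rewrite big_pred0 // => f; case: eqVneq => [->|]; rewrite ?Fe ?andbF.
  by apply: eq_bigl => f; case: eqVneq => [->|]; rewrite ?Fe ?andbF.
rewrite FE /absorb; have [S0|S0] := ltP 0 (load w o (ch e)); last first.
  by rewrite gerDr; case: ifP.
rewrite [leRHS](bigID (fun f => o f == ch e)) /= lerD //; last first.
  rewrite le_eqVlt; apply/orP; left; apply/eqP; apply: eq_bigl => f; rewrite /F'.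
  by case: eqVneq => [_|/negbTE nf] /=; rewrite ?nf ?andbF ?andbT.
have -> : \sum_(f <- K | F' (if o f == ch e then par e else o f) && (o f == ch e)) w f
    = if F (par e) then load w o (ch e) else 0.
  case: ifP => Fp; last first.
    by rewrite big_pred0 // => f; rewrite /F'; case: eqVneq => _ /=; rewrite ?Fp ?andbF.
  by apply: eq_bigl => f; rewrite /F'; case: eqVneq => _ /=; rewrite ?Fp ?pce ?andbF.
case: ifP => [/(Fup e (mem_head _ _))->//|_]; case: ifP => // _; exact: ltW.
Qed.

(** Only positive loads are merged, so the root carries a positive weight as soon as anything has
    reached it. This makes a nonempty [zone] a strict improvement. *)
Definition settled w o : bool :=
  (0 < load w o r) || ~~ has (fun f => o f == r) K.

Lemma settled_ge0 w o : settled w o -> 0 <= load w o r.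
Proof.
case/orP => [/ltW//|/hasPn none].
by rewrite /load big_seq_cond big_pred0 // => f; apply/negbTE/negP => /andP[/none/negP].
Qed.

Lemma elim_settled w l o : topo r par ch l ->
  settled w o -> settled w (elim w o l).
Proof.
elim: l o => //= e l IH o tl so; have pce := topo_cons_neq tl.
move: tl => /and3P[_ ne tl]; apply: IH => //.
have rne : r != ch e by apply: (memPn ne); apply: mem_head.
have [S0|S0] := boolP (0 < load w o (ch e)); last by rewrite /absorb (negbTE S0).
rewrite /settled absorb_load // S0 andbT.
have [rp|rp] := eqVneq r (par e).
  by rewrite ltr_wpDl // settled_ge0.
rewrite addr0; move: so; rewrite /settled.
suff -> : has (fun f => absorb w o e f == r) K = has (fun f => o f == r) K by [].
apply: eq_has => f; rewrite /absorb S0; case: (eqVneq (o f) (ch e)) => [->|//].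
by rewrite eq_sym (negbTE rp) eq_sym (negbTE rne).
Qed.

Hypothesis chI : {in K &, injective ch}.

(** An edge that has left its child end has joined its parent edge and moves with it; if it ends at
    the root, so does its parent edge. *)
Definition linked o l : Prop :=
  {in l, forall g, o g = ch g} /\
  (forall e f, e \in K -> f \in K -> ch f = par e -> o e = ch e \/ o e = o f).

Lemma elim_linked w l o : {subset l <= K} -> topo r par ch l ->
  (forall e f, e \in l -> f \in K -> ch f = par e -> f \in l) ->
  linked o l -> linked (elim w o l) [::].
Proof.
elim: l o => [|e l IH] o sl tl cl lo //=.
have pce := topo_cons_neq tl; move: tl => /= /and3P[pe ne tl].
have sl' : {subset l <= K} by move=> f fl; apply: sl; rewrite inE fl orbT.
have chl g : g \in l -> ch g != ch e.
  by move=> gl; apply: (memPn ne); rewrite inE map_f ?orbT.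
have cl' f g : f \in l -> g \in K -> ch g = par f -> g \in l.
  move=> fl gK gf; have := cl f g; rewrite !inE fl orbT => /(_ isT gK gf)/predU1P[ge|//].
  have : par f != ch e by apply: (memPn ne); apply: topo_par tl fl.
  by rewrite -gf ge eqxx.
apply: IH => //; have [ol lk] := lo.
rewrite /absorb; case: ifP => _; last first.
  by split=> // g gl; apply: ol; rewrite inE gl orbT.
split=> [g gl|g f gK fK fg].
  have og := ol g; rewrite inE gl orbT in og.
  by rewrite og // (negbTE (chl g gl)).
have [->|->] := lk g f gK fK fg; last by right.
case: (eqVneq (ch g)) => [ge|_]; last by left.
right; have {}ge := chI gK (sl e (mem_head _ _)) ge.
have fl : f \in e :: l by apply: cl fg => //; rewrite ge mem_head.
by rewrite ol // fg ge (negbTE pce).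
Qed.

Definition dominated w w' o o' y : Prop :=
  {in K, forall f, o' f = y -> o f = y} /\ load w' o' y <= load w o y.

(** A larger weight can only cause more merges, and each merge adds a positive load, so the
    comparison is preserved at every vertex not yet eliminated. *)
Lemma elim_mono w w' l o o' : topo r par ch l ->
  (forall y, y \in r :: map ch l -> dominated w w' o o' y) ->
  dominated w w' (elim w o l) (elim w' o' l) r.
Proof.
elim: l o o' => [|e l IH] o o' tl dom /=; first by apply: dom; apply: mem_head.
have pce := topo_cons_neq tl; move: tl => /= /and3P[pe ne tl].
have [sube domv] : dominated w w' o o' (ch e) by apply: dom; rewrite !inE eqxx orbT.
apply: IH => // y yl.
have ye : y != ch e by apply: (memPn ne).
have [sub le] : dominated w w' o o' y.
  by apply: dom; move: yl; rewrite !inE => /orP[->//|->]; rewrite !orbT.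
split; last first.
  rewrite !absorb_load // lerD //; case: (eqVneq y (par e)) => //= _.
  have [S'|S'] := ltP 0 (load w' o' (ch e)); first by rewrite (lt_le_trans S').
  by case: ifP => [/ltW|].
move=> f fK; rewrite /absorb.
have [S'|S'] := ltP 0 (load w' o' (ch e)).
  rewrite (lt_le_trans S') //; case: (eqVneq (o' f)) => [/(sube f fK)->|_].
    by rewrite eqxx.
  by move=> /(sub f fK) oy; rewrite oy (negbTE ye).
move=> /(sub f fK) oy; case: ifP => // _.
by rewrite oy (negbTE ye).
Qed.

End Elimination.

(** * Closed edge sets of maximum weight *)

Section MaxWeight.
Local Open Scope ring_scope.
Variables (R : realFieldType) (V E : finType) (r : V) (par ch : E -> V).
Variable K : seq E.
Hypothesis tK : topo r par ch K.
Implicit Types (w : E -> R) (F : {set E}).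

Definition zone w : {set E} := [set e in K | elim par ch K w ch K e == r].

Lemma topo_ch_inj : {in K &, injective ch}.
Proof. by have /andP[/uniq_map_inj] := topo_uniq tK. Qed.

Lemma topo_ch_root e : e \in K -> ch e != r.
Proof. by move=> eK; have /andP[_ /memPn] := topo_uniq tK; apply; apply: map_f. Qed.

Lemma sum_in_K (p : pred E) w :
  \sum_(f <- K | p f) w f = \sum_(f in [set e in K | p e]) w f.
Proof.
have uK : uniq K by have /andP[/map_uniq] := topo_uniq tK.
rewrite big_mkcond (big_uniq _ uK) -big_mkcondr /=.
by apply: eq_bigl => f; rewrite inE.
Qed.

Lemma load_zone w : load K w (elim par ch K w ch K) r = \sum_(f in zone w) w f.
Proof. exact: sum_in_K. Qed.

Lemma zone_sub w : {subset zone w <= K}.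
Proof. by move=> e; rewrite inE => /andP[]. Qed.

Lemma zone_max w F : upclosed par ch K F ->
  \sum_(f in F) w f <= \sum_(f in zone w) w f.
Proof.
move=> cF; have sF := closed_sub cF.
rewrite -load_zone; pose Q v := (v == r) || (v \in ch @: F).
have chQ e : e \in K -> Q (ch e) = (e \in F).
  move=> eK; rewrite /Q (negbTE (topo_ch_root eK)) /=.
  apply/imsetP/idP => [[f fF ef]|eF]; last by exists e.
  by rewrite (topo_ch_inj eK (sF f fF) ef).
have -> : \sum_(f in F) w f = \sum_(f <- K | Q (ch f)) w f.
  rewrite sum_in_K; apply: eq_bigl => f; rewrite inE.
  have [fK|nK] := boolP (f \in K); first by rewrite chQ.
  by apply/negbTE; apply: contra nK => /sF.
apply: elim_max => //.
- by rewrite /Q eqxx.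
- move=> e eK; rewrite chQ // => eF; rewrite /Q.
  have := topo_par tK eK; rewrite inE => /predU1P[->|/mapP[f fK fe]].
    by rewrite eqxx.
  rewrite fe imset_f ?orbT //; apply: closed_up cF eF _.
  by rewrite /parent_edge /= eK fK fe /=.
- move=> v; rewrite inE => /predU1P[->|/imsetP[f /sF fK ->]]; first by rewrite eqxx.
  by rewrite map_f ?orbT.
Qed.

Lemma zone_pos w : zone w != set0 -> 0 < \sum_(f in zone w) w f.
Proof.
move=> z0; rewrite -load_zone.
have s0 : settled r K w ch.
  apply/orP; right; apply/hasPn => e eK; exact: topo_ch_root.
have /orP[//|/hasPn none] := elim_settled tK s0.
have /set0Pn[e] := z0; rewrite inE => /andP[eK er].
by have := none e eK; rewrite er.
Qed.

Lemma zone_closed w : upclosed par ch K (zone w).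
Proof.
have l0 : linked par ch K ch K by split=> // *; left.
have [|_ lk] := elim_linked topo_ch_inj w (fun e h => h) tK _ l0; first by [].
apply/closedP; split=> [e|e f]; first exact: zone_sub.
rewrite inE => /andP[eK /eqP er] /and3P[_ fK /eqP fe]; rewrite inE fK.
have [eE|<-] := lk e f eK fK fe; last by rewrite er eqxx.
by have := topo_ch_root eK; rewrite -eE er eqxx.
Qed.

Lemma zone_mono w w' : {in K, forall e, w' e <= w e} -> zone w' \subset zone w.
Proof.
move=> le; apply/subsetP => e; rewrite !inE => /andP[eK /eqP er]; rewrite eK /=.
have [|sub _] := @elim_mono _ _ _ r par ch K w w' K ch ch tK.
  move=> y _; split=> //; rewrite /load big_seq_cond [leRHS]big_seq_cond.
  by apply: ler_sum => f /andP[fK _]; apply: le.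
by rewrite sub.
Qed.

Lemma zone_root w : zone w != set0 -> exists2 e, e \in zone w & par e = r.
Proof.
move=> /set0Pn[e ez]; have cz := zone_closed w.
(* The edge of the zone closest to the end of the list: its parent edge would be in the zone and
   come later. *)
have [e' e'z max] := arg_maxnP (fun f => index (ch f) (map ch K)) ez.
exists e' => //; have e'K := zone_sub e'z.
have := topo_par tK e'K; rewrite inE => /predU1P[//|/mapP[f fK fe]].
have fz : f \in zone w.
  by apply: closed_up cz e'z _; rewrite /parent_edge /= e'K fK fe /=.
have := topo_index tK e'K; rewrite fe ltnNge => /negP[].
by have := max f fz.
Qed.

End MaxWeight.

(** * Dinkelbach's iteration *)

Section Dinkelbach.
Local Open Scope ring_scope.
Variables (R : realFieldType) (V E : finType) (r : V) (par ch : E -> V).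
Variables (K : seq E) (p c : E -> R).
Hypotheses (tK : topo r par ch K) (c_gt0 : {in K, forall e, 0 < c e}).
Implicit Types (F : {set E}) (a : R).

Definition dzone a : {set E} := zone r par ch K (fun e => p e - a * c e).

Lemma sum_weight a F :
  \sum_(f in F) (p f - a * c f) = \sum_(f in F) p f - a * \sum_(f in F) c f.
Proof. by rewrite sumrB mulr_sumr. Qed.

Lemma sum_cost_gt0 F : {subset F <= K} -> F != set0 -> 0 < \sum_(f in F) c f.
Proof.
move=> sF /set0Pn[e eF]; rewrite (big_setD1 e) //=.
apply: ltr_pwDl; first exact/c_gt0/sF.
by apply: sumr_ge0 => f; rewrite inE => /andP[_ /sF/c_gt0/ltW].
Qed.

Lemma dzone_max a F : dzone a = set0 -> upclosed par ch K F ->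
  \sum_(f in F) p f <= a * \sum_(f in F) c f.
Proof.
move=> z0 /(zone_max tK (fun e => p e - a * c e)); rewrite -/(dzone a) z0.
by rewrite big_set0 sum_weight subr_le0.
Qed.

(** A nonempty maximizer has positive weight for [a], so its density [b] exceeds [a]. It has weight
    0 for [b], so it is not the maximizer for [b], which lies inside it by monotonicity. *)
Lemma dzone_improves a b : dzone a != set0 ->
  \sum_(f in dzone a) p f = b * \sum_(f in dzone a) c f ->
  a < b /\ dzone b \proper dzone a.
Proof.
move=> z0 zE; have pos := zone_pos tK z0; rewrite -/(dzone a) in pos.
have C0 : 0 < \sum_(f in dzone a) c f by apply: sum_cost_gt0 => //; apply: zone_sub.
have ab : a < b.
  by move: pos; rewrite sum_weight zE -mulrBl pmulr_lgt0 // subr_gt0.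
split=> //; rewrite properEneq andbC (zone_mono tK) /=; last first.
  by move=> e eK; rewrite lerD2l lerN2 ler_pM2r ?c_gt0 // ltW.
apply/eqP => zz; have := zone_pos tK (w := fun e => p e - b * c e).
by rewrite -/(dzone b) zz => /(_ z0); rewrite sum_weight zE subrr ltxx.
Qed.

End Dinkelbach.

(** * The program *)

Lemma ptime_sz {A B : Type} {EA : Enc A} {EB : Enc B} (f : A -> B) :
  ptime f -> pb sz (fun x => sz (f x)).
Proof. by case. Qed.

Ltac pbt := repeat first
  [ apply: pb_const | apply: pb_succ | apply: pb_add | apply: pb_mul
  | apply: pb_self | by apply: ptime_sz; pt ].

Lemma ptime_program {A B : Type} {EA : Enc A} {EB : Enc B} (f : A -> B) :
  ptime f -> exists (P : program) (a k : nat), forall x : A, exists2 t,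
    computes P (enc x) (enc (f x)) t & (t <= a * dsize (enc x) ^ k + a)%N.
Proof.
case=> _ [P [e [T [[k hk] rf]]]].
(* The main expression becomes function 0. A size [n] is at least 1, so [n + 2 <= 3 * n]; two more
   steps pay for the call. *)
exists (shift 1 e :: map (shift 1) P), (3 ^ k + 2)%N, k => x.
have [t tT ev] := rf x; exists (1 + t).+1.
  apply: (@eval_call _ _ _ _ (enc x)) => //.
    exact: (@eval_var _ [:: enc x] 0).
  by apply: (@eval_shift P [:: shift 1 e]).
have le : (T x <= 3 ^ k * dsize (enc x) ^ k)%N.
  apply: leq_trans (hk x) _; rewrite -expnMn; case: (k) => // m.
  have : (0 < sz x)%N by apply: sz_gt0.
  by rewrite leq_exp2r // /sz; lia.
have : (0 < 3 ^ k)%N by rewrite expn_gt0.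
by rewrite mulnDl; move: tT le; lia.
Qed.

Section Sizes.
Local Open Scope nat_scope.
Context {A B : Type} {EA : Enc A} {EB : Enc B}.

Lemma sz_seq_all M (l : seq A) :
  all (fun a => sz a <= M) l -> sz l <= size l * M.+1 + 1.
Proof.
elim: l => // a l IH /= /andP[le /IH]; rewrite sz_cons mulSn.
by move: le; lia.
Qed.

Lemma all_sz (l : seq A) : all (fun a => sz a <= sz l) l.
Proof.
elim: l => // a l IH /=; rewrite sz_cons; apply/andP; split; first lia.
by apply: sub_all IH => b; lia.
Qed.

Lemma sz_map_le (f : A -> B) (l : seq A) :
  (forall a, sz (f a) <= sz a) -> sz (map f l) <= sz l.
Proof.
by move=> h; elim: l => // a l IH /=; rewrite !sz_cons; have := h a; lia.
Qed.

Lemma sz_filter (p : pred A) (l : seq A) : sz (filter p l) <= sz l.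
Proof. by elim: l => // a l IH /=; case: (p a); rewrite !sz_cons; lia. Qed.

Lemma sz_snd_le (x : A * B) : sz x.2 <= sz x.
Proof. by rewrite (sz_pair x); lia. Qed.

Lemma sz_foldl_add (step : B -> A -> B) (s : B) (l : seq A) m g :
  (forall s a, sz a <= m -> sz (step s a) <= sz s + g) -> sz l <= m ->
  sz (foldl step s l) <= sz s + sz l * g.
Proof.
move=> h; elim: l s => [|a l IH] s /=; first by rewrite leq_addr.
rewrite sz_cons => le; have := h s a; have := IH (step s a).
by rewrite mulSn mulnDl; lia.
Qed.

End Sizes.

Lemma sz_fsum (l : seq qfrac) : (sz (fsum l) <= 8 * (sz l).+1 + 3)%N.
Proof.
by apply: sz_frac; apply: leq_trans (height_foldl _ _) _; rewrite expnS.
Qed.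

(* An edge: parent end, child end, name, prize of the child end, cost. *)
Local Notation item := (nat * (nat * (nat * (qfrac * qfrac))))%type.
Local Notation ichild x := (x.2.1) (only parsing).
Local Notation iname x := (x.2.2.1) (only parsing).
Local Notation iprize x := (x.2.2.2.1) (only parsing).
Local Notation icost x := (x.2.2.2.2) (only parsing).
Local Notation entry := (nat * item)%type.
Local Notation qratio := (qfrac * qfrac)%type.

Definition fmul (p q : qfrac) : qfrac := ((p.1 * q.1)%N, (p.2 * q.2)%N).
Definition flt (p q : qfrac) : bool := (p.1 * q.2 < q.1 * p.2)%N.

Definition psum (T : seq entry) (v : nat) : qfrac :=
  fsum [seq iprize t.2 | t <- T & t.1 == v].
Definition csum (T : seq entry) (v : nat) : qfrac :=
  fsum [seq icost t.2 | t <- T & t.1 == v].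

(** An entry is an item with the vertex into which it has been merged. The test compares the load
    with 0 for the ratio of [a.1] to [a.2], cross-multiplied so that neither negative numbers nor
    divisions occur. *)
Definition nabsorb (a : qratio) (T : seq entry) (x : item) : seq entry :=
  if flt (fmul a.1 (csum T (ichild x))) (fmul (psum T (ichild x)) a.2) then
    [seq (if t.1 == ichild x then (x.1, t.2) else t) | t <- T]
  else T.

Definition nelim (a : qratio) (L : seq item) : seq entry :=
  foldl (nabsorb a) [seq (ichild x, x) | x <- L] L.

Definition nzone (r : nat) (a : qratio) (L : seq item) : seq item :=
  [seq t.2 | t <- nelim a L & t.1 == r].

Definition nimprove (r : nat) (L : seq item) (s : qratio * seq item) :=
  if nilp (nzone r s.1 L) then s else
  ((fsum [seq iprize x | x <- nzone r s.1 L],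
    fsum [seq icost x | x <- nzone r s.1 L]),
   [seq x <- nzone r s.1 L | x.1 == r]).

(** The list is only a counter and the initial ratio is 0. The second component lists the root edges
    of a subtree of maximum density; it is empty when no prize is left. *)
Definition ndense (r : nat) (L : seq item) : qratio * seq item :=
  foldl (fun s _ => nimprove r L s) (((0%N, 1%N), (1%N, 1%N)), [::]) L.

Definition item0 : item := (0%N, (0%N, (0%N, ((0%N, 0%N), (0%N, 0%N))))).

Definition ncontract (r : nat) (x : item) (L : seq item) : seq item :=
  [seq (if y.1 == ichild x then (r, y.2) else y) | y <- L & iname y != iname x].

Definition nstep (r : nat) (s : seq item * seq nat) : seq item * seq nat :=
  if nilp (ndense r s.1).2 then s else
  (ncontract r (head item0 (ndense r s.1).2) s.1,
   iname (head item0 (ndense r s.1).2) :: s.2).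

Definition ngreedy (r : nat) (L : seq item) : seq nat :=
  rev (foldl (fun s _ => nstep r s) (L, [::]) L).2.

Definition nlook (vs : seq (nat * qfrac)) (v : nat) : qfrac :=
  foldl (fun q x => if x.1 == v then x.2 else q) (0%N, 1%N) vs.

Local Notation nedge := (nat * ((nat * nat) * qfrac))%type.

Definition nostep (vs : seq (nat * qfrac)) (s : seq nat * seq item) (e : nedge) :=
  if has (fun z => z == e.2.1.1) s.1 && ~~ has (fun z => z == e.2.1.2) s.1 then
    (e.2.1.2 :: s.1,
     (e.2.1.1, (e.2.1.2, (e.1, (nlook vs e.2.1.2, e.2.2)))) :: s.2)
  else if has (fun z => z == e.2.1.2) s.1 && ~~ has (fun z => z == e.2.1.1) s.1
  then (e.2.1.1 :: s.1,
        (e.2.1.2, (e.2.1.1, (e.1, (nlook vs e.2.1.1, e.2.2)))) :: s.2)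
  else s.

Definition norient (r : nat) (vs : seq (nat * qfrac)) (es : seq nedge) :=
  foldl (fun s _ => foldl (nostep vs) s es) ([:: r], [::]) es.

Definition nmain (x : nat * (seq (nat * qfrac) * seq nedge)) : seq nat :=
  ngreedy x.1 (norient x.1 x.2.1 x.2.2).2.

Section ProgramTime.
Local Open Scope nat_scope.

Lemma ptime_psum : ptime (fun z : seq entry * nat => psum z.1 z.2).
Proof.
apply: ptime_fsum; apply: (ptime_map (f := fun _ t => iprize t.2)); first by pt.
by apply: (ptime_filter (p := fun z t => t.1 == z.2)); pt.
Qed.

Lemma ptime_csum : ptime (fun z : seq entry * nat => csum z.1 z.2).
Proof.
apply: ptime_fsum; apply: (ptime_map (f := fun _ t => icost t.2)); first by pt.
by apply: (ptime_filter (p := fun z t => t.1 == z.2)); pt.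
Qed.

Lemma ptime_nabsorb :
  ptime (fun z : qratio * (seq entry * item) => nabsorb z.1 z.2.1 z.2.2).
Proof.
have ps : ptime (fun z : qratio * (seq entry * item) => psum z.2.1 (ichild z.2.2)).
  by apply: (ptime_comp ptime_psum (f := fun z => (z.2.1, ichild z.2.2))); pt.
have cs : ptime (fun z : qratio * (seq entry * item) => csum z.2.1 (ichild z.2.2)).
  by apply: (ptime_comp ptime_csum (f := fun z => (z.2.1, ichild z.2.2))); pt.
apply: ptime_ite; rewrite /flt /fmul /=; [by pt| |by pt].
apply: (ptime_map (f := fun z t =>
  if t.1 == ichild z.2.2 then (z.2.2.1, t.2) else t)); by pt.
Qed.

(** Entries move but keep their items, which bounds the table along the loop. *)
Lemma nabsorb_snd a T x : map snd (nabsorb a T x) = map snd T.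
Proof.
rewrite /nabsorb; case: ifP => // _; rewrite -map_comp.
by apply: eq_map => t /=; case: ifP.
Qed.

Definition pair_le {A B : Type} {EA : Enc A} {EB : Enc B} M (t : A * B) :=
  (sz t.1 <= M) && (sz t.2 <= M).

Lemma nabsorb_le M a T x : all (pair_le M) T -> sz x.1 <= M ->
  all (pair_le M) (nabsorb a T x).
Proof.
move=> aT xM; rewrite /nabsorb; case: ifP => // _; rewrite all_map.
by apply: sub_all aT => t /andP[h1 h2] /=; case: ifP; rewrite /pair_le ?xM ?h1 ?h2.
Qed.

Lemma nelim_snd a (l L : seq item) :
  map snd (foldl (nabsorb a) [seq (ichild x, x) | x <- L] l) = L.
Proof.
elim/last_ind: l => [|l x IH]; last by rewrite foldl_rcons nabsorb_snd.
by rewrite -map_comp map_id.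
Qed.

(** One round may rewrite every entry, so the table is bounded entry by entry: the vertex number of
    an entry always comes from the input list. *)
Lemma ptime_nelim : ptime (fun z : qratio * seq item => nelim z.1 z.2).
Proof.
apply: (ptime_foldl (step := fun z T x => nabsorb z.1 T x)).
- by apply: (ptime_comp ptime_nabsorb (f := fun y => (y.1.1, (y.2.2, y.2.1)))); pt.
- by pt.
- by apply: (ptime_map (f := fun _ x => (ichild x, x))); pt.
exists (fun z => sz z.2 * (sz z.2 + sz z.2).+2 + 1); first by pbt.
move=> [a L] l1 l2 /= e; set T := foldl _ _ _.
have sT : size T = size L by rewrite -(size_map snd) nelim_snd.
apply: leq_trans (sz_seq_all (M := (sz L + sz L).+1) _) _; last first.
  by rewrite sT leq_add2r leq_mul2r size_le_sz orbT.
have : all (pair_le (sz L)) T.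
  have : all (fun x => sz x <= sz L) l1.
    have : all (fun x => sz x <= sz L) (l1 ++ l2) by rewrite -e; apply: all_sz.
    by rewrite all_cat => /andP[].
  rewrite /T; elim/last_ind: (l1) => [|l x IH].
    move=> _; rewrite all_map; apply: sub_all (all_sz L) => x /= le.
    by rewrite /pair_le /= le andbT; move: le; rewrite !sz_pair; lia.
  rewrite all_rcons foldl_rcons => /andP[le /IH h]; apply: nabsorb_le h _.
  by move: le; rewrite sz_pair; lia.
by apply: sub_all => t /andP[h1 h2]; rewrite sz_pair; lia.
Qed.

Lemma ptime_nzone :
  ptime (fun z : nat * (qratio * seq item) => nzone z.1 z.2.1 z.2.2).
Proof.
apply: (ptime_map (f := fun _ t => t.2)); first by pt.
apply: (ptime_filter (p := fun z t => t.1 == z.1)); first by pt.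
by apply: (ptime_comp ptime_nelim (f := snd)); pt.
Qed.

Lemma sz_nzone r a L : sz (nzone r a L) <= sz L.
Proof.
rewrite -{2}(nelim_snd a L L) /nzone -/(nelim a L).
by elim: (nelim a L) => //= t T IH; case: ifP; rewrite /= !sz_cons; lia.
Qed.

Lemma all_nzone (Q : pred item) r a L : all Q L -> all Q (nzone r a L).
Proof.
rewrite -{1}(nelim_snd a L L) /nzone -/(nelim a L).
by elim: (nelim a L) => //= t T IH /andP[Qt /IH]; case: ifP => //= _ ->; rewrite Qt.
Qed.

Lemma ptime_nimprove :
  ptime (fun z : (nat * seq item) * (qratio * seq item) =>
           nimprove z.1.1 z.1.2 z.2).
Proof.
have pz : ptime (fun z : (nat * seq item) * (qratio * seq item) =>
    nzone z.1.1 z.2.1 z.1.2).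
  by apply: (ptime_comp ptime_nzone (f := fun z => (z.1.1, (z.2.1, z.1.2)))); pt.
apply: ptime_ite; [by pt|by pt|].
apply: ptime_pair; first apply: ptime_pair.
- by apply: ptime_fsum; apply: (ptime_map (f := fun _ x => iprize x)); pt.
- by apply: ptime_fsum; apply: (ptime_map (f := fun _ x => icost x)); pt.
- by apply: (ptime_filter (p := fun z x => x.1 == z.1.1)); pt.
Qed.

(** The new ratio consists of two sums over input items, each bounded by [sz_fsum], and does not
    involve the old ratio; sizes do not compound. *)
Lemma sz_nimprove r L s : sz (nimprove r L s) <= sz s + 20 * sz L + 40.
Proof.
rewrite /nimprove; case: ifP => _; first by lia.
have z := sz_nzone r s.1 L; set Z := nzone _ _ _ in z *.
have h1 : sz [seq iprize x | x <- Z] <= sz Z.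
  by apply: sz_map_le => x; rewrite !sz_pair; lia.
have h2 : sz [seq icost x | x <- Z] <= sz Z.
  by apply: sz_map_le => x; rewrite !sz_pair; lia.
have h3 : sz [seq x <- Z | x.1 == r] <= sz Z by apply: sz_filter.
have f1 : sz (fsum [seq iprize x | x <- Z]) <= 8 * (sz Z).+1 + 3.
  by apply: leq_trans (sz_fsum _) _; rewrite leq_add2r leq_mul2l ltnS.
have f2 : sz (fsum [seq icost x | x <- Z]) <= 8 * (sz Z).+1 + 3.
  by apply: leq_trans (sz_fsum _) _; rewrite leq_add2r leq_mul2l ltnS.
pose (b := 8 * (sz Z).+1 + 3).
apply: (@leq_trans ((b + b).+1 + sz Z).+1); last by rewrite /b; lia.
by rewrite sz_pair ltnS leq_add // sz_pair ltnS leq_add.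
Qed.

Lemma ptime_ndense : ptime (fun z : nat * seq item => ndense z.1 z.2).
Proof.
apply: (ptime_foldl_add (step := fun z s _ => nimprove z.1 z.2 s)
  (g := fun z => 20 * sz z.2 + 40)).
- by apply: (ptime_comp ptime_nimprove (f := fun y => (y.1, y.2.2))); pt.
- by pt.
- by pt.
- by pbt.
- by move=> z s a _; rewrite addnA; apply: sz_nimprove.
Qed.

Lemma all_ndense (Q : pred item) r L : all Q L -> all Q (ndense r L).2.
Proof.
move=> aL; suff gen (l : seq item) s : all Q s.2 ->
    all Q (foldl (fun s (_ : item) => nimprove r L s) s l).2 by apply: gen.
elim: l s => //= x l IH s as_; apply: IH.
rewrite /nimprove; case: ifP => //= _.
by have := all_nzone r s.1 aL; elim: (nzone _ _ _) => //= y l' IH' /andP[Qy /IH' h];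
   case: ifP => //= _; rewrite Qy.
Qed.

Lemma ptime_ncontract :
  ptime (fun z : (nat * item) * seq item => ncontract z.1.1 z.1.2 z.2).
Proof.
apply: (ptime_map (f := fun z y => if y.1 == ichild z.1.2 then (z.1.1, y.2) else y)).
  by apply: ptime_ite; pt.
by apply: (ptime_filter (p := fun z y => iname y != iname z.1.2)); pt.
Qed.

Lemma ptime_nstep : ptime (fun z : nat * (seq item * seq nat) => nstep z.1 z.2).
Proof.
have pd : ptime (fun z : nat * (seq item * seq nat) => ndense z.1 z.2.1).
  by apply: (ptime_comp ptime_ndense (f := fun z => (z.1, z.2.1))); pt.
have ph : ptime (fun z : nat * (seq item * seq nat) =>
    head item0 (ndense z.1 z.2.1).2).
  by apply: (ptime_comp (ptime_head item0) (f := fun z => (ndense z.1 z.2.1).2)); pt.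
apply: ptime_ite; [by pt|by pt|].
apply: ptime_pair; last by pt.
apply: (ptime_comp ptime_ncontract
  (f := fun z => ((z.1, head item0 (ndense z.1 z.2.1).2), z.2.1))).
by pt.
Qed.

Lemma ptime_ngreedy : ptime (fun z : nat * seq item => ngreedy z.1 z.2).
Proof.
apply: ptime_rev; apply: (ptime_comp ptime_snd (f := fun z : nat * seq item =>
  foldl (fun s _ => nstep z.1 s) (z.2, [::]) z.2)).
apply: (ptime_foldl (step := fun z s _ => nstep z.1 s)).
- by apply: (ptime_comp ptime_nstep (f := fun y => (y.1.1, y.2.2))); pt.
- by pt.
- by pt.
exists (fun z => (sz z.2 * (sz z.1 + sz z.2 + (sz z.1 + sz z.2)).+2 + 1 +
                  (sz z.2 * (sz z.1 + sz z.2).+1 + 1)).+1); first by pbt.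
move=> [r L] l1 l2 /= e; set M := sz r + sz L.
pose (good := fun s : seq item * seq nat =>
  [&& size s.1 <= size L, all (pair_le M) s.1 & all (fun e => sz e <= M) s.2]).
have step s : good s -> good (nstep r s) /\ size (nstep r s).2 <= (size s.2).+1.
  move=> gs; rewrite /nstep; case: ifP => n0; first by split=> //; apply: leqW.
  split=> //; have /and3P[le aL ao] := gs; set x := head _ _.
  have : all (pair_le M) (ndense r s.1).2 by apply: all_ndense.
  rewrite /x; case: (ndense r s.1).2 n0 => //= y l _ /andP[yM _].
  apply/and3P; split=> /=.
  - rewrite size_map size_filter; apply: leq_trans (count_size _ _) le.
  - rewrite all_map; have := aL; rewrite /ncontract.
    elim: (s.1) => //= z t IH /andP[zM /IH h]; case: ifP => //= _; rewrite h andbT.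
    case: ifP => // _; move: zM; rewrite /pair_le /= => /andP[_ ->].
    by rewrite andbT leq_addr.
  - rewrite ao andbT; move: yM; rewrite /pair_le !sz_pair => /andP[_]; lia.
have inv (l : seq item) : good (foldl (fun s _ => nstep r s) (L, [::]) l) /\
    size (foldl (fun s _ => nstep r s) (L, [::]) l).2 <= size l.
  elim/last_ind: l => [|l x [IH1 IH2]].
    split=> //; apply/and3P; split=> //=; apply: sub_all (all_sz L) => x.
    by rewrite /pair_le !sz_pair /M; lia.
  rewrite foldl_rcons size_rcons; have [h1 h2] := step _ IH1; split=> //.
  by apply: leq_trans h2 _.
have [/and3P[s1 a1 a2] s2] := inv l1; set s := foldl _ _ _ in s1 a1 a2 s2 *.
have sl1 : size l1 <= sz L.
  by apply: leq_trans (size_le_sz _); rewrite e size_cat leq_addr.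
have h1 : sz s.1 <= sz L * (M + M).+2 + 1.
  apply: leq_trans (sz_seq_all (M := (M + M).+1) _) _; last first.
    rewrite leq_add2r leq_mul2r (leq_trans s1) ?orbT //; exact: size_le_sz.
  by apply: sub_all a1 => t /andP[h1 h2]; rewrite sz_pair; lia.
have h2 : sz s.2 <= sz L * M.+1 + 1.
  apply: leq_trans (sz_seq_all a2) _.
  by rewrite leq_add2r leq_mul2r (leq_trans s2) ?orbT.
by rewrite sz_pair ltnS leq_add.
Qed.

Lemma ptime_nlook : ptime (fun z : seq (nat * qfrac) * nat => nlook z.1 z.2).
Proof.
apply: (ptime_foldl_add (step := fun z q x => if x.1 == z.2 then x.2 else q)
  (g := fun z => sz z.1)); [by apply: ptime_ite; pt|by pt|by pt|by pbt|].
move=> z q x le; case: ifP => _; last exact: leq_addr.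
by apply: leq_trans (leq_addl _ _); apply: leq_trans (sz_snd_le x) le.
Qed.

Lemma sz_nlook vs v : sz (nlook vs v) <= 7 + sz vs.
Proof.
have : sz ((0, 1) : qfrac) <= 7 + sz vs by exact: (leq_addr _ 7).
have : all (fun x => sz x <= sz vs) vs by apply: all_sz.
rewrite /nlook; move: (sz vs) => M.
elim: vs (0, 1) => //= x vs IH q /andP[xM aM] qM; apply: IH => //.
case: ifP => // _; apply: leq_trans (leq_addl _ _).
by apply: leq_trans (sz_snd_le x) xM.
Qed.

Lemma ptime_nostep :
  ptime (fun z : seq (nat * qfrac) * ((seq nat * seq item) * nedge) =>
           nostep z.1 z.2.1 z.2.2).
Proof.
pose X := (seq (nat * qfrac) * ((seq nat * seq item) * nedge))%type.
have p1 : ptime (fun z : X => has (fun y => y == z.2.2.2.1.1) z.2.1.1).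
  by apply: (ptime_has (p := fun z y => y == z.2.2.2.1.1)); pt.
have p2 : ptime (fun z : X => has (fun y => y == z.2.2.2.1.2) z.2.1.1).
  by apply: (ptime_has (p := fun z y => y == z.2.2.2.1.2)); pt.
have l1 : ptime (fun z : X => nlook z.1 z.2.2.2.1.1).
  by apply: (ptime_comp ptime_nlook (f := fun z => (z.1, z.2.2.2.1.1))); pt.
have l2 : ptime (fun z : X => nlook z.1 z.2.2.2.1.2).
  by apply: (ptime_comp ptime_nlook (f := fun z => (z.1, z.2.2.2.1.2))); pt.
apply: ptime_ite; [by pt|by pt|].
by apply: ptime_ite; pt.
Qed.

Lemma sz_nostep vs s e : sz (nostep vs s e) <= sz s + (sz vs + 3 * sz e + 20).
Proof.
have := sz_nlook vs e.2.1.1; have := sz_nlook vs e.2.1.2.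
rewrite /nostep; case: ifP => _; last case: ifP => _; last by lia.
  by rewrite !sz_pair /= !sz_cons !sz_pair /=; lia.
by rewrite !sz_pair /= !sz_cons !sz_pair /=; lia.
Qed.

Lemma ptime_norient : ptime (fun z : nat * (seq (nat * qfrac) * seq nedge) =>
  norient z.1 z.2.1 z.2.2).
Proof.
apply: (ptime_foldl_add (step := fun z s _ => foldl (nostep z.2.1) s z.2.2)
  (g := fun z => sz z.2.2 * (sz z.2.1 + 3 * sz z.2.2 + 20))).
- apply: (ptime_foldl_add (step := fun y s e => nostep y.1.2.1 s e)
    (g := fun y => sz y.1.2.1 + 3 * sz y.1.2.2 + 20)); [|by pt|by pt|by pbt|].
    by apply: (ptime_comp ptime_nostep (f := fun y => (y.1.1.2.1, (y.2.2, y.2.1)))); pt.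
  by move=> y s e le; have := sz_nostep y.1.2.1 s e; lia.
- by pt.
- by pt.
- by pbt.
- move=> z s a _; apply: (@sz_foldl_add _ _ _ _ _ _ _ (sz z.2.2)) => // s' e le.
  by have := sz_nostep z.2.1 s' e; lia.
Qed.

Lemma ptime_nmain : ptime nmain.
Proof.
apply: (ptime_comp ptime_ngreedy (f := fun x => (x.1, (norient x.1 x.2.1 x.2.2).2))).
by have po := ptime_norient; pt.
Qed.

End ProgramTime.

(** * Correctness of the program *)

Section FractionValues.
Local Open Scope ring_scope.

Definition qval (q : qfrac) : rat := q.1%:R / q.2%:R.
Definition qok (q : qfrac) : bool := (0 < q.2)%N.
Definition qfr (x : rat) : qfrac := (`|numq x|%N, `|denq x|%N).

Lemma qfr_ok x : qok (qfr x).
Proof. by rewrite /qok /qfr /= absz_gt0 denq_neq0. Qed.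

Lemma qfr_val x : 0 <= x -> qval (qfr x) = x.
Proof.
move=> x0; rewrite /qval /qfr /= -[in RHS](divq_num_den x) !natr_absz.
by rewrite !ger0_norm ?numq_ge0 // ltW ?denq_gt0.
Qed.

Lemma qok_fadd p q : qok p -> qok q -> qok (fadd p q).
Proof. by rewrite /qok /= muln_gt0 => -> ->. Qed.

Lemma qval_fadd p q : qok p -> qok q -> qval (fadd p q) = qval p + qval q.
Proof.
case: p q => [a b] [c d]; rewrite /qok /qval /fadd /= => b0 d0.
by rewrite natrD !natrM; field; rewrite !pnatr_eq0 -!lt0n b0 d0.
Qed.

Lemma fsum_val l : all qok l ->
  qok (fsum l) /\ qval (fsum l) = \sum_(q <- l) qval q.
Proof.
rewrite /fsum; suff gen (q : qfrac) : qok q -> all qok l ->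
    qok (foldl fadd q l) /\ qval (foldl fadd q l) = qval q + \sum_(q <- l) qval q.
  by move=> /(gen (0%N, 1%N) isT)[-> ->]; rewrite /qval mul0r add0r.
elim: l q => [|p l IH] q qo /=; first by rewrite big_nil addr0.
move=> /andP[po al]; have [-> ->] := IH _ (qok_fadd qo po) al.
by rewrite qval_fadd // big_cons addrA.
Qed.

Lemma qok_fmul p q : qok p -> qok q -> qok (fmul p q).
Proof. by rewrite /qok /= muln_gt0 => -> ->. Qed.

Lemma qval_fmul p q : qval (fmul p q) = qval p * qval q.
Proof. by rewrite /qval /= !natrM invfM mulrACA. Qed.

Lemma fltE p q : qok p -> qok q -> flt p q = (qval p < qval q).
Proof.
rewrite /qok /flt /qval => p0 q0.
by rewrite ltr_pdivrMr ?ltr0n // mulrAC ltr_pdivlMr ?ltr0n // -!natrM ltr_nat.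
Qed.

End FractionValues.

(** * Numbers in place of vertices and edges *)

Section Simulation.
Local Open Scope ring_scope.
Variables (V E : finType) (r : V) (par ch : E -> V) (K : seq E).
Variables (p c : E -> rat).
Hypotheses (tK : topo r par ch K) (p_ge0 : {in K, forall e, 0 <= p e})
  (c_gt0 : {in K, forall e, 0 < c e}).

Definition eltnum (T : finType) (x : T) : nat := enum_rank x.

Lemma eltnum_inj (T : finType) : injective (@eltnum T).
Proof. by move=> x y /ord_inj/enum_rank_inj. Qed.

Lemma eltnum_eq (T : finType) (x y : T) : (eltnum x == eltnum y) = (x == y).
Proof. exact: inj_eq (@eltnum_inj T) x y. Qed.

Definition ecode (e : E) : item :=
  (eltnum (par e), (eltnum (ch e), (eltnum e, (qfr (p e), qfr (c e))))).

Definition table (o : E -> V) : seq entry := [seq (eltnum (o e), ecode e) | e <- K].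

Local Notation w a := (fun e => p e - a * c e).
Local Notation dzone a := (dzone r par ch K p c a).

Lemma psum_table o v : qok (psum (table o) (eltnum v)) /\
  qval (psum (table o) (eltnum v)) = \sum_(f <- K | o f == v) p f.
Proof.
have -> : psum (table o) (eltnum v) = fsum [seq qfr (p f) | f <- K & o f == v].
  rewrite /psum /table filter_map -map_comp; congr (fsum (map _ _)).
  by apply: eq_filter => f /=; rewrite eltnum_eq.
have [|-> ->] := @fsum_val [seq qfr (p f) | f <- K & o f == v].
  by rewrite all_map; apply/allP => f _; apply: qfr_ok.
rewrite big_map big_filter; split=> //; rewrite big_seq_cond [RHS]big_seq_cond.
by apply: eq_bigr => f /andP[fK _]; rewrite qfr_val ?p_ge0.
Qed.

Lemma csum_table o v : qok (csum (table o) (eltnum v)) /\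
  qval (csum (table o) (eltnum v)) = \sum_(f <- K | o f == v) c f.
Proof.
have -> : csum (table o) (eltnum v) = fsum [seq qfr (c f) | f <- K & o f == v].
  rewrite /csum /table filter_map -map_comp; congr (fsum (map _ _)).
  by apply: eq_filter => f /=; rewrite eltnum_eq.
have [|-> ->] := @fsum_val [seq qfr (c f) | f <- K & o f == v].
  by rewrite all_map; apply/allP => f _; apply: qfr_ok.
rewrite big_map big_filter; split=> //; rewrite big_seq_cond [RHS]big_seq_cond.
by apply: eq_bigr => f /andP[fK _]; rewrite qfr_val ?ltW ?c_gt0.
Qed.

Definition ratio_of (a : rat) (s : qratio) : Prop :=
  [/\ qok s.1, qok s.2, 0 < qval s.2 & a = qval s.1 / qval s.2].

Lemma nabsorb_table a s o e : ratio_of a s ->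
  nabsorb s (table o) (ecode e) = table (absorb par ch K (w a) o e).
Proof.
move=> [ok1 ok2 s2 aE]; rewrite /nabsorb /=.
have [pok pE] := psum_table o (ch e); have [cok cE] := csum_table o (ch e).
have -> : flt (fmul s.1 (csum (table o) (eltnum (ch e))))
    (fmul (psum (table o) (eltnum (ch e))) s.2) = (0 < load K (w a) o (ch e)).
  rewrite fltE ?qok_fmul // !qval_fmul pE cE /load sumrB -mulr_sumr subr_gt0.
  by rewrite aE [in RHS]mulrAC ltr_pdivrMr.
rewrite /absorb; case: ifP => // _; rewrite -map_comp; apply: eq_map => f /=.
by rewrite eltnum_eq; case: ifP.
Qed.

Lemma nelim_table a s : ratio_of a s ->
  nelim s (map ecode K) = table (elim par ch K (w a) ch K).
Proof.
move=> rs; rewrite /nelim -map_comp -/(table ch).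
suff gen l o : foldl (nabsorb s) (table o) (map ecode l) =
    table (elim par ch K (w a) o l) by apply: gen.
by elim: l o => //= e l IH o; rewrite (nabsorb_table _ _ rs).
Qed.

Lemma nzone_dzone a s : ratio_of a s ->
  nzone (eltnum r) s (map ecode K) = [seq ecode e | e <- K & e \in dzone a].
Proof.
move=> rs; rewrite /nzone (nelim_table rs) /table filter_map -map_comp.
congr (map _ _); apply: eq_in_filter => e eK /=.
by rewrite eltnum_eq inE eK.
Qed.

Lemma sum_zone (Z : {set E}) (f : E -> rat) : {subset Z <= K} ->
  \sum_(e <- K | e \in Z) f e = \sum_(e in Z) f e.
Proof.
move=> sZ; rewrite (sum_in_K tK); apply: eq_bigl => e; rewrite inE.
by case eZ: (e \in Z); rewrite ?andbF // sZ.
Qed.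

Lemma fsum_zone (Z : {set E}) (f : E -> rat) : {subset Z <= K} ->
  {in K, forall e, 0 <= f e} ->
  qok (fsum [seq qfr (f e) | e <- K & e \in Z]) /\
  qval (fsum [seq qfr (f e) | e <- K & e \in Z]) = \sum_(e in Z) f e.
Proof.
move=> sZ f0; have [|-> ->] := @fsum_val [seq qfr (f e) | e <- K & e \in Z].
  by rewrite all_map; apply/allP => e _; apply: qfr_ok.
rewrite big_map big_filter -sum_zone //; split=> //.
rewrite big_seq_cond [RHS]big_seq_cond.
by apply: eq_bigr => e /andP[eK _]; rewrite qfr_val ?f0.
Qed.

Definition candidates (Z : {set E}) (a : rat) (l : seq item) : Prop :=
  [/\ upclosed par ch K Z, exists2 e, e \in Z & par e = r, 0 < a,
      \sum_(e in Z) p e = a * \sum_(e in Z) c e &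
      l = [seq ecode e | e <- K & (e \in Z) && (par e == r)]].

(** Every round before the end shrinks the zone strictly, so after [size K] rounds the zone is empty
    and [a] bounds all densities. *)
Definition dense_inv (i : nat) (s : qratio * seq item) : Prop :=
  exists a, [/\ ratio_of a s.1, 0 <= a,
    dzone a = set0 \/ (#|dzone a| + i <= size K)%N &
    (s.2 = [::] /\ a = 0) \/ exists Z, candidates Z a s.2].

Lemma dense_step i s : dense_inv i s ->
  dense_inv i.+1 (nimprove (eltnum r) (map ecode K) s).
Proof.
move=> [a [rs a0 small cand]]; rewrite /nimprove (nzone_dzone rs).
have [z0|z0] := eqVneq (dzone a) set0.
  have -> : [seq ecode e | e <- K & e \in dzone a] = [::].
    by rewrite z0 (eq_filter (a2 := pred0)) ?filter_pred0 // => e; rewrite inE.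
  by exists a; split=> //; left.
set l := [seq ecode e | e <- K & e \in dzone a].
have -> : nilp l = false.
  have /set0Pn[e ez] := z0; apply/negbTE; rewrite /nilp size_map size_filter -lt0n -has_count.
  by apply/hasP; exists e => //; apply: zone_sub ez.
have sz : {subset dzone a <= K} by apply: zone_sub.
have C0 : 0 < \sum_(e in dzone a) c e by exact: (sum_cost_gt0 c_gt0 sz z0).
have [pok pE] := fsum_zone sz p_ge0.
have [cok cE] := fsum_zone sz (fun e eK => ltW (c_gt0 eK)).
pose b := (\sum_(e in dzone a) p e) / (\sum_(e in dzone a) c e).
have bE : \sum_(e in dzone a) p e = b * \sum_(e in dzone a) c e.
  by rewrite divfK // gt_eqF.
have [ab zz] := dzone_improves tK c_gt0 z0 bE.
exists b; split=> /=.
- by rewrite /l -!map_comp; split; rewrite /= ?pok ?cok ?cE ?pE.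
- by rewrite ltW // (le_lt_trans a0).
- right; case: small => [h|h]; first by rewrite h eqxx in z0.
  by have := proper_card zz; lia.
- right; exists (dzone a); split=> //.
  + exact: zone_closed.
  + exact: zone_root.
  + exact: le_lt_trans ab.
  + rewrite /l filter_map -filter_predI; congr (map _ _); apply: eq_filter => e /=.
    by rewrite eltnum_eq andbC.
Qed.

Lemma denseP : exists a,
  [/\ 0 <= a, forall F, upclosed par ch K F ->
      \sum_(f in F) p f <= a * \sum_(f in F) c f &
  ((ndense (eltnum r) (map ecode K)).2 = [::] /\ a = 0) \/
  exists Z, candidates Z a (ndense (eltnum r) (map ecode K)).2].
Proof.
have inv l : dense_inv (size l) (foldl (fun s (_ : item) =>
    nimprove (eltnum r) (map ecode K) s) (((0%N, 1%N), (1%N, 1%N)), [::]) l).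
  elim/last_ind: l => [|l x IH]; last by rewrite foldl_rcons size_rcons; apply: dense_step.
  exists 0; split; [|by []|right|by left].
    by split; rewrite // /qval /= ?mul0r ?divr1 ?ltr01.
  rewrite addn0 cardE; apply: uniq_leq_size; first exact: enum_uniq.
  by move=> e; rewrite mem_enum; apply: zone_sub.
have [a [_ a0 small cand]] := inv (map ecode K).
exists a; split=> //; move=> F cF; apply: (dzone_max tK) => //.
case: small => // le; apply/eqP; rewrite -cards_eq0.
by move: le; rewrite size_map; lia.
Qed.

End Simulation.

Section Correctness.
Local Open Scope ring_scope.
Variables (V E : finType) (I : instance rat V E).
Hypotheses (VI : valid I) (TI : is_tree I).
Local Notation r := (root I).
Local Notation par := (opar I).
Local Notation ch := (och I).
Local Notation K := (map fst (orient I).2).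
Local Notation prizes := (fun e => prize I (ch e)).
Local Notation kcode X :=
  [seq ecode (pcon I par ch X) ch prizes (cost I) e | e <- kcon K X].

Lemma inst_arb : arb I par ch K.
Proof. exact: tree_arb. Qed.

Lemma pcon_add X e f :
  pcon I par ch (e |: X) f =
  if pcon I par ch X f == ch e then r else pcon I par ch X f.
Proof.
rewrite /pcon imsetU1 !inE; case: (boolP (par f == r)) => //= nr.
  by case: ifP.
by case: (par f \in ch @: X); rewrite ?orbT ?orbF //=; case: ifP.
Qed.

Definition step_inv (i : nat) (s : seq item * seq nat) : Prop :=
  exists pi, [/\ dg_reach I pi,
    s = (kcode [set e in pi], [seq eltnum e | e <- rev pi]) &
    uncollected I pi = 0 \/ size pi = i].

Lemma step_inv_next i s : step_inv i s -> step_inv i.+1 (nstep (eltnum r) s).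
Proof.
move=> [pi [rp -> small]]; have AI := inst_arb.
have [cX un _] := dg_run AI VI rp; set X := [set e in pi] in cX *.
have AX := arb_contract AI cX.
have tX : topo r (pcon I par ch X) ch (kcon K X) := arb_topo AX.
have sKX : {subset kcon K X <= K} by move=> e; rewrite mem_kcon => /andP[].
have p0 : {in kcon K X, forall e, 0 <= prizes e}.
  by move=> e /sKX; apply: (prize_ge0 AI VI).
have c0 : {in kcon K X, forall e, 0 < cost I e}.
  by move=> e /sKX; apply: (cost_gt0 AI VI).
have [a [a0 amax [[nil aE]|[Z [cZ [e eZ pe] apos ZE lE]]]]] := denseP tX p0 c0.
  (* No candidate means that 0 bounds the densities, hence no prize is left. *)
  rewrite /nstep nil; exists pi; split=> //; left.
  rewrite (uncollected_closed AI) //; apply/eqP.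
  have sD : {subset kset K :\: X <= K} by move=> f; rewrite !inE => /andP[].
  rewrite eq_le (sprize_ge0 AI VI) // andbT.
  have := amax (kset K :\: X); rewrite aE mul0r; apply.
  apply/closedP; split=> [f|f g].
    by rewrite mem_kcon !inE.
  by move=> _ /and3P[_]; rewrite mem_kcon !inE.
have hl : head item0 (ndense (eltnum r) (kcode X)).2 \in
    [seq ecode (pcon I par ch X) ch prizes (cost I) e
    | e <- kcon K X & (e \in Z) && (pcon I par ch X e == r)].
  rewrite lE; set l := filter _ _; have el : e \in l.
    by rewrite mem_filter eZ pe eqxx /= (closed_sub cZ).
  by case: l el => // f l _; rewrite mem_head.
rewrite /nstep; have -> : nilp (ndense (eltnum r) (kcode X)).2 = false.
  by move: hl; rewrite lE; case: (filter _ _).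
case/mapP: hl => f; rewrite mem_filter => /andP[/andP[fZ /eqP pf] fK] ->.
have aZ : adm par ch K X Z by rewrite -(closed_contract AI).
have pf' : par f \in r |: ch @: X.
  by move: pf; rewrite /pcon; case: ifP => // nS pr; rewrite -nS pr !inE eqxx.
have ZE' : sprize I ch Z = a * scost I Z by [].
have maxX F : adm par ch K X F -> sprize I ch F <= a * scost I F.
  by rewrite -(closed_contract AI) // => /amax.
(* [Z] has maximum density but need not be minimal; the root edge [f] picked by the program still
   lies in some min-max subtree. *)
have [F bF fF] := best_exists AI cX aZ fZ pf' apos ZE' maxX.
have u0 : uncollected I pi != 0.
  rewrite (uncollected_closed AI) // gt_eqF //.
  apply: lt_le_trans (_ : sprize I ch Z <= _).
    rewrite ZE' mulr_gt0 //; apply: (scost_gt0 AI VI); first exact: adm_sub aZ.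
    by apply/set0Pn; exists f.
  rewrite (sprizeID _ _ (kset K :\: X) Z) (setIidPr _) ?lerDl.
    by apply: (sprize_ge0 AI VI) => g; rewrite !inE => /and3P[].
  apply/subsetP => g gZ; rewrite in_setD [g \in kset _]inE (adm_sub aZ gZ) andbT.
  by have /andP[dZ _] := aZ; rewrite (disjointFr dZ gZ).
exists (rcons pi f); split.
- exact: (dg_step_best AI VI rp u0 bF fF pf').
- congr pair; last by rewrite rev_rcons.
  rewrite /ncontract filter_map -map_comp set_rcons -/X.
  have -> : kcon K (f |: X) = [seq g <- kcon K X | g != f].
    rewrite /kcon -filter_predI; apply: eq_filter => g /=.
    by rewrite !inE negb_or.
  have -> : [seq g <- kcon K X | preim (ecode (pcon I par ch X) ch prizes (cost I))
      (fun y : item => iname y != eltnum f) g] = [seq g <- kcon K X | g != f].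
    by apply: eq_filter => g /=; rewrite eltnum_eq.
  apply: eq_map => g /=; rewrite /ecode /= pcon_add eltnum_eq.
  by case: ifP.
- by right; case: small => [u|<-]; [rewrite u eqxx in u0|rewrite size_rcons].
Qed.

Lemma ngreedyP : exists2 pi, dg_output I pi &
  ngreedy (eltnum r) [seq ecode par ch prizes (cost I) e | e <- K] =
  [seq eltnum e | e <- pi].
Proof.
have AI := inst_arb.
set L := map _ K.
have inv l : step_inv (size l) (foldl (fun s (_ : item) => nstep (eltnum r) s)
    (L, [::]) l).
  elim/last_ind: l => [|l x IH]; last first.
    by rewrite foldl_rcons size_rcons; apply: step_inv_next.
  exists [::]; split; [exact: dg_start| |by right].
  have -> : [set e in [::]] = set0 :> {set E} by apply/setP => e; rewrite !inE.
  congr pair; rewrite /kcon (eq_filter (a2 := predT)) ?filter_predT.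
    apply: eq_map => e; rewrite /ecode; congr (eltnum _, _).
    by rewrite /pcon imset0 setU0 inE; case: eqP.
  by move=> e; rewrite inE.
have [pi [rp sE small]] := inv L.
exists pi; last by rewrite /ngreedy sE /= map_rev revK.
split=> //; case: small => // szp.
have [cX un _] := dg_run AI VI rp.
rewrite (uncollected_closed AI) //.
(* If every round has added an edge, all edges have been taken. *)
suff -> : kset K :\: [set e in pi] = set0 by rewrite /sprize big_set0.
have sub : {subset pi <= K} by move=> e epi; apply: (closed_sub cX); rewrite inE.
have szK : (size K <= size pi)%N by rewrite szp /L !size_map.
have [_ eqK] := uniq_min_size un sub szK.
by apply/setP => e; rewrite !inE -eqK andNb.
Qed.

Definition vcode := [seq (eltnum v, qfr (prize I v)) | v <- enum (vset I)].
Definition edcode (e : E) : nedge :=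
  (eltnum e, ((eltnum (ends I e).1, eltnum (ends I e).2), qfr (cost I e))).
Definition tcode (x : E * (V * V)) : item :=
  (eltnum x.2.1, (eltnum x.2.2, (eltnum x.1,
     (qfr (prize I x.2.2), qfr (cost I x.1))))).
Definition scode (s : seq V * seq (E * (V * V))) : seq nat * seq item :=
  (map (@eltnum V) s.1, map tcode s.2).

Lemma nlook_vcode v : v \in vset I -> nlook vcode (eltnum v) = qfr (prize I v).
Proof.
rewrite -mem_enum /nlook /vcode.
suff gen l q : foldl (fun q (x : nat * qfrac) => if x.1 == eltnum v then x.2 else q) q
    [seq (eltnum u, qfr (prize I u)) | u <- l] =
    if v \in l then qfr (prize I v) else q by rewrite gen => ->.
elim: l q => //= u l IH q; rewrite IH eltnum_eq inE [v == u]eq_sym.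
by have [->|_] := eqVneq u v; case: (_ \in l).
Qed.

Lemma has_eltnum (s : seq V) v :
  has (fun z => z == eltnum v) (map (@eltnum V) s) = (v \in s).
Proof.
rewrite has_map; apply/hasP/idP => [[u us /=]|vs]; last by exists v => /=.
by rewrite eltnum_eq => /eqP <-.
Qed.

Lemma nostep_code s e : e \in eset I ->
  nostep vcode (scode s) (edcode e) = scode (ostep I s e).
Proof.
move=> eE; have [_ endsV _ _] := VI; have [h1 h2] := endsV _ eE.
rewrite /nostep /ostep /= !has_eltnum !nlook_vcode //.
by case: ifP => // _; case: ifP.
Qed.

Lemma norient_code :
  norient (eltnum r) vcode [seq edcode e | e <- enum (eset I)] = scode (orient I).
Proof.
have scan s l : {subset l <= eset I} ->
    foldl (nostep vcode) (scode s) (map edcode l) = scode (foldl (ostep I) s l).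
  elim: l s => //= e l IH s sl; rewrite nostep_code ?IH //.
    by move=> f fl; apply: sl; rewrite inE fl orbT.
  by apply: sl; rewrite mem_head.
rewrite /norient /orient (_ : ([:: eltnum r], [::]) = scode ([:: r], [::])) //.
have sE : {subset enum (eset I) <= eset I} by move=> e; rewrite mem_enum.
suff gen (l : seq E) s : foldl (fun s (_ : nedge) =>
    foldl (nostep vcode) s [seq edcode e | e <- enum (eset I)]) (scode s)
    (map edcode l) = scode (foldl (fun s (_ : E) => oscan I s) s l) by apply: gen.
by elim: l s => //= e l IH s; rewrite scan // IH.
Qed.

Lemma nmain_correct : exists2 pi, dg_output I pi &
  nmain (eltnum r, (vcode, [seq edcode e | e <- enum (eset I)])) =
  [seq eltnum e | e <- pi].
Proof.
have [pi out piE] := ngreedyP; exists pi => //.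
rewrite /nmain /= norient_code -piE /scode /=; congr ngreedy.
rewrite -map_comp; apply/eq_in_map => x /orient_assoc[xp xc].
by rewrite /tcode /ecode /= xp xc.
Qed.

Lemma enc_instanceE :
  enc_instance I = enc (eltnum r, (vcode, [seq edcode e | e <- enum (eset I)])).
Proof.
rewrite /enc_instance /enc /enc_of_prod /= /enc /enc_of_prod /enc_of_seq /=.
by rewrite /vcode -!map_comp.
Qed.

Lemma enc_outputE (pi : seq E) : enc_output pi = enc [seq eltnum e | e <- pi].
Proof. by rewrite /enc_output /enc /enc_of_seq -map_comp. Qed.

End Correctness.

Local Open Scope ring_scope.

Theorem theorem1 (R : realType) :
  (exists (P : program) (a k : nat),
     forall (V E : finType) (I : instance rat V E), valid I -> is_tree I ->
       exists (pi : seq E) (t : nat),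
         [/\ dg_output I pi,
             computes P (enc_instance I) (enc_output pi) t
           & (t <= a * dsize (enc_instance I) ^ k + a)%N])
  /\
  (forall (V E : finType) (I : instance R V E), valid I -> is_tree I ->
     forall (chi alpha mu : R), is_ecc I chi -> chi <= alpha -> 1 <= mu ->
     forall pi : seq E, dg_output I pi ->
     forall B : R, 0 <= B -> forall T, is_opt I B T ->
       total_prize I T <= mu * total_prize I (alg I pi (B + alpha)))
  /\
  (forall chi alpha : R, 0 < chi -> 0 <= alpha -> alpha < chi ->
     exists (V E : finType) (I : instance R V E),
       [/\ valid I, is_tree I, is_ecc I chi, exists pi : seq E, dg_output I pi
         & forall mu : R, 1 <= mu ->
           forall pi : seq E, dg_output I pi ->
           exists2 B : R, 0 <= B &
             exists2 T, is_opt I B T &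
               mu * total_prize I (alg I pi (B + alpha)) < total_prize I T]).
Proof.
split; [|split].
- have [P [a [k hP]]] := ptime_program ptime_nmain.
  exists P, a, k => V E I vI tI.
  have [pi out piE] := nmain_correct vI tI.
  have := hP (eltnum (root I), (vcode I, [seq edcode I e | e <- enum (eset I)])).
  rewrite piE -enc_outputE -enc_instanceE => -[t ct le].
  by exists pi, t.
- move=> V E I vI tI chi alpha mu ecc le mu1 pi out B B0 T opt.
  exact: (competitive (tree_arb vI tI) vI ecc le mu1 out B0 opt).
(* Half of the gap, so that [eps + alpha] stays below [chi]. *)
- move=> chi alpha chi0 a0 lt; pose eps := (chi - alpha) / 2.
  have eps0 : 0 < eps by rewrite divr_gt0 // subr_gt0.
  have eps2 : eps + alpha < chi.
    have : eps * 2 = chi - alpha by rewrite divfK // pnatr_eq0.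
    by move: eps0; lra.
  have eps1 : eps < chi by move: eps2 a0; lra.
  exists (option bool), bool, (star chi eps); split.
  + exact: star_valid.
  + exact: star_tree.
  + exact: star_ecc.
  + by exists [:: true; false]; apply: star_output.
  + move=> mu mu1 pi out; exists eps; first exact: ltW.
    have [opt h] := star_not_competitive eps0 eps1 mu a0 eps2 out.
    by exists (tree_of (star chi eps) Some [set false]).
Qed.
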